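(* Let $\mathcal W=W_{\rm lin}$ be the linear elastic energy density $$W_{\rm lin}(d,\varepsilon)=\tfrac12(\varepsilon-d\,\underline\varepsilon):C(\varepsilon-d\,\underline\varepsilon),\qquad d\in\mathbb R,\ \varepsilon\in\mathbb R^{D\times D}_{\rm sym},$$ with a constant $\underline\varepsilon\in\mathbb R^{D\times D}_{\rm sym}$, for a homogeneous material, i.e. the symmetric positive definite elasticity tensor $C$ (mapping $\mathbb R^{D\times D}_{\rm sym}$ to itself) is independent of $d$. Let $M\equiv1$, and let the initial data $a_0,b_0:\Omega\to\mathbb R$ satisfy $0\le a_0+b_0\le1$, $0\le a_0-b_0\le1$ and $\mathcal W(a_0+b_0,\varepsilon(\mathbf u(x,0)))<\infty$, where $\mathbf u(\cdot,0)$ is the solution of $\mathrm{div}\big(\partial_\varepsilon\mathcal W(a_0+b_0,\varepsilon(\mathbf u))\big)=\mathbf 0$ with $\partial_\varepsilon\mathcal W(a_0+b_0,\varepsilon(\mathbf u))\,\mathbf n=\sigma_{\rm ext}\mathbf n$ on $\partial\Omega$. Then the weak solution $(a,b,\mathbf u)$ of $$\partial_t a=\lambda\,\Delta\frac{\partial F}{\partial a},\qquad \partial_t b=-\frac{\partial F}{\partial b},\qquad \mathbf 0=\mathrm{div}\big(\partial_\varepsilon\mathcal W(a+b,\varepsilon(\mathbf u))\big)\quad\text{in }\Omega_{\mathcal T},$$ with the initial and boundary conditions given in the context, having the properties (i) $a,b\in C^{0,\frac14}([0,\mathcal T];L^2(\Omega))$, (ii) $\partial_t a\in L^2(0,\mathcal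 T;H^1(\Omega)^* )$, $\partial_t b\in L^2(\Omega_{\mathcal T})$, (iii) $\mathbf u\in L^\infty(0,\mathcal T;H^1(\Omega;\mathbb R^D))$, (iv) $0\le a+b\le1$ and $0\le a-b\le1$ in $\Omega_{\mathcal T}$, is unique in this class: any two weak solutions with the same initial data and with properties (i)–(iv) coincide.
   Context: $\Omega\subset\mathbb R^D$, $D\ge1$, is a bounded domain with Lipschitz boundary and outer unit normal $\mathbf n$; $\mathcal T>0$ and $\Omega_{\mathcal T}=\Omega\times(0,\mathcal T)$. $\lambda,\theta,\kappa_1,\kappa_2>0$ are constants. $\mathbb R^{D\times D}_{\rm sym}$ denotes symmetric matrices, $A:B=\mathrm{tr}(A^tB)$, and $\varepsilon(\mathbf u)=\frac12(\nabla\mathbf u+\nabla\mathbf u^t)$ for a displacement $\mathbf u$. $\sigma_{\rm ext}\in\mathbb R^{D\times D}_{\rm sym}$ is a constant applied stress. The order parameters $a,b$ are scalar and real-valued. The free energy is $$F(a,b,\mathbf u)=\int_\Omega\psi(a,b)+\frac\lambda2\big(|\nabla a|^2+|\nabla b|^2\big)+\mathcal W(a+b,\varepsilon(\mathbf u))-\varepsilon(\mathbf u):\sigma_{\rm ext}\,dx ,$$ with $\psi(a,b)=\frac{\theta}{2}\big(g(a+b)+g(a-b)\big)+\kappa_1a(1-a)-\kappa_2b^2$, $g(s)=s\ln s+(1-s)\ln(1-s)$ (with $0\ln0=0$), and $\frac{\partial F}{\partial a},\frac{\partial F}{\partial b}$ are its variational derivatives. Initial conditions: $a(0)=a_0$,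 $b(0)=b_0$ in $\Omega$. Boundary conditions on $\partial\Omega$, $t>0$: $\nabla a\cdot\mathbf n=\nabla b\cdot\mathbf n=0$, $\nabla\frac{\partial F}{\partial a}\cdot\mathbf n=0$, and $\sigma\mathbf n=\sigma_{\rm ext}\mathbf n$ with $\sigma=\partial_\varepsilon\mathcal W(a+b,\varepsilon(\mathbf u))$. Weak solution means: $a(0)=a_0$, $b(0)=b_0$, $a,b\in L^2(0,\mathcal T;H^1(\Omega))$, and there is a chemical potential $\mu\in L^2(0,\mathcal T;H^1(\Omega))$ such that all integrals below are well defined and $$\int_{\Omega_{\mathcal T}}-(a-a_0)\partial_t\xi+\lambda \nabla\mu\cdot\nabla\xi\,dx\,dt=0,$$ $$\int_{\Omega_{\mathcal T}}\mu\zeta\,dx\,dt=\int_{\Omega_{\mathcal T}}\Big[\tfrac\theta2\big(g'(a+b)+g'(a-b)\big)+\kappa_1(1-2a)+\partial_d\mathcal W(a+b,\varepsilon(\mathbf u))\Big]\zeta+\lambda\nabla a\cdot\nabla\zeta\,dx\,dt,$$ $$\int_{\Omega_{\mathcal T}}\Big[\partial_tb+\tfrac\theta2\big(g'(a+b)-g'(a-b)\big)-2\kappa_2b+\partial_d\mathcal W(a+b,\varepsilon(\mathbf u))\Big]\eta+\lambda\nabla b\cdot\nabla\eta\,dx\,dt=0,$$ $$\int_{\Omega_{\mathcal T}}\big(\partial_\varepsilon\mathcal W(a+b,\varepsilon(\mathbf u))-\sigma_{\rm ext}\big):\varepsilon(\mathbf v)\,dx\,dt=0$$ for all $\xi,\zeta,\eta\in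 L^2(0,\mathcal T;H^1(\Omega))\cap L^\infty(\Omega_{\mathcal T})$ with $\partial_t\xi\in L^2(\Omega_{\mathcal T})$, $\xi(\mathcal T)=0$, and all $\mathbf v\in L^2(0,\mathcal T;H^1(\Omega;\mathbb R^D))$.
   Formalization: The displacements are shown to coincide only up to infinitesimal rigid displacements (for a.e. t); literal equality of u fails, since adding a constant vector to u yields another weak solution with the same data and properties (i)–(iv). *)

(* Defs.v *)
From HB Require Import structures.
From mathcomp Require Import all_boot all_order all_algebra.
From mathcomp Require Import all_classical all_reals all_analysis.

Set Implicit Arguments.
Unset Strict Implicit.
Unset Printing Implicit Defensive.

Import Order.TTheory GRing.Theory Num.Theory.
Import numFieldNormedType.Exports.

Local Open Scope classical_set_scope.
Local Open Scope ring_scope.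

(* Borel sigma-algebra of R^n, generated by the coordinate maps. *)
Section row_vector_measurable.
Context {R : realType} {n : nat}.

Definition row_coord (i : 'I_n) (x : 'rV[R]_n) : R := x ord0 i.

Let row_set0 : g_sigma_preimage row_coord set0.
Proof. exact: sigma_algebra0. Qed.

Let row_setC A : g_sigma_preimage row_coord A ->
  g_sigma_preimage row_coord (~` A).
Proof. exact: sigma_algebraC. Qed.

Let row_bigcup (F : (set 'rV[R]_n)^nat) :
  (forall i, g_sigma_preimage row_coord (F i)) ->
  g_sigma_preimage row_coord (\bigcup_i (F i)).
Proof. exact: sigma_algebra_bigcup. Qed.

HB.instance Definition _ := @isMeasurable.Build default_measure_display
  'rV[R]_n (g_sigma_preimage row_coord) row_set0 row_setC row_bigcup.

Lemma measurable_row_coord (i : 'I_n) : measurable_fun [set: 'rV[R]_n] (row_coord i).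
Proof.
move=> _ Y mY; rewrite setTI; apply: sub_sigma_algebra => /=.
rewrite -bigcup_seq/=; exists i => /=; first by rewrite mem_index_enum.
by exists Y => //; rewrite setTI.
Qed.

End row_vector_measurable.

Lemma prod_sigma_finite d1 d2 (T1 : measurableType d1) (T2 : measurableType d2)
    (R : realType) (m1 : {sigma_finite_measure set T1 -> \bar R})
    (m2 : {sigma_finite_measure set T2 -> \bar R}) :
  sigma_finite setT (m1 \x m2)%E.
Proof.
have /sigma_finiteP[F [TF ndF Foo]] := sigma_finiteT m1.
have /sigma_finiteP[G [TG ndG Goo]] := sigma_finiteT m2.
exists (fun k => F k `*` G k) => [|k].
  rewrite -setXTT TF TG predeqE => -[x y]; split; last first.
    by move=> [k _ []/= ? ?]; split; exists k.
  move=> [/= [k _ Fx] [l _ Gy]]; exists (maxn k l) => //; split.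
  - by move: x Fx; exact/subsetPset/ndF/leq_maxl.
  - by move: y Gy; exact/subsetPset/ndG/leq_maxr.
have [? ?] := Foo k; have [? ?] := Goo k.
split; first exact: measurableX.
by rewrite product_measure1E// lte_mul_pinfty// ge0_fin_numE.
Qed.

Section lebesgue_row_step.
Context {R : realType} {n : nat}.

Definition row_cons (p : R * 'rV[R]_n) : 'rV[R]_n.+1 :=
  \row_i oapp (fun j => p.2 ord0 j) p.1 (unlift ord0 i).

Definition row_uncons (x : 'rV[R]_n.+1) : R * 'rV[R]_n :=
  (x ord0 ord0, \row_j x ord0 (lift ord0 j)).

Lemma row_consK : cancel row_cons row_uncons.
Proof.
move=> [t y]; rewrite /row_cons /row_uncons mxE unlift_none /=; congr pair.
by apply/rowP => j; rewrite !mxE liftK.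
Qed.

Lemma row_unconsK : cancel row_uncons row_cons.
Proof.
move=> x; apply/rowP => i; rewrite mxE /row_uncons.
by case: unliftP => [j|] -> /=; rewrite ?mxE.
Qed.

Lemma measurable_to_row d (T : measurableType d) k (f : T -> 'rV[R]_k) :
  (forall i, measurable_fun [set: T] (fun x => f x ord0 i)) ->
  measurable_fun [set: T] f.
Proof.
move=> mf.
suff sub : g_sigma_preimage (@row_coord R k) `<=`
    [set B | measurable (f @^-1` B)].
  by move=> _ B /sub; rewrite setTI.
apply: smallest_sub.
  split => /=; first by rewrite preimage_set0.
  - by move=> A mA; rewrite setTD preimage_setC; exact: measurableC.
  - by move=> F mF; rewrite preimage_bigcup; exact: bigcupT_measurable.
move=> B; rewrite -bigcup_seq => -[i _] [C mC <-] /=.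
rewrite setTI -comp_preimage -[X in measurable X]setTI.
exact: mf.
Qed.

Lemma measurable_row_cons : measurable_fun [set: R * 'rV[R]_n] row_cons.
Proof.
apply: measurable_to_row => i.
have [j ->|->] := unliftP ord0 i.
- rewrite (_ : (fun _ => _) = row_coord j \o snd).
    exact: measurableT_comp (measurable_row_coord j) measurable_snd.
  by apply/funext => p; rewrite /= mxE liftK.
- rewrite (_ : (fun _ => _) = fst); first exact: measurable_fst.
  by apply/funext => p; rewrite mxE unlift_none.
Qed.

Lemma measurable_row_uncons : measurable_fun [set: 'rV[R]_n.+1] row_uncons.
Proof.
apply: measurable_fun_pair; first exact: (measurable_row_coord ord0).
apply: measurable_to_row => i.
rewrite (_ : (fun _ => _) = row_coord (lift ord0 i)).
  exact: measurable_row_coord.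
by apply/funext => x; rewrite /= mxE.
Qed.

Variable mu : {sigma_finite_measure set 'rV[R]_n -> \bar R}.

Definition lebesgue_row_step : set 'rV[R]_n.+1 -> \bar R :=
  pushforward (@lebesgue_measure R \x mu)%E row_cons.

HB.instance Definition _ := Measure.copy lebesgue_row_step
  (measure_function_pushforward__canonical__measure_function_Measure
     (@lebesgue_measure R \x mu)%E measurable_row_cons).

Let lebesgue_row_step_sigma_finite : sigma_finite setT lebesgue_row_step.
Proof.
have [F FT Ffin] := prod_sigma_finite (@lebesgue_measure R) mu.
have pre A : row_cons @^-1` (row_uncons @^-1` A) = A.
  by apply/seteqP; split => p /=; rewrite row_consK.
exists (fun k => row_uncons @^-1` F k) => [|k].
  by rewrite -preimage_bigcup -FT preimage_setT.
split; last by rewrite /lebesgue_row_step /pushforward pre; case: (Ffin k).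
rewrite -[X in measurable X]setTI.
by apply: measurable_row_uncons => //; case: (Ffin k).
Qed.

HB.instance Definition _ := Measure_isSigmaFinite.Build _ _ _
  lebesgue_row_step lebesgue_row_step_sigma_finite.

End lebesgue_row_step.

Fixpoint lebesgue_row {R : realType} (n : nat) :
    {sigma_finite_measure set 'rV[R]_n -> \bar R} :=
  match n with
  | 0 => \d_(0 : 'rV[R]_0)
  | n'.+1 => lebesgue_row_step (lebesgue_row n')
  end.

Lemma lebesgue_row_box {R : realType} n (A : 'I_n -> set R) :
  (forall i, measurable (A i)) ->
  lebesgue_row n [set x : 'rV[R]_n | forall i, A i (x ord0 i)] =
  (\prod_(i < n) lebesgue_measure (A i))%E.
Proof.
elim: n A => [|n IH] A mA.
  rewrite big_ord0 /= diracE mem_set //=; by case.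
rewrite big_ord_recl /= /lebesgue_row_step /pushforward.
rewrite (_ : _ @^-1` _ =
    A ord0 `*` [set y : 'rV[R]_n | forall i, A (lift ord0 i) (y ord0 i)]).
  rewrite product_measure1E; first by congr (_ * _)%E; exact: IH.
    exact: mA.
  rewrite [X in measurable X](_ : _ =
      \big[setI/setT]_(i < n) (row_coord i @^-1` A (lift ord0 i))).
    apply: bigsetI_measurable => i _.
    by rewrite -[X in measurable X]setTI; exact: measurable_row_coord.
  rewrite -bigcap_seq; apply/seteqP; split => [x /= + i _|x /= + i]; first exact.
  by apply => /=; rewrite mem_index_enum.
apply/seteqP; split => [[t y] /= H|[t y] /= [At Ay] i].
  split; first by have := H ord0; rewrite mxE unlift_none.
  by move=> i; have := H (lift ord0 i); rewrite mxE liftK.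
rewrite mxE; by case: unliftP => [j|] -> /=.
Qed.

Section test_functions.
Context {R : realType} {V : normedModType R}.

Definition iter_derive (f : V -> R) (vs : seq V) : V -> R :=
  foldr (fun v h => 'D_v h) f vs.

Definition smooth (f : V -> R) : Prop := forall vs : seq V,
  continuous (iter_derive f vs) /\
  forall x v, derivable (iter_derive f vs) x v.

(* C^oo_c(U) *)
Definition test_function (U : set V) (phi : V -> R) : Prop :=
  smooth phi /\
  exists K, [/\ compact K, K `<=` U & forall x, ~ K x -> phi x = 0].

End test_functions.

Section algebra.
Context {R : realType} {D : nat}.

Definition dot (x y : 'rV[R]_D) : R := \sum_i x ord0 i * y ord0 i.

(* A : B *)
Definition frob (A B : 'M[R]_D) : R := \tr (A^T *m B).

Definition sym_part (G : 'M[R]_D) : 'M[R]_D := 2^-1 *: (G + G^T).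

End algebra.

Section domain.
Context {R : realType} {D : nat}.

(* Near each boundary point, [Omega] is the strict epigraph, in the direction
   of a unit vector [e], of a Lipschitz function [gam] of the component of [x]
   orthogonal to [e]. *)
Definition lipschitz_boundary (Omega : set 'rV[R]_D) : Prop :=
  forall p, (closure Omega `\` Omega) p ->
  exists (e : 'rV[R]_D) (gam : 'rV[R]_D -> R) (U : set 'rV[R]_D),
    [/\ dot e e = 1, lipschitz gam, nbhs p U &
        forall x, U x -> (Omega x <-> gam (x - dot x e *: e) < dot x e)].

Definition lipschitz_domain (Omega : set 'rV[R]_D) : Prop :=
  [/\ Omega !=set0, open Omega, connected Omega, bounded_set Omega &
      lipschitz_boundary Omega].

End domain.

Section function_spaces.
Context {R : realType} {D : nat}.
Local Notation vec := 'rV[R]_D.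
Local Notation leb1 := (@lebesgue_measure R).
Local Notation lebD := (@lebesgue_row R D).

Definition spacetime_measure : {measure set (measurableTypeR R * vec) -> \bar R} :=
  (leb1 \x lebD)%E.

Definition cylinder (T : R) (Omega : set vec) : set (R * vec) :=
  `]0, T[%classic `*` Omega.

Definition in_L2 d (X : measurableType d) (m : {measure set X -> \bar R})
    (A : set X) (f : X -> R) : Prop :=
  measurable_fun A f /\ (\int[m]_(x in A) (f x ^+ 2)%:E < +oo)%E.

Definition L2_norm (Omega : set vec) (f : vec -> R) : R :=
  Num.sqrt (\int[lebD]_(x in Omega) (f x ^+ 2)).

(* [v] belongs to H^1(Omega) with weak gradient [Dv]. *)
Definition in_H1 (Omega : set vec) (v : vec -> R) (Dv : vec -> vec) : Prop :=
  [/\ in_L2 lebD Omega v,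
      forall i, in_L2 lebD Omega (fun x => Dv x ord0 i) &
      forall phi, test_function Omega phi -> forall i,
        \int[lebD]_(x in Omega) (v x * 'D_(delta_mx ord0 i) phi x) =
        - \int[lebD]_(x in Omega) (Dv x ord0 i * phi x)].

Definition H1_sqnorm (Omega : set vec) (v : vec -> R) (Dv : vec -> vec)
    : \bar R :=
  (\int[lebD]_(x in Omega) (v x ^+ 2 + dot (Dv x) (Dv x))%:E)%E.

(* [f] is a jointly measurable representative of a measurable map
   ]0, T[ -> H^1(Omega), with spatial gradient [Df]. *)
Definition measurable_H1 (T : R) (Omega : set vec) (f : R -> vec -> R)
    (Df : R -> vec -> vec) : Prop :=
  [/\ measurable_fun (cylinder T Omega) (fun p : R * vec => f p.1 p.2),
      forall i, measurable_fun (cylinder T Omega)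
        (fun p : R * vec => Df p.1 p.2 ord0 i) &
      \forall t \ae leb1, 0 < t < T -> in_H1 Omega (f t) (Df t)].

Definition in_L2H1 (T : R) (Omega : set vec) (f : R -> vec -> R)
    (Df : R -> vec -> vec) : Prop :=
  measurable_H1 T Omega f Df /\
  (\int[leb1]_(t in `]0%R, T[) H1_sqnorm Omega (f t) (Df t) < +oo)%E.

(* Vector fields: row [i] of [Dv x] is the gradient of the component [i], so
   that [Dv x i j] is the derivative of the component [i] along axis [j]. *)
Definition in_H1v (Omega : set vec) (v : vec -> vec) (Dv : vec -> 'M[R]_D)
    : Prop :=
  forall i, in_H1 Omega (fun x => v x ord0 i) (fun x => row i (Dv x)).

Definition measurable_H1v (T : R) (Omega : set vec) (u : R -> vec -> vec)
    (Du : R -> vec -> 'M[R]_D) : Prop :=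
  forall i, measurable_H1 T Omega (fun t x => u t x ord0 i)
    (fun t x => row i (Du t x)).

Definition in_L2H1v (T : R) (Omega : set vec) (u : R -> vec -> vec)
    (Du : R -> vec -> 'M[R]_D) : Prop :=
  forall i, in_L2H1 T Omega (fun t x => u t x ord0 i)
    (fun t x => row i (Du t x)).

Definition in_LooH1v (T : R) (Omega : set vec) (u : R -> vec -> vec)
    (Du : R -> vec -> 'M[R]_D) : Prop :=
  measurable_H1v T Omega u Du /\
  exists K : R, \forall t \ae leb1, 0 < t < T ->
    (\sum_i H1_sqnorm Omega (fun x => u t x ord0 i)
       (fun x => row i (Du t x)) <= K%:E)%E.

Definition ess_bounded (T : R) (Omega : set vec) (f : R -> vec -> R) : Prop :=
  exists K : R, \forall p \ae spacetime_measure,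
    cylinder T Omega p -> `|f p.1 p.2| <= K.

(* [g] is the distributional time derivative of [f] in the open cylinder. *)
Definition weak_dt (T : R) (Omega : set vec) (f g : R -> vec -> R) : Prop :=
  forall phi : R * vec -> R, test_function (cylinder T Omega) phi ->
  [/\ spacetime_measure.-integrable (cylinder T Omega)
        (fun p => (f p.1 p.2 * 'D_(1, 0) phi p)%:E),
      spacetime_measure.-integrable (cylinder T Omega)
        (fun p => (g p.1 p.2 * phi p)%:E) &
      \int[spacetime_measure]_(p in cylinder T Omega)
        (f p.1 p.2 * 'D_(1, 0) phi p) =
      - \int[spacetime_measure]_(p in cylinder T Omega) (g p.1 p.2 * phi p)].

(* Distributional time derivative of [f] in L^2(0, T; H^1(Omega)^* ); [L t v]
   is the value at [v] of the derivative at time [t], and [N] dominates its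
   dual norm. *)
Definition dt_in_L2H1dual (T : R) (Omega : set vec) (f : R -> vec -> R)
    : Prop :=
  exists (L : R -> (vec -> R) -> R) (N : R -> R),
  [/\ in_L2 leb1 `]0, T[%classic N,
      \forall t \ae leb1, 0 < t < T ->
        forall (c : R) v w Dv Dw, in_H1 Omega v Dv -> in_H1 Omega w Dw ->
          L t (fun x => c * v x + w x) = c * L t v + L t w,
      \forall t \ae leb1, 0 < t < T -> forall v Dv, in_H1 Omega v Dv ->
          `|L t v| <= N t * Num.sqrt (fine (H1_sqnorm Omega v Dv)),
      forall v Dv, in_H1 Omega v Dv ->
        measurable_fun `]0, T[%classic (fun t => L t v) &
      forall v Dv, in_H1 Omega v Dv ->
        forall phi : R -> R, test_function `]0, T[%classic phi ->
        \int[leb1]_(t in `]0, T[)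
          ((\int[lebD]_(x in Omega) (f t x * v x)) * derive1 phi t) =
        - \int[leb1]_(t in `]0, T[) (L t v * phi t)].

Definition continuous_L2 (T : R) (Omega : set vec) (f : R -> vec -> R)
    : Prop :=
  (forall t, 0 <= t <= T -> in_L2 lebD Omega (f t)) /\
  forall t, 0 <= t <= T ->
    L2_norm Omega (fun x => f s x - f t x)
      @[s --> within `[0, T]%classic (nbhs t)] --> (0 : R).

(* C^{0,h}([0, T]; L^2(Omega)); this concerns [f t] for every [t] in [0, T],
   i.e. [f] is the continuous representative. *)
Definition hoelder_L2 (h T : R) (Omega : set vec) (f : R -> vec -> R) : Prop :=
  (forall t, 0 <= t <= T -> in_L2 lebD Omega (f t)) /\
  exists K : R, forall s t, 0 <= s <= T -> 0 <= t <= T ->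
    L2_norm Omega (fun x => f s x - f t x) <= K * `|s - t| `^ h.

End function_spaces.

Section energy.
Context {R : realType} {D : nat}.
Implicit Types W : R -> 'M[R]_D -> R.

Definition entropy (s : R) : R := s * ln s + (1 - s) * ln (1 - s).

Definition partial_d W (d : R) (e : 'M[R]_D) : R := derive1 (fun s => W s e) d.

(* The gradient of [W d] on the space of symmetric matrices: the symmetric
   matrix [S] with [frob S E = 'D_E (W d) e] for all symmetric [E]. *)
Definition partial_eps W (d : R) (e : 'M[R]_D) : 'M[R]_D :=
  \matrix_(i, j) 'D_(sym_part (delta_mx i j)) (W d) e.

Definition elasticity_tensor (C : 'M[R]_D -> 'M[R]_D) : Prop :=
  [/\ forall E, E^T = E -> (C E)^T = C E,
      forall E F, E^T = E -> F^T = F -> frob E (C F) = frob F (C E) &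
      forall E, E^T = E -> E != 0 -> 0 < frob E (C E)].

Definition W_lin (C : 'M[R]_D -> 'M[R]_D) (ebar : 'M[R]_D) (d : R)
    (e : 'M[R]_D) : R :=
  2^-1 * frob (e - d *: ebar) (C (e - d *: ebar)).

End energy.

Section weak_solutions.
Context {R : realType} {D : nat}.
Local Notation vec := 'rV[R]_D.
Local Notation lebD := (@lebesgue_row R D).

(* div (partial_eps W d (eps u)) = 0 in Omega with traction sext n on the
   boundary, in weak form. *)
Definition elastic_equilibrium (W : R -> 'M[R]_D -> R) (sext : 'M[R]_D)
    (Omega : set vec) (d : vec -> R) (u : vec -> vec) (Du : vec -> 'M[R]_D)
    : Prop :=
  in_H1v Omega u Du /\
  forall v Dv, in_H1v Omega v Dv ->
    let F x := frob (partial_eps W (d x) (sym_part (Du x)) - sext)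
                 (sym_part (Dv x)) in
    lebD.-integrable Omega (EFin \o F) /\ \int[lebD]_(x in Omega) F x = 0.

Definition admissible_test (T : R) (Omega : set vec) (z : R -> vec -> R)
    (Dz : R -> vec -> vec) : Prop :=
  in_L2H1 T Omega z Dz /\ ess_bounded T Omega z.

(* [z], with time derivative in L^2 of the cylinder, is identified with its
   continuous representative [0, T] -> L^2(Omega), so that [z T] makes
   sense. *)
Definition admissible_test_T (T : R) (Omega : set vec) (z dz : R -> vec -> R)
    (Dz : R -> vec -> vec) : Prop :=
  [/\ admissible_test T Omega z Dz,
      in_L2 (@spacetime_measure R D) (cylinder T Omega)
        (fun p : R * vec => dz p.1 p.2),
      weak_dt T Omega z dz, continuous_L2 T Omega z &
      \forall x \ae lebD, Omega x -> z T x = 0].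

(* The displayed integrals are required to converge absolutely.  Since [entropy]
   is differentiable on ]0, 1[ only, with infinite slope at 0 and 1, the terms
   containing its derivative make sense only if a + b and a - b lie in ]0, 1[ almost
   everywhere; this must be required separately, as [ln] takes the value 0
   outside its domain. *)
Definition weak_solution (lam th k1 k2 : R) (W : R -> 'M[R]_D -> R)
    (sext : 'M[R]_D) (T : R) (Omega : set vec) (a0 b0 : vec -> R)
    (a b : R -> vec -> R) (u : R -> vec -> vec) : Prop :=
  let Q := cylinder T Omega in
  let m := @spacetime_measure R D in
  exists (mu db : R -> vec -> R) (Dmu Da Db : R -> vec -> vec)
         (Du : R -> vec -> 'M[R]_D),
  let d t x := a t x + b t x in
  let eps t x := sym_part (Du t x) in
  [/\ (\forall x \ae lebD, Omega x -> a 0 x = a0 x /\ b 0 x = b0 x) /\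
      (\forall p \ae m, Q p ->
         0 < a p.1 p.2 + b p.1 p.2 < 1 /\ 0 < a p.1 p.2 - b p.1 p.2 < 1),
      [/\ in_L2H1 T Omega a Da, in_L2H1 T Omega b Db,
          in_L2H1 T Omega mu Dmu, measurable_H1v T Omega u Du &
          weak_dt T Omega b db],
      forall xi dxi Dxi, admissible_test_T T Omega xi dxi Dxi ->
        let F (p : R * vec) := let: (t, x) := p in
          - (a t x - a0 x) * dxi t x + lam * dot (Dmu t x) (Dxi t x) in
        m.-integrable Q (EFin \o F) /\ \int[m]_(p in Q) F p = 0,
      forall zeta Dzeta, admissible_test T Omega zeta Dzeta ->
        let F (p : R * vec) := let: (t, x) := p in mu t x * zeta t x in
        let G (p : R * vec) := let: (t, x) := p in
          (th / 2 * (derive1 entropy (a t x + b t x) + derive1 entropy (a t x - b t x))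
           + k1 * (1 - 2 * a t x)
           + partial_d W (d t x) (eps t x)) * zeta t x
          + lam * dot (Da t x) (Dzeta t x) in
        [/\ m.-integrable Q (EFin \o F), m.-integrable Q (EFin \o G) &
            \int[m]_(p in Q) F p = \int[m]_(p in Q) G p] &
      (forall eta Deta, admissible_test T Omega eta Deta ->
        let F (p : R * vec) := let: (t, x) := p in
          (db t x
           + th / 2 * (derive1 entropy (a t x + b t x) - derive1 entropy (a t x - b t x))
           - 2 * k2 * b t x
           + partial_d W (d t x) (eps t x)) * eta t x
          + lam * dot (Db t x) (Deta t x) in
        m.-integrable Q (EFin \o F) /\ \int[m]_(p in Q) F p = 0) /\
      (forall v Dv, in_L2H1v T Omega v Dv ->
        let F (p : R * vec) := let: (t, x) := p in
          frob (partial_eps W (d t x) (eps t x) - sext)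
            (sym_part (Dv t x)) in
        m.-integrable Q (EFin \o F) /\ \int[m]_(p in Q) F p = 0)].

Definition regularity_class (T : R) (Omega : set vec) (a b : R -> vec -> R)
    (u : R -> vec -> vec) : Prop :=
  [/\ hoelder_L2 4^-1 T Omega a /\ hoelder_L2 4^-1 T Omega b,
      dt_in_L2H1dual T Omega a,
      exists2 db, in_L2 (@spacetime_measure R D) (cylinder T Omega)
          (fun p : R * vec => db p.1 p.2) & weak_dt T Omega b db,
      exists Du, in_LooH1v T Omega u Du &
      \forall p \ae @spacetime_measure R D, cylinder T Omega p ->
        0 <= a p.1 p.2 + b p.1 p.2 <= 1 /\ 0 <= a p.1 p.2 - b p.1 p.2 <= 1].

(* [w] is an infinitesimal rigid displacement: the kernel of the symmetric
   gradient. *)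
Definition rigid_displacement (Omega : set vec) (w : vec -> vec) : Prop :=
  exists (S : 'M[R]_D) (c : vec), S^T = - S /\
    \forall x \ae lebD, Omega x -> w x = x *m S + c.

End weak_solutions.

(* Main.v *)
(* Let a, b, mu, u denote differences of two solutions. Testing the mass
   balance with products rho(t) v(x), v bounded in H^1, gives for every t
     int a(t) v = - lam int (int_0^t grad mu) . grad v,
   and truncating v removes its bound; this replaces the inverse Neumann
   Laplacian. Put G(t) = int_0^t grad mu. With v = mu(t) the time integral of
   int a mu becomes - lam/2 |G(t)|^2, and with v = a(t) the norm |a|^2 is
   controlled by |G| |grad a|. Adding the equations for mu, b and u tested with
   a, b and u on (0, t), the monotone entropy slope and the convex elastic
   energy only help, so Y = |b|^2/2 + lam/2 |G|^2 satisfies Y(t) <= K int_0^t Y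
   and vanishes by Gronwall's lemma. Then a = 0 by the choice v = a, and the
   elastic equation forces the symmetric gradient of u to vanish, whence u is an
   infinitesimal rigid displacement.

   Weak derivatives are handled through difference quotients: g is a weak k-th
   partial derivative of v iff, locally and for small h,
   v(x + h e_k) - v(x) = int_0^h g(x + s e_k) ds for almost every x. Truncation
   and the time derivative (in R^(D+1)) reduce in this way to statements about
   one-dimensional primitives. *)
Require Import Defs.
From HB Require Import structures.
From mathcomp Require Import all_boot all_order all_algebra.
From mathcomp Require Import all_classical all_reals all_analysis.
From mathcomp Require Import measurable_realfun ring lra.

Set Implicit Arguments.
Unset Strict Implicit.
Unset Printing Implicit Defensive.

Import Order.TTheory GRing.Theory Num.Theory.
Import numFieldNormedType.Exports.

Local Open Scope classical_set_scope.
Local Open Scope ring_scope.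

(** * Smooth functions of tensor product form *)

(** The mass balance only admits bounded test functions that vanish at time T, whereas the energy
    argument calls for mu and a, and mu is not known to be bounded. Fixing the time removes both
    restrictions: a single v in H^1 can be truncated, and afterwards v may be chosen anew at each
    time. The equations for mu and b also ask for bounded tests, but there the tests are the
    differences of a and of b, and 0 < a + b < 1, 0 < a - b < 1 bound these by 1.

    The dangerous term is -2 k1 |a|^2, which comes from the concave part of psi and has no
    counterpart in Y. It is rewritten by |a|^2 = -lam int G . grad a, and completing the square
    against lam |grad a|^2 leaves lam k1^2 int |G|^2, which Y controls. The elastic coupling costs
    nothing because [W_lin] is a nonnegative quadratic form in e - d ebar, hence jointly convex in d
    and e.

    Test functions must have all iterated directional derivatives. They are therefore drawn from an
    explicit algebra generated by exp(-1/x), closed under differentiation, and weak derivatives are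
    tested only on products of functions of one coordinate. *)

Section flat.
Context {R : realType}.

(** The classical flat function exp(-1/x), with a polynomial in 1/x as prefactor so that the family
    is closed under differentiation. *)
Definition flat (p : {poly R}) (x : R) : R :=
  if 0 < x then p.[x^-1] * expR (- x^-1) else 0.

(** For y > 1, [y^n <= y^(n+1)] and [exp y = exp(y/(n+1))^(n+1) >= (y/(n+1))^(n+1)], whence the
    constant [(n+1)^(n+1)]; the added 1 covers y <= 1. *)
Lemma exprn_expR_bound (n : nat) : exists C : R, forall y, 0 <= y ->
  y ^+ n * expR (- y) <= C.
Proof.
exists ((n.+1)%:R ^+ n.+1 + 1) => y y0.
have [y1|y1] := leP y 1.
  apply: (@le_trans _ _ 1); last by rewrite lerDr exprn_ge0.
  rewrite -[leRHS]mulr1; apply: ler_pM.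
  - exact: exprn_ge0.
  - exact: expR_ge0.
  - exact: exprn_ile1.
  - by rewrite expR_le1 oppr_le0.
rewrite expRN ler_pdivrMr ?expR_gt0//.
have -> : expR y = expR (y / n.+1%:R) ^+ n.+1.
  by rewrite -expRM_natl mulrC divfK // pnatr_eq0.
apply: (@le_trans _ _ (n.+1%:R ^+ n.+1 * expR (y / n.+1%:R) ^+ n.+1)); last first.
  by rewrite ler_pM2r ?lerDl// exprn_gt0 // expR_gt0.
rewrite -exprMn.
apply: (@le_trans _ _ (y ^+ n.+1)).
  by rewrite exprS ler_peMl ?exprn_ge0// ltW.
apply: lerXn2r; rewrite ?nnegrE ?(ltW (le_lt_trans ler01 y1))//.
have := expR_ge1Dx (y / n.+1%:R) => h.
rewrite -(ler_pdivrMl) ?ltr0n// mulrC.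
by apply: le_trans h; rewrite lerDr.
Qed.

Lemma poly_expR_bound (p : {poly R}) : exists C : R, forall y, 0 <= y ->
  `|p.[y]| * expR (- y) <= C.
Proof.
have [C HC] := choice exprn_expR_bound.
exists (\sum_(i < size p) `|p`_i| * C i) => y y0.
rewrite horner_coef.
apply: (le_trans (ler_wpM2r (expR_ge0 _) (ler_norm_sum _ _ _))).
rewrite mulr_suml; apply: ler_sum => i _.
by rewrite normrM -mulrA ler_wpM2l// ger0_norm ?exprn_ge0 ?HC.
Qed.

(** Chain rule in y = 1/x: the derivative of [p(y) exp(-y)] with respect to x is
    [y^2 (p - p')(y) exp(-y)]. *)
Definition dflat (p : {poly R}) : {poly R} := 'X^2 * (p - p^`()).

Lemma is_derive_flat (p : {poly R}) (x : R) :
  is_derive x 1 (flat p) (flat (dflat p) x).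
Proof.
have [x0|x0|->] := ltgtP x 0.
- rewrite {2}/flat ltNge (ltW x0)/=.
  apply: (@near_eq_is_derive _ _ _ (cst 0)).
  near=> y; rewrite /flat ltNge (_ : y <= 0)//.
  apply: ltW; near: y; exact: lt_nbhsl.
- have E : is_derive x 1 (fun y => p.[y^-1] * expR (- y^-1)) (flat (dflat p) x).
    have xn0 : x != 0 by rewrite gt_eqF.
    have dV : is_derive x 1 (fun y : R => y^-1) (- x ^- 2).
      have := @is_deriveV _ (@id R) x 1 1 xn0 (is_derive_id _ _).
      by rewrite /= scaleNr /GRing.scale /= mulr1.
    have dp : is_derive x 1 (horner p \o (fun y : R => y^-1)) ((p^`()).[x^-1] * - x ^- 2).
      exact: is_derive1_comp.
    have de : is_derive x 1 (expR \o (fun y : R => - y^-1)) (expR (- x^-1) * x ^- 2).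
      apply: is_derive1_comp.
      by apply: is_derive_eq; rewrite opprK.
    have H := is_deriveM dp de.
    apply: is_derive_eq.
    rewrite /flat x0 /dflat !hornerE /= /GRing.scale /=.
    rewrite exprVn. ring.
  apply: near_eq_is_derive E => //.
  near=> y; rewrite /flat (_ : 0 < y)//.
  near: y; exact: lt_nbhsr.
- rewrite {2}/flat ltxx.
  (* For h > 0 and y = 1/h the difference quotient at 0 is [y p(y) exp(-y)]; a bound on
     [y^2 p(y) exp(-y)] makes it O(h). *)
  have [C HC] := poly_expR_bound ('X^2 * p).
  have H : (fun h => h^-1 *: (flat p (h *: 1 + 0) - flat p 0)) @ (0 : R)^' --> (0 : R).
    apply/cvgrPdist_le => e e0.
    near=> h.
    rewrite sub0r normrN addr0 /flat ltxx subr0 /GRing.scale /= mulr1.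
    case: ifPn => [h0|_]; last by rewrite mulr0 normr0 ltW.
    rewrite normrM normfV (gtr0_norm h0) normrM (ger0_norm (expR_ge0 _)).
    have := HC _ (ltW (_ : 0 < h^-1)); rewrite invr_gt0 => /(_ h0).
    rewrite !hornerE normrM (ger0_norm (exprn_ge0 _ _)) ?invr_ge0 ?(ltW h0)// => H.
    apply: (@le_trans _ _ (C * h)).
      rewrite -ler_pdivrMr//; apply: le_trans H.
      by rewrite [leLHS]mulrC mulrA expr2 !mulrA.
    have hC : h <= e / (`|C| + 1).
      apply: le_trans (ler_norm _) _.
      near: h; apply: dnbhs0_le; rewrite divr_gt0// ltr_wpDl//.
    apply: (@le_trans _ _ ((`|C| + 1) * h)).
      by rewrite ler_pM2r// (le_trans (ler_norm _))// lerDl.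
    by rewrite mulrC -ler_pdivlMr// ltr_wpDl//.
  split; first by apply/cvg_ex; exists 0.
  exact: cvg_lim H.
Unshelve. all: by end_near.
Qed.

End flat.

Section smooth_functions.
Context {R : realType}.

(* An explicit class of smooth functions, closed under the operations needed to
   build bumps, so that all iterated derivatives come for free. *)
Inductive smooth1 : (R -> R) -> Prop :=
| smooth1_flat p : smooth1 (flat p)
| smooth1_cst c : smooth1 (cst c)
| smooth1_affine f c d : smooth1 f -> smooth1 (fun x => f (c * x + d))
| smooth1_add f g : smooth1 f -> smooth1 g -> smooth1 (f \+ g)
| smooth1_mul f g : smooth1 f -> smooth1 g -> smooth1 (f \* g).

Lemma smooth1_ex_derive f : smooth1 f ->
  exists2 g, smooth1 g & forall x : R, is_derive x 1 f (g x).
Proof.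
elim=> {f} [p|c|f c d _ [f' sf' df]|f g sf [f' sf' df] sg [g' sg' dg]
  |f g sf [f' sf' df] sg [g' sg' dg]].
- by exists (flat (dflat p)); [exact: smooth1_flat|exact: is_derive_flat].
- by exists (cst 0); [exact: smooth1_cst|move=> x; exact: is_derive_cst].
- exists (cst c \* (fun x => f' (c * x + d))).
    by apply: smooth1_mul; [exact: smooth1_cst|exact: smooth1_affine].
  move=> x /=; rewrite mulrC.
  apply: (@is_derive1_comp _ f (fun x => c * x + d)).
  apply: is_derive_eq.
  by rewrite addr0 /GRing.scale /= mulr1.
- exists (f' \+ g'); first exact: smooth1_add.
  by move=> x; exact: is_deriveD.
- exists (f \* g' \+ g \* f'); first by apply: smooth1_add; exact: smooth1_mul.
  by move=> x; exact: is_deriveM.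
Qed.

Lemma smooth1_is_derive f (x : R) : smooth1 f -> is_derive x 1 f (derive1 f x).
Proof.
move=> /smooth1_ex_derive[g _ dg]; have := dg x; rewrite derive1E.
by move=> h; have := h; rewrite -(@derive_val _ _ _ _ _ _ _ h).
Qed.

Lemma smooth1_derive1 f : smooth1 f -> smooth1 (derive1 f).
Proof.
move=> /smooth1_ex_derive[g sg dg].
rewrite (_ : derive1 f = g)//; apply/funext => x.
by rewrite derive1E derive_val.
Qed.

Lemma smooth1_continuous f : smooth1 f -> continuous f.
Proof.
move=> /smooth1_ex_derive[g _ dg] x.
by apply: differentiable_continuous; apply/derivable1_diffP.
Qed.

Context {V : normedModType R}.
Implicit Types (f : V -> R) (l : V -> R).

Lemma is_derive_line f x v d :
  is_derive (0 : R) (1 : R) (fun h : R => f (h *: v + x)) d -> is_derive x v f d.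
Proof.
move=> [H1 H2].
have E : (fun h : R => h^-1 *: (f (h *: v + x) - f x)) =
   (fun h : R => h^-1 *: ((fun h : R => f (h *: v + x)) (h *: 1 + 0) -
     (fun h : R => f (h *: v + x)) 0)).
  by apply/funext => h; rewrite addr0 scale0r add0r /GRing.scale /= mulr1.
by split; rewrite /derivable /derive E.
Qed.

Definition affine_along l v c := forall x (h : R), l (h *: v + x) = l x + h * c.

(** The counterpart of [smooth1] in several variables, generated by functions of one affine
    coordinate. The space V is left abstract because the class serves both on R^D and on R x R^D. *)
Inductive smooth_tensor : (V -> R) -> Prop :=
| smooth_tensor_comp (f : R -> R) l : smooth1 f -> continuous l ->
    (forall v, exists c, affine_along l v c) -> smooth_tensor (f \o l)
| smooth_tensor_cst c : smooth_tensor (cst c)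
| smooth_tensor_add f g : smooth_tensor f -> smooth_tensor g ->
    smooth_tensor (f \+ g)
| smooth_tensor_mul f g : smooth_tensor f -> smooth_tensor g ->
    smooth_tensor (f \* g).

Lemma is_derive_affine_comp (f : R -> R) l x v c (d : R) : affine_along l v c ->
  is_derive (l x) 1 f d -> is_derive x v (f \o l) (c * d).
Proof.
move=> lv df; apply: is_derive_line.
rewrite (_ : (fun _ => _) = f \o (fun h => l x + h * c)).
  rewrite mulrC; apply: is_derive1_comp; first by rewrite mul0r addr0.
  apply: is_derive_eq.
  by rewrite /GRing.scale /= mulr0 !add0r mul1r mulr1.
by apply/funext => h /=; rewrite lv.
Qed.

Lemma smooth_tensor_ex_derive f v : smooth_tensor f ->
  exists2 g, smooth_tensor g & forall x, is_derive x v f (g x).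
Proof.
elim=> {f} [f l sf cl al|c|f g sf [f' sf' df] sg [g' sg' dg]
  |f g sf [f' sf' df] sg [g' sg' dg]].
- have [c lc] := al v; exists (cst c \* (derive1 f \o l)).
    apply: smooth_tensor_mul; first exact: smooth_tensor_cst.
    by apply: smooth_tensor_comp => //; exact: smooth1_derive1.
  by move=> x; apply: is_derive_affine_comp lc _; exact: smooth1_is_derive.
- exists (cst 0); first exact: smooth_tensor_cst.
  by move=> x; exact: is_derive_cst.
- exists (f' \+ g'); first exact: smooth_tensor_add.
  by move=> x; exact: is_deriveD.
- exists (f \* g' \+ g \* f').
    by apply: smooth_tensor_add; exact: smooth_tensor_mul.
  by move=> x; exact: is_deriveM.
Qed.

Lemma smooth_tensor_continuous f : smooth_tensor f -> continuous f.
Proof.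
elim=> {f} [f l sf cl al|c|f g _ cf _ cg|f g _ cf _ cg] x.
- by apply: continuous_comp; [exact: cl|exact: smooth1_continuous].
- exact: cvg_cst.
- by apply: cvgD; [exact: cf|exact: cg].
- by apply: cvgM; [exact: cf|exact: cg].
Qed.

Lemma smooth_tensor_smooth f : smooth_tensor f -> smooth f.
Proof.
move=> sf vs.
have {sf} : smooth_tensor (iter_derive f vs).
  elim: vs => [//|v vs /smooth_tensor_ex_derive-/(_ v)[g sg dg]] /=.
  rewrite (_ : (fun _ => _) = g)//; apply/funext => x.
  exact: derive_val.
move=> sg; split; first exact: smooth_tensor_continuous.
move=> x v; have [g _ dg] := smooth_tensor_ex_derive v sg.
exact: ex_derive.
Qed.

Lemma smooth_derive f v : smooth f -> smooth ('D_v f).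
Proof.
move=> sf vs.
have -> : iter_derive ('D_v f) vs = iter_derive f (rcons vs v).
  by rewrite /iter_derive foldr_rcons.
exact: sf.
Qed.

Lemma test_function_derive (U : set V) f v :
  test_function U f -> test_function U ('D_v f).
Proof.
move=> [sf [K [cK KU f0]]]; split; first exact: smooth_derive.
exists K; split => // x Kx.
have cl : closed K by apply: compact_closed => //; exact: norm_hausdorff.
have /open_nbhs_nbhs-/nbhs_interior : open_nbhs x (~` K).
  by split=> //; exact: closed_openC.
move=> nK; suff : is_derive x v f 0 by move=> h; rewrite derive_val.
apply: (@near_eq_is_derive _ _ _ (cst 0)).
by apply: filterS nK => y /nbhs_singleton Ky; rewrite f0.
Qed.

Section tensor.
Context {n : nat} (l : 'I_n -> V -> R).

Definition tensor (F : 'I_n -> R -> R) (x : V) : R := \prod_i F i (l i x).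

Lemma tensor_smooth F : (forall i, smooth1 (F i)) ->
  (forall i, continuous (l i)) ->
  (forall i v, exists c, affine_along (l i) v c) -> smooth_tensor (tensor F).
Proof.
move=> sF cl al; rewrite /tensor.
elim: (index_enum _) => [|i s IH].
  by under eq_fun do rewrite big_nil; exact: smooth_tensor_cst.
under eq_fun do rewrite big_cons.
by apply: smooth_tensor_mul => //; apply: (@smooth_tensor_comp (F i)).
Qed.

Definition upd (F : 'I_n -> R -> R) k g i := if i == k then g else F i.

Lemma tensor_derive F k v x : smooth1 (F k) ->
  (forall i, affine_along (l i) v (i == k)%:R) ->
  is_derive x v (tensor F) (tensor (upd F k (derive1 (F k))) x).
Proof.
move=> sF al; apply: is_derive_line.
rewrite (_ : (fun _ => _) = (\prod_(i | i != k) F i (l i x)) \*: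
   (F k \o (fun h => l k x + h))); last first.
  apply/funext => h; rewrite /tensor (bigD1 k)//= al eqxx mulr1 mulrC; congr *%R.
  by apply: eq_bigr => i /negbTE ik; rewrite al ik mulr0 addr0.
have -> : tensor (upd F k (derive1 (F k))) x =
    (\prod_(i | i != k) F i (l i x)) * derive1 (F k) (l k x).
  rewrite /tensor (bigD1 k)//= mulrC /upd eqxx; congr *%R.
  by apply: eq_bigr => i /negbTE ->.
apply: is_deriveZ => /=.
rewrite -[X in is_derive _ _ _ X]mulr1; apply: is_derive1_comp.
  by rewrite addr0; exact: smooth1_is_derive.
have := is_deriveD (is_derive_cst (l k x) (0 : R) 1) (is_derive_id (0 : R) 1).
by rewrite add0r.
Qed.

End tensor.

End smooth_functions.

(** * Smooth bumps on intervals *)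

Section bump.
Context {R : realType}.

(* Tends to the indicator of ]a, b[ as k grows. *)
Definition bump (k a b x : R) : R := flat 1 (k * (x - a)) * flat 1 (k * (b - x)).

Lemma smooth1_bump k a b : smooth1 (bump k a b).
Proof.
apply: smooth1_mul.
  rewrite (_ : (fun x => _) = fun x => flat 1 (k * x + - (k * a))).
    exact: (smooth1_affine _ _ (smooth1_flat 1)).
  by apply/funext => x; rewrite mulrBr.
rewrite (_ : (fun x => _) = fun x => flat 1 (- k * x + k * b)).
  exact: (smooth1_affine _ _ (smooth1_flat 1)).
by apply/funext => x; rewrite mulrBr mulNr addrC.
Qed.

Lemma flat_le0 p (x : R) : x <= 0 -> flat p x = 0.
Proof. by rewrite /flat leNgt => /negbTE ->. Qed.

Lemma flat1_gt0 (x : R) : 0 < x -> 0 < flat 1 x.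
Proof. by move=> x0; rewrite /flat x0 hornerC mul1r expR_gt0. Qed.

Lemma flat1_ge0 (x : R) : 0 <= flat 1 x.
Proof. by rewrite /flat; case: ifP => // _; rewrite hornerC mul1r expR_ge0. Qed.

Lemma flat1_le1 (x : R) : flat 1 x <= 1.
Proof.
rewrite /flat; case: ifP => // x0; rewrite hornerC mul1r expR_le1 oppr_le0 invr_ge0.
exact: ltW.
Qed.

Lemma bump_ge0 k a b x : 0 <= bump k a b x.
Proof. by rewrite mulr_ge0 ?flat1_ge0. Qed.

Lemma bump_le1 k a b x : bump k a b x <= 1.
Proof. by rewrite mulr_ile1 ?flat1_ge0 ?flat1_le1. Qed.

Lemma bump_out k a b x : 0 < k -> ~~ (a < x < b) -> bump k a b x = 0.
Proof.
move=> k0; rewrite negb_and /bump -!leNgt => /orP[h|h].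
  by rewrite flat_le0 ?mul0r// pmulr_rle0// subr_le0.
by rewrite [X in _ * X]flat_le0 ?mulr0// pmulr_rle0// subr_le0.
Qed.

Lemma bump_gt0 k a b x : 0 < k -> a < x < b -> 0 < bump k a b x.
Proof.
by move=> k0 /andP[ax xb]; rewrite mulr_gt0// flat1_gt0// pmulr_rgt0// subr_gt0.
Qed.

Lemma bump_cvg a b x : a < x < b -> (fun k : nat => bump k.+1%:R a b x) @ \oo --> (1 : R).
Proof.
move=> /andP[ax xb].
have H (c : R) : 0 < c -> (fun k : nat => flat 1 (k.+1%:R * c)) @ \oo --> (1 : R).
  move=> c0; rewrite (_ : (fun _ => _) = fun k : nat => expR (- (k.+1%:R^-1 * c^-1))).
    have {2}-> : (1 : R) = expR (- (0 * c^-1)) by rewrite mul0r oppr0 expR0.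
    apply: (cvg_comp _ expR); last exact: continuous_expR.
    apply: cvgN; apply: cvgMr_tmp.
    exact: cvg_harmonic.
  apply/funext => k; rewrite /flat pmulr_rgt0 ?ltr0n// c0 hornerC mul1r.
  by rewrite invfM.
rewrite -[X in _ --> X](mulr1 1); apply: cvgM; apply: H; by rewrite subr_gt0.
Qed.

End bump.

(** * Integrable and square-integrable real functions *)

Section real_integral.
Context {d} {T : measurableType d} {R : realType}.
Variable mu : {measure set T -> \bar R}.
Implicit Types f g h : T -> R.

(** Integrals run over the whole space throughout: a function on a subset A is replaced by its
    extension by zero [f \_ A], so that no domain has to be carried along. *)
Definition L1 f : Prop := mu.-integrable setT (EFin \o f).
Definition Int f : R := \int[mu]_x f x.
Definition L2 f : Prop := measurable_fun setT f /\ L1 (fun x => f x ^+ 2).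

Lemma eq_Int f g : f =1 g -> Int f = Int g.
Proof. by move=> /funext ->. Qed.

Lemma eq_L1 f g : f =1 g -> L1 f -> L1 g.
Proof. by move=> /funext ->. Qed.

Lemma L1_measurable f : L1 f -> measurable_fun setT f.
Proof. by move=> /measurable_int/measurable_EFinP. Qed.

Lemma L1_le f g : measurable_fun setT f -> (forall x, `|f x| <= `|g x|) ->
  L1 g -> L1 f.
Proof.
move=> mf fg; apply: le_integrable => //; first exact/measurable_EFinP.
by move=> x _; rewrite /= lee_fin.
Qed.

Lemma L1D f g : L1 f -> L1 g -> L1 (fun x => f x + g x).
Proof. by move=> Lf Lg; apply: (integrableD _ Lf Lg). Qed.

Lemma L1Z c f : L1 f -> L1 (fun x => c * f x).
Proof. by move=> Lf; have := integrableZl measurableT c Lf. Qed.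

Lemma L1N f : L1 f -> L1 (fun x => - f x).
Proof. by move=> /(L1Z (-1)); congr L1; apply/funext => x; rewrite mulN1r. Qed.

Lemma L1B f g : L1 f -> L1 g -> L1 (fun x => f x - g x).
Proof. by move=> Lf Lg; apply: L1D => //; exact: L1N. Qed.

Lemma L1_0 : L1 (fun=> 0).
Proof. exact: integrable0. Qed.

Lemma L1_sum I (s : seq I) (P : pred I) (F : I -> T -> R) :
  (forall i, P i -> L1 (F i)) -> L1 (fun x => \sum_(i <- s | P i) F i x).
Proof.
move=> LF; elim: s => [|i s IH].
  by under eq_fun do rewrite big_nil; exact: L1_0.
under eq_fun do rewrite big_cons.
by case: (P i) (LF i) => // /(_ isT) ?; exact: L1D.
Qed.

Lemma L1_norm f : L1 f -> L1 (fun x => `|f x|).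
Proof.
move=> Lf; apply: L1_le (Lf); last by move=> x; rewrite normr_id.
by apply: measurableT_comp => //; exact: L1_measurable.
Qed.

Lemma L1_mul_bounded f g M : L1 f -> measurable_fun setT g ->
  (forall x, `|g x| <= M) -> L1 (fun x => f x * g x).
Proof.
move=> Lf mg gM.
apply: (@L1_le _ (fun x => M * f x)); last exact: L1Z.
  by apply: measurable_funM => //; exact: L1_measurable.
move=> x; rewrite !normrM mulrC ler_wpM2r//.
exact: le_trans (gM x) (ler_norm _).
Qed.

Lemma IntD f g : L1 f -> L1 g -> Int (fun x => f x + g x) = Int f + Int g.
Proof. exact: RintegralD. Qed.

Lemma IntZ c f : L1 f -> Int (fun x => c * f x) = c * Int f.
Proof. exact: RintegralZl. Qed.

Lemma IntN f : L1 f -> Int (fun x => - f x) = - Int f.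
Proof.
by move=> Lf; rewrite -mulN1r -IntZ//; congr Int; apply/funext => x; rewrite mulN1r.
Qed.

Lemma IntB f g : L1 f -> L1 g -> Int (fun x => f x - g x) = Int f - Int g.
Proof. by move=> Lf Lg; rewrite -IntN// -IntD//; exact: L1N. Qed.

Lemma Int0 : Int (fun=> 0) = 0.
Proof. by rewrite /Int /Rintegral integral0. Qed.

Lemma Int_sum I (s : seq I) (P : pred I) (F : I -> T -> R) :
  (forall i, P i -> L1 (F i)) ->
  Int (fun x => \sum_(i <- s | P i) F i x) = \sum_(i <- s | P i) Int (F i).
Proof.
move=> LF; elim: s => [|i s IH].
  by rewrite big_nil; under eq_fun do rewrite big_nil; exact: Int0.
rewrite big_cons; under eq_fun do rewrite big_cons.
case: (P i) (LF i) => // /(_ isT) Li; rewrite IntD ?IH//.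
exact: L1_sum.
Qed.

Lemma Int_ge0 f : (forall x, 0 <= f x) -> 0 <= Int f.
Proof. by move=> f0; apply: Rintegral_ge0. Qed.

Lemma Int_le f g : L1 f -> L1 g -> (forall x, f x <= g x) -> Int f <= Int g.
Proof. by move=> Lf Lg fg; apply: le_Rintegral. Qed.

Lemma Int_norm f : L1 f -> `|Int f| <= Int (fun x => `|f x|).
Proof. by move=> Lf; apply: le_normr_Rintegral. Qed.

Lemma Int_ae f g : measurable_fun setT f -> measurable_fun setT g ->
  (\forall x \ae mu, f x = g x) -> Int f = Int g.
Proof.
move=> mf mg fg; rewrite /Int /Rintegral; congr fine; apply: ae_eq_integral => //.
- exact/measurable_EFinP.
- exact/measurable_EFinP.
- by apply: filterS fg => x /= -> _.
Qed.

Lemma L1_ae f g : measurable_fun setT f -> L1 g ->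
  (\forall x \ae mu, f x = g x) -> L1 f.
Proof.
move=> mf Lg fg; have mg := L1_measurable Lg.
apply/integrableP; split; first exact/measurable_EFinP.
have /integrableP[_] := Lg; congr (_ < _)%E.
apply: ae_eq_integral => //.
- by apply: measurableT_comp => //; exact/measurable_EFinP.
- by apply: measurableT_comp => //; exact/measurable_EFinP.
- by apply: filterS fg => x /= -> _.
Qed.

(** The maximum of f and g dominates f everywhere and equals g almost everywhere, which reduces the
    claim to the pointwise inequality. *)
Lemma Int_ae_le f g : L1 f -> L1 g -> (\forall x \ae mu, f x <= g x) -> Int f <= Int g.
Proof.
move=> Lf Lg fg.
have mf := L1_measurable Lf; have mg := L1_measurable Lg.
have mh : measurable_fun setT (fun x => Num.max (f x) (g x)) by exact: measurable_maxr.
have fgE : \forall x \ae mu, Num.max (f x) (g x) = g x.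
  by apply: filterS fg => x ?; exact/max_idPr.
rewrite -(Int_ae mh mg fgE); apply: Int_le => //; first exact: L1_ae Lg fgE.
by move=> x; rewrite le_max lexx.
Qed.

Lemma Int_eq0 f : L1 f -> (forall x, 0 <= f x) -> Int f = 0 ->
  \forall x \ae mu, f x = 0.
Proof.
move=> Lf f0 If0.
have mf : measurable_fun setT (EFin \o f) by apply/measurable_EFinP; exact: L1_measurable.
have [H _] := ae_eq_integral_abs mu measurableT mf.
have : (\int[mu]_x `|(EFin \o f) x|)%E = 0%E.
  under eq_integral do rewrite gee0_abs ?lee_fin//.
  rewrite -(@fineK _ (\int[mu]_x (EFin \o f) x)%E); last exact: integrable_fin_num.
  by congr (_%:E).
by move=> /H; apply: filterS => x /= /(_ I)[].
Qed.

Lemma Int_cvg (F : nat -> T -> R) f g : (forall n, measurable_fun setT (F n)) ->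
  measurable_fun setT f -> L1 g -> (forall n x, `|F n x| <= g x) ->
  (\forall x \ae mu, F n x @[n --> \oo] --> f x) -> Int (F n) @[n --> \oo] --> Int f.
Proof.
move=> mF mf Lg Fg Ff.
have [] := @dominated_convergence _ _ _ mu _ measurableT (fun n => EFin \o F n) (EFin \o f) (EFin \o g).
- by move=> n; exact/measurable_EFinP.
- exact/measurable_EFinP.
- by apply: filterS Ff => x Ff _; apply: cvg_EFin => //; exact: nearW.
- exact: Lg.
- by apply: aeW => x n _; rewrite lee_fin.
move=> Lf _ H.
have Lff : L1 f by exact: Lf.
rewrite /Int /Rintegral.
have E : (\int[mu]_x (f x)%:E)%E = (fine (\int[mu]_x (f x)%:E)%E)%:E.
  by rewrite fineK//; exact: integrable_fin_num.
apply: fine_cvg; rewrite -E; exact: H.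
Qed.

Lemma L2_measurable f : L2 f -> measurable_fun setT f. Proof. by case. Qed.

Lemma L2M f g : L2 f -> L2 g -> L1 (fun x => f x * g x).
Proof.
move=> [mf Lf] [mg Lg].
apply: (@L1_le _ (fun x => f x ^+ 2 + g x ^+ 2)); last exact: L1D.
  exact: measurable_funM.
move=> x; rewrite [leRHS]ger0_norm ?addr_ge0 ?sqr_ge0// normrM.
rewrite -(real_normK (num_real (f x))) -(real_normK (num_real (g x))).
have := sqr_ge0 (`|f x| - `|g x|); have := mulr_ge0 (normr_ge0 (f x)) (normr_ge0 (g x)).
rewrite sqrrB; lra.
Qed.

Lemma L2Z c f : L2 f -> L2 (fun x => c * f x).
Proof.
move=> [mf Lf]; split; first exact: measurable_funM.
by under eq_fun do rewrite exprMn; exact: L1Z.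
Qed.

Lemma L2D f g : L2 f -> L2 g -> L2 (fun x => f x + g x).
Proof.
move=> Lf Lg; split; first by apply: measurable_funD; exact: L2_measurable.
under eq_fun do rewrite sqrrD.
apply: L1D; last by case: Lg.
apply: L1D; first by case: Lf.
under eq_fun do rewrite mulr2n.
by apply: L1D; exact: L2M.
Qed.

Lemma L2N f : L2 f -> L2 (fun x => - f x).
Proof. by move=> /(L2Z (-1)); congr L2; apply/funext => x; rewrite mulN1r. Qed.

Lemma L2B f g : L2 f -> L2 g -> L2 (fun x => f x - g x).
Proof. by move=> Lf Lg; apply: L2D => //; exact: L2N. Qed.

Lemma L2_0 : L2 (fun=> 0).
Proof. by split => //; under eq_fun do rewrite expr0n; exact: L1_0. Qed.

Lemma L2_sum I (s : seq I) (P : pred I) (F : I -> T -> R) :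
  (forall i, P i -> L2 (F i)) -> L2 (fun x => \sum_(i <- s | P i) F i x).
Proof.
move=> LF; elim: s => [|i s IH].
  by under eq_fun do rewrite big_nil; exact: L2_0.
under eq_fun do rewrite big_cons.
by case: (P i) (LF i) => // /(_ isT) ?; exact: L2D.
Qed.

Lemma L2_le f g : measurable_fun setT f -> (forall x, `|f x| <= `|g x|) ->
  L2 g -> L2 f.
Proof.
move=> mf fg [mg Lg]; split => //; apply: L1_le Lg; first exact: measurable_funX.
by move=> x; rewrite !normrX lerXn2r ?nnegrE.
Qed.

Lemma L2_ae f g : measurable_fun setT f -> L2 g ->
  (\forall x \ae mu, f x = g x) -> L2 f.
Proof.
move=> mf [mg Lg] fg; split => //; apply: L1_ae Lg _; first exact: measurable_funX.
by apply: filterS fg => x ->.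
Qed.

(** The integral of [(s f + t g)^2] is a nonnegative quadratic form in s and t. At (B, -C) it equals
    [B (A B - C^2)]; if B = 0 and C is nonzero, the choice s = 1, t = -(A + 1)/(2 C) would make it
    -1. *)
Lemma Cauchy_Schwarz f g : L2 f -> L2 g ->
  Int (fun x => f x * g x) ^+ 2 <= Int (fun x => f x ^+ 2) * Int (fun x => g x ^+ 2).
Proof.
move=> Lf Lg; have Lfg := L2M Lf Lg.
set A := Int (fun x => f x ^+ 2); set B := Int (fun x => g x ^+ 2).
set C := Int _.
have A0 : 0 <= A by apply: Int_ge0 => x; exact: sqr_ge0.
have B0 : 0 <= B by apply: Int_ge0 => x; exact: sqr_ge0.
have H (s t : R) : 0 <= s ^+ 2 * A + 2 * s * t * C + t ^+ 2 * B.
  have <- : Int (fun x => (s * f x + t * g x) ^+ 2) =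
      s ^+ 2 * A + 2 * s * t * C + t ^+ 2 * B.
    rewrite -!IntZ//; [|by case: Lg|by case: Lf].
    have [_ Lff] := Lf; have [_ Lgg] := Lg.
    rewrite -!IntD; try first [exact: L1Z | by apply: L1D; exact: L1Z].
    by congr Int; apply/funext => x; ring.
  by apply: Int_ge0 => x; exact: sqr_ge0.
have [B0'|B0'] := eqVneq B 0.
  rewrite B0' mulr0.
  have [->|C0] := eqVneq C 0; first by rewrite expr0n.
  have := H 1 (- (A + 1) / (2 * C)).
  rewrite B0'; have -> : 1 ^+ 2 * A + 2 * 1 * (- (A + 1) / (2 * C)) * C + (- (A + 1) / (2 * C)) ^+ 2 * 0 = - 1.
    by field.
  by rewrite oppr_ge0 ler10.
have := H B (- C).
have -> : B ^+ 2 * A + 2 * B * - C * C + (- C) ^+ 2 * B = B * (A * B - C ^+ 2) by ring.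
by rewrite pmulr_rge0 ?subr_ge0// lt_def B0' B0.
Qed.

Lemma Int_sqr_add f g : L2 f -> L2 g ->
  Int (fun x => (f x + g x) ^+ 2) <=
  2 * Int (fun x => f x ^+ 2) + 2 * Int (fun x => g x ^+ 2).
Proof.
move=> Lf Lg; have [_ Lff] := Lf; have [_ Lgg] := Lg; have [_ Lfg] := L2D Lf Lg.
rewrite -!IntZ// -IntD; [|exact: L1Z|exact: L1Z].
apply: Int_le => //; first by apply: L1D; exact: L1Z.
by move=> x; have := sqr_ge0 (f x - g x); rewrite !expr2; lra.
Qed.

Lemma measurable_patch f (A : set T) : measurable A -> measurable_fun A f ->
  measurable_fun setT (f \_ A).
Proof. by move=> mA mf; apply: (measurable_restrictT f mA).1. Qed.

Lemma L1_indic f (A : set T) : measurable A -> L1 f -> L1 (f \_ A).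
Proof.
move=> mA Lf; apply: L1_le (Lf); last by move=> x; rewrite patchE; case: ifP => //; rewrite normr0.
by apply: measurable_patch => //; apply: measurable_funS (L1_measurable Lf).
Qed.

Lemma indic_nonneg (A : set T) x : 0 <= \1_A x :> R.
Proof. by rewrite indicE ler0n. Qed.

Lemma L1_indicator (A : set T) : measurable A -> (mu A < +oo)%E -> L1 \1_A.
Proof.
move=> mA Aoo; apply/integrableP; split.
  by apply/measurable_EFinP; exact: measurable_indic.
under eq_integral do rewrite /= ger0_norm//.
by rewrite integral_indic// setIT.
Qed.

Lemma Int_indicator (A : set T) : measurable A -> Int \1_A = fine (mu A).
Proof. by move=> mA; rewrite /Int /Rintegral integral_indic// setIT. Qed.

Lemma L2_L1 f (A : set T) : measurable A -> (mu A < +oo)%E -> L2 f -> L1 (f \_ A).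
Proof.
move=> mA Aoo Lf.
have L2i : L2 (\1_A : T -> R).
  split => //; rewrite (_ : (fun _ => _) = \1_A).
    exact: L1_indicator.
  by apply/funext => x; rewrite indicE; case: (_ \in _); rewrite ?expr0n ?expr1n.
have := L2M Lf L2i; congr L1; apply/funext => x.
by rewrite patchE indicE; case: (_ \in _); rewrite ?mulr1 ?mulr0.
Qed.

Lemma integrable_L1 f (A : set T) : measurable A ->
  mu.-integrable A (EFin \o f) <-> L1 (f \_ A).
Proof. by move=> mA; rewrite /L1 -restrict_EFin; exact: integrable_mkcond. Qed.

Lemma Rintegral_Int f (A : set T) : \int[mu]_(x in A) f x = Int (f \_ A).
Proof. exact: Rintegral_mkcond. Qed.

Lemma L2_finite f (A : set T) : measurable A -> measurable_fun A f ->
  (\int[mu]_(x in A) (f x ^+ 2)%:E < +oo)%E <-> L2 (f \_ A).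
Proof.
move=> mA mf; have mfA : measurable_fun setT (f \_ A) by exact: measurable_patch.
have E : (\int[mu]_(x in A) (f x ^+ 2)%:E = \int[mu]_x `|((f \_ A) x ^+ 2)%:E|)%E.
  rewrite integral_mkcond; apply: eq_integral => x _.
  rewrite gee0_abs ?lee_fin ?sqr_ge0// !patchE; case: ifP => //.
  by rewrite expr0n.
rewrite E; split=> [H|[_ /integrableP[]//]]; split => //.
by apply/integrableP; split => //; apply/measurable_EFinP; exact: measurable_funX.
Qed.

End real_integral.

(** * Fubini and Tonelli for real-valued integrals *)

Section Rfubini.
Context {d1 d2} {T1 : measurableType d1} {T2 : measurableType d2} {R : realType}.
Variables (m1 : {sigma_finite_measure set T1 -> \bar R})
  (m2 : {sigma_finite_measure set T2 -> \bar R}).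
Implicit Types f : T1 * T2 -> R.

Lemma L1_fubini1 f : L1 (m1 \x m2)%E f -> \forall x \ae m1, L1 m2 (fun y => f (x, y)).
Proof. by move=> /ae_integrable1. Qed.

Lemma L1_fubini2 f : L1 (m1 \x m2)%E f -> \forall y \ae m2, L1 m1 (fun x => f (x, y)).
Proof. by move=> /ae_integrable2. Qed.

(** No integrability is assumed: [Int] is [fine] of a difference of the integrals of the positive
    and negative parts, each measurable in x by Tonelli. *)
Lemma measurable_Int1 f : measurable_fun setT f ->
  measurable_fun setT (fun x => Int m2 (fun y => f (x, y))).
Proof.
move=> mf.
apply: (measurableT_comp (@fine_measurable _ setT measurableT)).
under eq_fun do rewrite integralE.
apply: emeasurable_funB.
  have mfE : measurable_fun setT (EFin \o f)^\+%E.
    by apply: measurable_funepos; exact/measurable_EFinP.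
  have := @measurable_fun_fubini_tonelli_F _ _ _ _ _ m2 _ mfE (fun=> funepos_ge0 _ _).
  apply: (eq_measurable_fun _) => x _; rewrite /fubini_F; apply: eq_integral => y _.
  by rewrite !funeposE.
have mfE : measurable_fun setT (EFin \o f)^\-%E.
    by apply: measurable_funeneg; exact/measurable_EFinP.
  have := @measurable_fun_fubini_tonelli_F _ _ _ _ _ m2 _ mfE (fun=> funeneg_ge0 _ _).
  apply: (eq_measurable_fun _) => x _; rewrite /fubini_F; apply: eq_integral => y _.
  by rewrite !funenegE.
Qed.

Lemma measurable_Int2 f : measurable_fun setT f ->
  measurable_fun setT (fun y => Int m1 (fun x => f (x, y))).
Proof.
move=> mf.
apply: (measurableT_comp (@fine_measurable _ setT measurableT)).
under eq_fun do rewrite integralE.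
apply: emeasurable_funB.
  have mfE : measurable_fun setT (EFin \o f)^\+%E.
    by apply: measurable_funepos; exact/measurable_EFinP.
  have := @measurable_fun_fubini_tonelli_G _ _ _ _ _ m1 _ mfE (fun=> funepos_ge0 _ _).
  apply: (eq_measurable_fun _) => x _; rewrite /fubini_G; apply: eq_integral => y _.
  by rewrite !funeposE.
have mfE : measurable_fun setT (EFin \o f)^\-%E.
    by apply: measurable_funeneg; exact/measurable_EFinP.
  have := @measurable_fun_fubini_tonelli_G _ _ _ _ _ m1 _ mfE (fun=> funeneg_ge0 _ _).
  apply: (eq_measurable_fun _) => x _; rewrite /fubini_G; apply: eq_integral => y _.
  by rewrite !funenegE.
Qed.

Lemma L1_Int1 f : L1 (m1 \x m2)%E f -> L1 m1 (fun x => Int m2 (fun y => f (x, y))).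
Proof.
move=> Lf; have mf := L1_measurable Lf.
have Lg := integrable_fubini_F Lf.
apply/integrableP; split; first by apply/measurable_EFinP; exact: measurable_Int1.
have /integrableP[mF] := Lg; apply: le_lt_trans.
apply: ge0_le_integral => //.
- by apply: measurableT_comp => //; apply/measurable_EFinP; exact: measurable_Int1.
- exact: measurableT_comp.
move=> x _ /=; rewrite /Int /Rintegral /fubini_F /=.
by case: (integral _ _ _) => [r| |] /=; rewrite ?leey// normr0.
Qed.

Lemma L1_Int2 f : L1 (m1 \x m2)%E f -> L1 m2 (fun y => Int m1 (fun x => f (x, y))).
Proof.
move=> Lf; have mf := L1_measurable Lf.
have mfE : measurable_fun setT (EFin \o f) by exact/measurable_EFinP.
apply/integrableP; split; first by apply/measurable_EFinP; exact: measurable_Int2.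
have /(integrable21ltyP m1 m2 mfE) := Lf; apply: le_lt_trans.
apply: ge0_le_integral => //.
- by apply: measurableT_comp => //; apply/measurable_EFinP; exact: measurable_Int2.
- apply: (@measurable_fun_fubini_tonelli_G _ _ _ _ _ m1 (fun p => `|(EFin \o f) p|)%E) => //.
  exact: measurableT_comp.
move=> y _ /=.
have mfy : measurable_fun setT (fun x => (f (x, y))%:E).
  exact: measurableT_comp mfE (measurable_pair2 y).
apply: le_trans (le_abse_integral m1 measurableT mfy).
rewrite /Int /Rintegral /=.
by case: (integral _ _ _) => [r| |] /=; rewrite ?leey// normr0.
Qed.

Lemma Int_fubini1 f : L1 (m1 \x m2)%E f ->
  Int (m1 \x m2)%E f = Int m1 (fun x => Int m2 (fun y => f (x, y))).
Proof.
move=> Lf; have mf := L1_measurable Lf.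
rewrite /Int {1}/Rintegral -(integral12_prod_meas1 Lf) [RHS]/Rintegral; congr fine.
apply: ae_eq_integral => //; first exact: measurable_fubini_F Lf.
  by apply/measurable_EFinP; exact: measurable_Int1.
apply: filterS (L1_fubini1 Lf) => x Lx _.
by rewrite /= /Rintegral fineK//; exact: integrable_fin_num Lx.
Qed.

Lemma Int_fubini2 f : L1 (m1 \x m2)%E f ->
  Int (m1 \x m2)%E f = Int m2 (fun y => Int m1 (fun x => f (x, y))).
Proof.
move=> Lf; have mf := L1_measurable Lf.
rewrite /Int {1}/Rintegral -(integral21_prod_meas1 Lf) [RHS]/Rintegral; congr fine.
apply: ae_eq_integral => //; first exact: measurable_fubini_G Lf.
  by apply/measurable_EFinP; exact: measurable_Int2.
apply: filterS (L1_fubini2 Lf) => x Lx _.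
by rewrite /= /Rintegral fineK//; exact: integrable_fin_num Lx.
Qed.

Lemma Int_swap f : L1 (m1 \x m2)%E f ->
  Int m1 (fun x => Int m2 (fun y => f (x, y))) =
  Int m2 (fun y => Int m1 (fun x => f (x, y))).
Proof. by move=> Lf; rewrite -Int_fubini1// Int_fubini2. Qed.

Lemma L1_tensor (f : T1 -> R) (g : T2 -> R) : L1 m1 f -> L1 m2 g ->
  L1 (m1 \x m2)%E (fun p => f p.1 * g p.2).
Proof.
move=> Lf Lg; have mf := L1_measurable Lf; have mg := L1_measurable Lg.
have mfg : measurable_fun setT (fun p : T1 * T2 => f p.1 * g p.2).
  by apply: measurable_funM; exact: measurableT_comp.
apply/integrable12ltyP; first exact/measurable_EFinP.
have /integrableP[_ Lf'] := Lf; have /integrableP[_ Lg'] := Lg.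
rewrite (eq_integral (fun x => `|(f x)%:E| * \int[m2]_y `|(g y)%:E|)%E); last first.
  move=> x _; rewrite -ge0_integralZl//.
    by apply: eq_integral => y _; rewrite /= normrM EFinM.
  by apply: measurableT_comp => //; exact/measurable_EFinP.
rewrite ge0_integralZr//.
- by rewrite lte_mul_pinfty// ?integral_ge0// ge0_fin_numE// integral_ge0.
- by apply: measurableT_comp => //; exact/measurable_EFinP.
- exact: integral_ge0.
Qed.

(** The indicator of the exceptional null set has integral zero, hence so have almost all of its
    slices. *)
Lemma ae_fubini1 (P : T1 * T2 -> Prop) : (\forall p \ae (m1 \x m2)%E, P p) ->
  \forall x \ae m1, \forall y \ae m2, P (x, y).
Proof.
move=> [A [mA A0 PA]].
have L : L1 (m1 \x m2)%E (\1_A : _ -> R).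
  by apply: L1_indicator => //; rewrite [X in (X < _)%E]A0.
have I0 : Int (m1 \x m2)%E (\1_A : _ -> R) = 0.
  by rewrite /Int /Rintegral integral_indic// setIT [X in fine X]A0.
rewrite Int_fubini1// in I0.
have H := Int_eq0 (L1_Int1 L) (fun x => Int_ge0 _ (fun y => indic_nonneg _ _)) I0.
apply: filterS2 H (L1_fubini1 L) => x Hx Lx.
have {Hx}H := Int_eq0 Lx (fun y => indic_nonneg _ _) Hx.
apply: filterS H => y; rewrite indicE => H; apply: contrapT => /PA Axy.
by move: H; rewrite mem_set// => /eqP; rewrite oner_eq0.
Qed.

Lemma ae_fubini2 (P : T1 * T2 -> Prop) : (\forall p \ae (m1 \x m2)%E, P p) ->
  \forall y \ae m2, \forall x \ae m1, P (x, y).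
Proof.
move=> [A [mA A0 PA]].
have L : L1 (m1 \x m2)%E (\1_A : _ -> R).
  by apply: L1_indicator => //; rewrite [X in (X < _)%E]A0.
have I0 : Int (m1 \x m2)%E (\1_A : _ -> R) = 0.
  by rewrite /Int /Rintegral integral_indic// setIT [X in fine X]A0.
rewrite Int_fubini2// in I0.
have H := Int_eq0 (L1_Int2 L) (fun x => Int_ge0 _ (fun y => indic_nonneg _ _)) I0.
apply: filterS2 H (L1_fubini2 L) => x Hx Lx.
have {Hx}H := Int_eq0 Lx (fun y => indic_nonneg _ _) Hx.
apply: filterS H => y; rewrite indicE => H; apply: contrapT => /PA Axy.
by move: H; rewrite mem_set// => /eqP; rewrite oner_eq0.
Qed.

(** A converse to slicing, by Tonelli for the indicator of the complement. Here A itself must be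
    measurable, which is why later arguments first show that the set where two representatives agree
    is measurable. *)
Lemma ae_prod1 (A : set (T1 * T2)) : measurable A ->
  (\forall x \ae m1, \forall y \ae m2, A (x, y)) -> \forall p \ae (m1 \x m2)%E, A p.
Proof.
move=> mA H; exists (~` A); split => //; first exact: measurableC.
suff : (\int[m1 \x m2]_z (\1_(~` A) z)%:E = 0)%E.
  by rewrite integral_indic ?setIT//; exact: measurableC.
rewrite fubini_tonelli1//=.
- apply: (etrans _ (integral0 m1 setT)); apply: ae_eq_integral => //.
    apply: measurable_fun_fubini_tonelli_F => //.
    by apply/measurable_EFinP; apply: measurable_indic; exact: measurableC.
  apply: filterS H => x Hx _; rewrite /fubini_F.
  apply: (etrans _ (integral0 m2 setT)); apply: ae_eq_integral => //.
    apply/measurable_EFinP; apply: measurableT_comp (measurable_pair1 x) => //.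
    by apply: measurable_indic; exact: measurableC.
  apply: filterS Hx => y Axy _ /=.
  by rewrite indicE memNset//; exact.
- by apply/measurable_EFinP; apply: measurable_indic; exact: measurableC.
Qed.

End Rfubini.

Lemma ae_mono {d} {T : measurableType d} {R : realType} (mu : {measure set T -> \bar R})
    (P Q : T -> Prop) : (forall x, P x -> Q x) ->
  (\forall x \ae mu, P x) -> \forall x \ae mu, Q x.
Proof. by move=> PQ; apply: filterS. Qed.

Lemma ae_mono2 {d} {T : measurableType d} {R : realType} (mu : {measure set T -> \bar R})
    (P P' Q : T -> Prop) : (forall x, P x -> P' x -> Q x) ->
  (\forall x \ae mu, P x) -> (\forall x \ae mu, P' x) -> \forall x \ae mu, Q x.
Proof. by move=> PQ; apply: filterS2. Qed.

Lemma ae_forall_fin {d} {T : measurableType d} {R : realType}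
    (mu : {measure set T -> \bar R}) (I : finType) (P : I -> T -> Prop) :
  (forall i, \forall x \ae mu, P i x) -> \forall x \ae mu, forall i, P i x.
Proof.
move=> H; suff : \forall x \ae mu, forall i, i \in enum I -> P i x.
  by apply: filterS => x Hx i; apply: Hx; rewrite mem_enum.
elim: (enum I) => [|i s IH]; first by apply: aeW => x.
by apply: filterS2 (H i) IH => x Hi Hs j; rewrite inE => /predU1P[->//|]; exact: Hs.
Qed.

Lemma L1_ae_le {d} {T : measurableType d} {R : realType} (mu : {measure set T -> \bar R})
    (f g : T -> R) : measurable_fun setT f -> L1 mu g ->
  (\forall x \ae mu, `|f x| <= g x) -> L1 mu f.
Proof.
move=> mf Lg fg; have mg := L1_measurable Lg.
have mfn : measurable_fun setT (fun x => `|f x|) by exact: measurableT_comp.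
have L : L1 mu (fun x => Num.min `|f x| `|g x|).
  apply: L1_le (Lg) => [|x]; first by apply: measurable_minr => //; exact: measurableT_comp.
  by rewrite ger0_norm ?ge_min ?lexx ?orbT// le_min !normr_ge0.
apply: (@L1_le _ _ _ _ _ (fun x => `|f x|)) => // [x|]; first by rewrite normr_id.
apply: (L1_ae mfn L); apply: filterS fg => x fgx; apply/esym/min_idPl.
exact: le_trans fgx (ler_norm _).
Qed.

Lemma L1_fsum {d} {T : measurableType d} {R : realType} {mu : {measure set T -> \bar R}}
    {I : finType} {F : I -> T -> R} :
  (forall i, L1 mu (F i)) -> L1 mu (fun x => \sum_i F i x).
Proof. by move=> LF; apply: L1_sum. Qed.

Lemma Int_fsum {d} {T : measurableType d} {R : realType} {mu : {measure set T -> \bar R}}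
    {I : finType} {F : I -> T -> R} :
  (forall i, L1 mu (F i)) -> Int mu (fun x => \sum_i F i x) = \sum_i Int mu (F i).
Proof. by move=> LF; apply: Int_sum. Qed.

Lemma patch_in {X : Type} {R : realType} (A : set X) (f : X -> R) x : A x -> (f \_ A) x = f x.
Proof. by move=> Ax; rewrite patchE mem_set. Qed.

Lemma patch_out {X : Type} {R : realType} (A : set X) (f : X -> R) x : ~ A x -> (f \_ A) x = 0.
Proof. by move=> Ax; rewrite patchE memNset. Qed.

(** * Boxes and translations in R^n *)

Section pi_system_integral.
Context {d} {T : measurableType d} {R : realType}.
Variable mu : {measure set T -> \bar R}.

(** The sets over which f has integral zero form a Dynkin system that contains the generators, hence
    all measurable sets; the vanishing of the full integral puts the whole space into it. It then
    suffices to take the sets where f is positive and where it is negative. *)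
Lemma Int_pi_system (G : set (set T)) (f : T -> R) :
  measurable = <<s G >> -> setI_closed G -> L1 mu f -> Int mu f = 0 ->
  (forall A, G A -> Int mu (f \_ A) = 0) -> \forall x \ae mu, f x = 0.
Proof.
move=> mG GI Lf If0 fG; have mf := L1_measurable Lf.
pose H := [set A | measurable A /\ Int mu (f \_ A) = 0].
have HH : lambda_system setT H.
  split => //.
  - by split => //; rewrite patch_setT.
  - move=> A B BA [mA A0] [mB B0]; split; first exact: measurableD.
    rewrite (_ : f \_ (A `\` B) = fun x => (f \_ A) x - (f \_ B) x).
      by rewrite IntB ?A0 ?B0 ?subrr//; exact: L1_indic.
    apply/funext => x; rewrite !patchE in_setD.
    have [xB|xB] := boolP (x \in B); last by rewrite andbT; case: ifP; rewrite subr0.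
    by rewrite andbF (_ : x \in A) ?subrr//; move/set_mem : xB => /BA /mem_set.
  - move=> F ndF HF; have mF k : measurable (F k) by case: (HF k).
    have mU : measurable (\bigcup_k F k) by exact: bigcupT_measurable.
    split => //.
    have := @Int_cvg _ _ _ mu (fun k => f \_ (F k)) (f \_ (\bigcup_k F k)) (fun x => `|f x|).
    have -> : (fun k => Int mu (f \_ (F k))) = fun=> 0.
      by apply/funext => k; case: (HF k).
    move=> /(_ _ _ (L1_norm Lf)) cv; apply/esym/(cvg_unique _ _ (cv _ _ _ _)) => //.
    + exact: cvg_cst.
    + by move=> k; apply: (@L1_measurable _ _ _ mu); exact: L1_indic.
    + by apply: (@L1_measurable _ _ _ mu); exact: L1_indic.
    + by move=> k x; rewrite patchE; case: ifP => //; rewrite normr0.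
    + apply: aeW => x; rewrite patchE; case: ifPn => [/set_mem[k _ Fkx]|xU].
        apply: cvg_near_cst; exists k => //= l kl.
        rewrite patchE mem_set//; have /subsetPset := ndF _ _ kl; exact.
      rewrite (_ : (fun k => _) = fun=> 0); first exact: cvg_cst.
      apply/funext => k; rewrite patchE memNset// => Fkx.
      by move: xU => /negP; apply; apply/mem_set; exists k.
have GH : G `<=` H.
  by move=> A GA; split; [rewrite mG; exact: sub_sigma_algebra|exact: fG].
have {GH}Hm : forall A, measurable A -> Int mu (f \_ A) = 0.
  move=> A; rewrite mG => sA.
  by have [] := lambda_system_subset GI HH GH (fun _ _ => @subsetT _ _) sA.
have mpos : measurable [set x | 0 < f x].
  rewrite (_ : [set x | _] = setT `&` f @^-1` `]0, +oo[%classic); first exact: mf.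
  by rewrite setTI; apply/seteqP; split => x /=; rewrite in_itv/= andbT.
have mneg : measurable [set x | f x < 0].
  rewrite (_ : [set x | _] = setT `&` f @^-1` `]-oo, 0[%classic); first exact: mf.
  by rewrite setTI; apply/seteqP; split => x /=; rewrite in_itv/=.
have P0 : \forall x \ae mu, (f \_ [set x | 0 < f x]) x = 0.
  apply: Int_eq0; [exact: L1_indic| |exact: Hm].
  by move=> x; rewrite patchE; case: ifPn => // /set_mem/ltW.
have N0 : \forall x \ae mu, (fun x => - (f \_ [set x | f x < 0]) x) x = 0.
  apply: Int_eq0; [by apply/L1N/L1_indic| |].
    by move=> x; rewrite patchE oppr_ge0; case: ifPn => // /set_mem/ltW.
  by rewrite IntN ?Hm ?oppr0//; exact: L1_indic.
apply: filterS2 P0 N0 => x; rewrite !patchE.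
have [|] := boolP (x \in _) => // xp.
have [|] := boolP (x \in _) => [_ _ /eqP|xn _ _]; first by rewrite oppr_eq0 => /eqP.
apply/eqP; rewrite eq_le !leNgt; apply/andP; split; apply/negP => h.
  by move/negP : xp; apply; exact/mem_set.
by move/negP : xn; apply; exact/mem_set.
Qed.

End pi_system_integral.

Section boxes.
Context {R : realType} {n : nat}.
Local Notation vec := 'rV[R]_n.
Local Notation leb := (@lebesgue_row R n).
Implicit Types (a b : 'I_n -> R) (x y : vec).

Definition box a b : set vec := [set x | forall i, a i < x ord0 i < b i].
Definition cbox a b : set vec := [set x | forall i, a i <= x ord0 i <= b i].

Lemma measurable_pibox (A : 'I_n -> set R) : (forall i, measurable (A i)) ->
  measurable [set x : vec | forall i, A i (x ord0 i)].
Proof.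
move=> mA; rewrite [X in measurable X](_ : _ =
      \big[setI/setT]_(i < n) (row_coord i @^-1` A i)).
  apply: bigsetI_measurable => i _.
  by rewrite -[X in measurable X]setTI; exact: measurable_row_coord.
rewrite -bigcap_seq; apply/seteqP; split => [x /= + i _|x /= + i]; first exact.
by apply => /=; rewrite mem_index_enum.
Qed.

Lemma boxE a b : box a b = [set x | forall i, `]a i, b i[%classic (x ord0 i)].
Proof. by apply/seteqP; split => x /= H i; have := H i; rewrite /= in_itv. Qed.

Lemma measurable_box a b : measurable (box a b).
Proof. rewrite boxE; apply: (@measurable_pibox (fun i => `]a i, b i[%classic)) => i.
exact: measurable_itv. Qed.

Lemma lebesgue_box a b : (forall i, a i <= b i) ->
  leb (box a b) = (\prod_i (b i - a i))%:E.
Proof.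
move=> ab; rewrite boxE (@lebesgue_row_box _ _ (fun i => `]a i, b i[%classic)); last first.
  by move=> i; exact: measurable_itv.
rewrite (eq_bigr (fun i => (b i - a i)%:E)); first by rewrite -prodEFin.
move=> i _; rewrite lebesgue_measure_itv/= lte_fin; case: ltP => // ba.
by rewrite (_ : b i = a i) ?subrr//; apply/eqP; rewrite eq_le ba ab.
Qed.

Lemma box_eq0 a b i : b i < a i -> box a b = set0.
Proof.
move=> ba; apply/seteqP; split => // x /(_ i) /andP[h1 h2].
by move: ba; rewrite ltNge (ltW (lt_trans h1 h2)).
Qed.

Lemma box_setI a b a' b' : box a b `&` box a' b' =
  box (fun i => Num.max (a i) (a' i)) (fun i => Num.min (b i) (b' i)).
Proof.
apply/seteqP; split => [x /= [H H'] i|x /= H].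
  by rewrite gt_max lt_min; have /andP[-> ->] := H i; have /andP[-> ->] := H' i.
by split=> i; have := H i; rewrite gt_max lt_min => /andP[/andP[h1 h2] /andP[h3 h4]]; rewrite ?h1 ?h2 ?h3 ?h4.
Qed.

Definition open_boxes : set (set vec) := [set A | exists a b, A = box a b].

Lemma open_boxes_setI : setI_closed open_boxes.
Proof. by move=> _ _ [a [b ->]] [a' [b' ->]]; rewrite box_setI; eexists; eexists. Qed.

Lemma box_cover : \bigcup_k box (fun=> - k%:R) (fun=> k%:R) = setT.
Proof.
apply/seteqP; split => // x _.
exists (Num.bound (\sum_i `|x ord0 i|)) => //= i.
rewrite -ltr_norml; apply: le_lt_trans (archi_boundP _); last exact: sumr_ge0.
by rewrite (bigD1 i)//= lerDl sumr_ge0.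
Qed.

Lemma measurable_open_boxes : @measurable _ vec = <<s open_boxes >>.
Proof.
apply/seteqP; split; last first.
  apply: smallest_sub; first exact: sigma_algebra_measurable.
  by move=> _ [a [b ->]]; exact: measurable_box.
apply: smallest_sub; first exact: smallest_sigma_algebra.
move=> B; rewrite -bigcup_seq => -[i _] [C mC <-] /=; rewrite setTI.
move: mC; rewrite [measurable](_ : _ = @measurable _ (measurableTypeR R))//.
rewrite RGenOpens.measurableE.
pose H := [set A : set R | <<s open_boxes >> (row_coord i @^-1` A)].
suff : <<s @RGenOpens.G R >> `<=` H by exact.
apply: smallest_sub.
  have [s0 sC sU] := @smallest_sigma_algebra _ setT open_boxes.
  split => [|A HA|F HF]; rewrite /H /=.
  - by rewrite preimage_set0.
  - by rewrite setTD preimage_setC -setTD; exact: sC.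
  - by rewrite preimage_bigcup; exact: sU.
move=> _ [x [y ->]]; rewrite /H /=.
(* A slab [x < z_i < y] is unbounded in the other coordinates; it is the union over k of its
   intersections with the cubes of half-side k, and these are boxes. *)
rewrite -[X in <<s _ >> X]setTI -box_cover setI_bigcupl.
apply: sigma_algebra_bigcup => k; apply: sub_sigma_algebra.
exists (fun j => if j == i then Num.max x (- k%:R) else - k%:R).
exists (fun j => if j == i then Num.min y k%:R else k%:R).
apply/seteqP; split => [z /= [H1 +] j|z /= H1].
  rewrite in_itv/= => H2; case: eqP => [->|_]; last exact: H1.
  by rewrite gt_max lt_min; have /andP[-> ->] := H1 i; case/andP : H2 => -> ->.
split=> [j|].
  have := H1 j; case: eqP => // ->.
  by rewrite gt_max lt_min => /andP[/andP[_ ->] /andP[_ ->]].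
have := H1 i; rewrite eqxx in_itv/= /row_coord.
by rewrite gt_max lt_min => /andP[/andP[-> _] /andP[-> _]].
Qed.

Lemma row_measure_unique (m1 m2 : {measure set vec -> \bar R}) :
  (forall a b, m1 (box a b) = m2 (box a b)) ->
  (forall k : nat, (m1 (box (fun=> (- k%:R)%R) (fun=> k%:R%R)) < +oo)%E) ->
  forall A, measurable A -> m1 A = m2 A.
Proof.
move=> m12 moo A mA.
apply: (@measure_unique _ _ _ open_boxes
  (fun k : nat => box (fun=> - k%:R) (fun=> k%:R))) => //.
- exact: measurable_open_boxes.
- exact: open_boxes_setI.
- by move=> k; exists (fun=> - k%:R), (fun=> k%:R).
- exact: box_cover.
- by move=> _ [a [b ->]].
Qed.

Definition shift (y x : vec) : vec := x + y.

Lemma measurable_shift y : measurable_fun setT (shift y).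
Proof.
apply: measurable_to_row => i; under eq_fun do rewrite mxE.
by apply: measurable_funD => //; exact: (measurable_row_coord i).
Qed.

Definition shifted y : set vec -> \bar R := pushforward leb (shift y).

HB.instance Definition _ y := Measure.copy (shifted y)
  (measure_function_pushforward__canonical__measure_function_Measure
     leb (measurable_shift y)).

Lemma lebesgue_shift y A : measurable A -> leb (shift y @^-1` A) = leb A.
Proof.
move=> mA; apply/esym.
apply: (row_measure_unique (m2 := shifted y)) mA => [a b|k]; last first.
  suff : (leb (box (fun=> (- k%:R)%R) (fun=> k%:R%R)) < +oo)%E by [].
  by rewrite lebesgue_box ?ltry// => i; rewrite (@le_trans _ _ 0) ?oppr_le0 ?ler0n.
rewrite /= /shifted /pushforward.
have -> : shift y @^-1` (box a b) = box (fun i => a i - y ord0 i) (fun i => b i - y ord0 i).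
  by apply/seteqP; split => x /= H i; have := H i; rewrite mxE ltrBlDr ltrBrDr.
(* The product formula for the volume holds only when the bounds are ordered; otherwise both boxes
   are empty. *)
have [ab|] := boolP [forall i, a i <= b i].
  move/forallP in ab; rewrite !lebesgue_box//; last by move=> i; rewrite lerD2r.
  by congr _%:E; apply: eq_bigr => i _; ring.
rewrite negb_forall => /existsP[i]; rewrite -ltNge => ba.
by rewrite (box_eq0 ba) (@box_eq0 _ _ i)// ltrD2r.
Qed.

Lemma ae_shift y (P : vec -> Prop) : (\forall x \ae leb, P x) ->
  \forall x \ae leb, P (x + y).
Proof.
move=> [A [mA A0 PA]]; exists (shift y @^-1` A); split.
- by rewrite -[X in measurable X]setTI; exact: measurable_shift.
- by rewrite lebesgue_shift.
- by move=> x /= Px; exact: PA.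
Qed.

Lemma L1_shift y (f : vec -> R) : L1 leb f -> L1 leb (fun x => f (x + y)).
Proof.
move=> Lf; have mf := L1_measurable Lf.
have mfy : measurable_fun setT (fun x => f (x + y)).
  exact: measurableT_comp mf (measurable_shift y).
apply/integrableP; split; first exact/measurable_EFinP.
have /integrableP[_] := Lf; congr (_ < _)%E.
transitivity (\int[shifted y]_x `|(EFin \o f) x|)%E.
  by apply: eq_measure_integral => A mA _; exact/esym/lebesgue_shift.
rewrite ge0_integral_pushforward//; first exact: measurable_shift.
by apply: measurableT_comp => //; exact/measurable_EFinP.
Qed.

Lemma Int_shift y (f : vec -> R) : L1 leb f -> Int leb (fun x => f (x + y)) = Int leb f.
Proof.
move=> Lf; have mf := L1_measurable Lf.
rewrite /Int /Rintegral; congr fine; apply/esym.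
transitivity (\int[shifted y]_x (f x)%:E)%E.
  by apply: eq_measure_integral => A mA _; exact/esym/lebesgue_shift.
rewrite (integral_pushforward (measurable_shift y))//.
- exact/measurable_EFinP.
- exact: L1_shift Lf.
Qed.

Lemma cbox_compact a b : compact (cbox a b).
Proof.
rewrite (_ : cbox a b = [set x | forall i, `[a i, b i]%classic (x ord0 i)]).
  apply: (@rV_compact _ _ (fun i => `[a i, b i]%classic)) => i.
  exact: segment_compact.
by apply/seteqP; split => x /= H i; have := H i; rewrite /= in_itv.
Qed.

Lemma ballE x (r : R) : 0 < r -> ball x r =
  box (fun i => x ord0 i - r) (fun i => x ord0 i + r).
Proof.
move=> r0; apply/seteqP; split => [y [_ H] i|y H]; last first.
  split => // i j; rewrite (ord1 i) /ball /= ltr_distlC; exact: H.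
by have := H ord0 i; rewrite /ball /= ltr_distlC.
Qed.

Lemma measurable_rball x (r : R) : 0 < r -> measurable (ball x r).
Proof. by move=> r0; rewrite ballE//; exact: measurable_box. Qed.

Definition ratv (q : 'rV[rat]_n) : vec := map_mx ratr q.

Lemma ball_ratP (U : set vec) x (r : R) : 0 < r -> ball x r `<=` U ->
  exists (q : 'rV[rat]_n) (k : nat),
    ball (ratv q) k.+1%:R^-1 x /\ ball (ratv q) k.+1%:R^-1 `<=` U.
Proof.
move=> r0 xrU.
have [k kr] : exists k : nat, k.+1%:R^-1 < r / 2.
  exists (Num.bound (r / 2)^-1); rewrite -[ltRHS]invrK ltf_pV2 ?posrE ?invr_gt0 ?divr_gt0//.
  apply: (lt_le_trans (archi_boundP _)); last by rewrite ler_nat.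
  by rewrite invr_ge0 divr_ge0// ltW.
have k0 : 0 < k.+1%:R^-1 :> R by [].
have /choice[q Hq] : forall i, exists q : rat, `|ratr q - x ord0 i| < k.+1%:R^-1 :> R.
  move=> i; have [|q] := @rat_in_itvoo R (x ord0 i - k.+1%:R^-1) (x ord0 i + k.+1%:R^-1).
    by rewrite ltrD2l gt0_cp.
  by rewrite in_itv/= -ltr_distl; exists q.
exists (\row_i q i), k; split.
  split => // i j; rewrite (ord1 i) /ball /= !mxE; exact: Hq.
move=> y [_ Hy]; apply: xrU; split => // i j; rewrite (ord1 i) /ball /=.
have := Hy ord0 j; rewrite /ball /= !mxE => {}Hy.
rewrite [ltRHS](splitr r) -(subrKA (ratr (q j))).
apply: (le_lt_trans (ler_normD _ _)); apply: ltrD.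
  by rewrite distrC; apply: lt_trans kr; exact: Hq.
exact: lt_trans kr.
Qed.

(** A Lindelof argument: balls with rational centre and radius 1/(k+1) are countably many, and each
    point of U lies in one contained in its good ball, so the exceptions form a countable union of
    null sets. *)
Lemma ae_local (U : set vec) (P : vec -> Prop) :
  (forall p, U p -> exists2 r : R, 0 < r & \forall x \ae leb, ball p r x -> P x) ->
  \forall x \ae leb, U x -> P x.
Proof.
move=> H.
pose F (k : nat) : set vec := if @unpickle ('rV[rat]_n * nat)%type k is Some i then
  if `[< \forall x \ae leb, ball (ratv i.1) i.2.+1%:R^-1 x -> P x >] then
  [set x | ball (ratv i.1) i.2.+1%:R^-1 x /\ ~ P x] else set0 else set0.
have nF k : leb.-negligible (F k).
  rewrite /F; case: unpickle => [i|]; last exact: negligible_set0.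
  case: ifPn => [/asboolP h|_]; last exact: negligible_set0.
  by apply: negligibleS h => x /= [bx Px] /(_ bx).
apply: negligibleS (negligible_bigcup nF) => x /= /not_implyP[Ux nPx].
have [r r0 Hr] := H _ Ux.
have [q [k [xq qx]]] := @ball_ratP (ball x r) x r r0 (fun _ => id).
exists (pickle (q, k)) => //; rewrite /F pickleK /=.
rewrite ifT//; apply/asboolP; apply: filterS Hr => y Hy /qx; exact: Hy.
Qed.

(** The sigma-algebra of row vectors is generated by the coordinates, not by the topology; open sets
    belong to it as countable unions of rational balls. *)
Lemma open_row_measurable (U : set vec) : open U -> measurable U.
Proof.
move=> oU.
pose F (i : 'rV[rat]_n * nat) : set vec :=
  if `[< ball (ratv i.1) i.2.+1%:R^-1 `<=` U >] then
  ball (ratv i.1) i.2.+1%:R^-1 else set0.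
rewrite (_ : U = \bigcup_i F i).
  apply: countable_bigcupT_measurable => // i; rewrite /F.
  by case: ifP => // _; exact: measurable_rball.
apply/seteqP; split => [x Ux|x [i _]]; last by rewrite /F; case: ifPn => // /asboolP; exact.
have /nbhs_ballP[r r0 xr] := open_nbhs_nbhs (conj oU Ux).
have [q [k [xq qx]]] := ball_ratP r0 xr.
by exists (q, k) => //; rewrite /F /= ifT//; exact/asboolP.
Qed.

Lemma continuous_row_measurable (f : vec -> R) : continuous f -> measurable_fun setT f.
Proof.
move=> cf; apply: (measurability _ (RGenOpens.measurableE R)) => _ [_ [x [y ->]] <-].
rewrite setTI; apply: open_row_measurable.
by apply: open_comp => // z _; exact: cf.
Qed.

End boxes.

(** * Weak partial derivatives and difference quotients *)

Section supports.
Context {R : realType}.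

Lemma compact_support_bounded {V : normedModType R} (f : V -> R) (K : set V) :
  continuous f -> compact K -> (forall x, ~ K x -> f x = 0) ->
  exists2 M : R, 0 <= M & forall x, `|f x| <= M.
Proof.
move=> cf cK f0.
have : compact (f @` K).
  by apply: continuous_compact => //; exact: continuous_subspaceT.
move=> /compact_bounded[M [_ HM]].
exists (`|M| + 1); first by rewrite addr_ge0.
move=> x; have [Kx|/f0->] := pselect (K x); last by rewrite normr0 addr_ge0.
by apply: (HM (`|M| + 1)); [rewrite (le_lt_trans (ler_norm _))// ltrDl|exists x].
Qed.

Lemma derive1_support (f : R -> R) a b : (forall x, ~~ (a <= x <= b) -> f x = 0) ->
  forall x, ~~ (a <= x <= b) -> derive1 f x = 0.
Proof.
move=> f0 x xab; rewrite derive1E; suff h : is_derive x 1 f 0 by rewrite derive_val.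
apply: (@near_eq_is_derive _ _ _ (cst 0)).
move: xab; rewrite negb_and -!ltNge => /orP[h|h]; near=> y; rewrite f0// negb_and -!ltNge.
  by apply/orP; left; near: y; exact: lt_nbhsl.
by apply/orP; right; near: y; exact: lt_nbhsr.
Unshelve. all: by end_near.
Qed.

Lemma smooth1_FTC (f : R -> R) h : smooth1 f -> 0 <= h ->
  \int[lebesgue_measure]_(s in `[0, h]) derive1 f s = f h - f 0.
Proof.
move=> sf; rewrite le_eqVlt => /predU1P[<-|h0].
  by rewrite set_itv1 Rintegral_set1 subrr.
have cf := smooth1_continuous sf.
have df x : derivable f x 1 by have [] := smooth1_is_derive x sf.
rewrite -[RHS]/(fine ((f h)%:E - (f 0)%:E)%E) /Rintegral; congr fine.
apply: continuous_FTC2 h0 _ _ _.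
- by apply: continuous_subspaceT; apply: smooth1_continuous; exact: smooth1_derive1.
- split; first by move=> x _; exact: df.
    by apply: cvg_at_right_filter; exact: cf.
  by apply: cvg_at_left_filter; exact: cf.
- by [].
Qed.

End supports.

Lemma lebesgue_itv_lty {R : realType} (a b : R) s t :
  (lebesgue_measure [set` Interval (BSide s a) (BSide t b)] < +oo)%E.
Proof. by rewrite lebesgue_measure_itv/=; case: ifP => // _; rewrite -EFinD ltry. Qed.

Section fundamental_lemma.
Context {R : realType} {n : nat}.
Local Notation vec := 'rV[R]_n.
Local Notation leb := (@lebesgue_row R n).
Local Notation leb1 := (@lebesgue_measure R).
Local Notation tens := (tensor (@row_coord R n)).

Lemma row_coord_continuous i : continuous (@row_coord R n i).
Proof. exact: coord_continuous. Qed.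

Lemma row_coord_affine i (v : vec) : affine_along (row_coord i) v (v ord0 i).
Proof. by move=> x h; rewrite /row_coord !mxE addrC. Qed.

Lemma tens_smooth F : (forall i, smooth1 (F i)) -> smooth_tensor (tens F).
Proof.
move=> sF; apply: tensor_smooth => //; first exact: row_coord_continuous.
by move=> i v; exists (v ord0 i); exact: row_coord_affine.
Qed.

Lemma tens_continuous F : (forall i, smooth1 (F i)) -> continuous (tens F).
Proof. by move=> /tens_smooth; exact: smooth_tensor_continuous. Qed.

Lemma tens_measurable F : (forall i, smooth1 (F i)) -> measurable_fun setT (tens F).
Proof. by move=> /tens_continuous; exact: continuous_row_measurable. Qed.

Definition supported (a b : 'I_n -> R) (F : 'I_n -> R -> R) :=
  forall i x, ~~ (a i <= x <= b i) -> F i x = 0.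

Lemma tens_support a b F : supported a b F -> forall x, ~ cbox a b x -> tens F x = 0.
Proof.
move=> F0 x /existsNP[i /negP xi]; rewrite /tensor (bigD1 i)//=.
by rewrite F0 ?mul0r.
Qed.

Lemma tens_bounded a b F : (forall i, smooth1 (F i)) -> supported a b F ->
  exists2 M : R, 0 <= M & forall x, `|tens F x| <= M.
Proof.
move=> sF F0; apply: (compact_support_bounded (K := cbox a b)).
- exact: tens_continuous.
- exact: cbox_compact.
- exact: tens_support.
Qed.

Lemma upd_smooth (F : 'I_n -> R -> R) k g : (forall i, smooth1 (F i)) -> smooth1 g ->
  forall i, smooth1 (upd F k g i).
Proof. by move=> sF sg i; rewrite /upd; case: ifP. Qed.

Lemma upd_supported a b F k : supported a b F -> supported a b (upd F k (derive1 (F k))).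
Proof.
move=> F0 i x xab; rewrite /upd; case: eqP => [E|_]; last exact: F0.
by rewrite E in xab; apply: derive1_support xab => y; exact: F0.
Qed.

Lemma cvg_prod1 (I : Type) (s : seq I) (u : nat -> I -> R) :
  (forall i, u k i @[k --> \oo] --> (1 : R)) ->
  \prod_(i <- s) u k i @[k --> \oo] --> (1 : R).
Proof.
move=> H; elim: s => [|i s IH].
  by under eq_fun do rewrite big_nil; exact: cvg_cst.
under eq_fun do rewrite big_cons.
apply: (@cvg_trans _ (nbhs (1 * 1 : R))); first exact: (cvgM (H i) IH).
by rewrite mulr1.
Qed.

(** As k grows the tensor bumps converge boundedly to indicators, so w has integral zero over every
    box inside [box a b]; boxes form a generating pi-system. *)
Lemma fundamental_lemma (a b : 'I_n -> R) (w : vec -> R) : L1 leb w ->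
  (forall a' b', (forall i, a i <= a' i /\ b' i <= b i) -> forall k : nat,
    Int leb (fun x => w x * tens (fun i => bump k.+1%:R (a' i) (b' i)) x) = 0) ->
  \forall x \ae leb, box a b x -> w x = 0.
Proof.
move=> Lw H; have mw := L1_measurable Lw.
have H1 a' b' : (forall i, a i <= a' i /\ b' i <= b i) ->
    Int leb (w \_ (box a' b')) = 0.
  move=> ab; have := @Int_cvg _ _ _ leb
    (fun k x => w x * tens (fun i => bump k.+1%:R (a' i) (b' i)) x) (w \_ (box a' b')) (fun x => `|w x|).
  under [X in (X @ _)%classic]eq_fun do rewrite H//.
  move=> cv; apply/esym/(cvg_unique _ _ (cv _ _ _ _ _)) => //.
  - exact: cvg_cst.
  - by move=> k; apply: measurable_funM => //; apply: tens_measurable => i; exact: smooth1_bump.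
  - by apply: measurable_patch; [exact: measurable_box|exact: measurable_funS mw].
  - exact: L1_norm.
  - move=> k x; rewrite normrM ler_piMr// normr_prod.
    apply: prodr_ile1 => i _; rewrite normr_ge0 ger0_norm ?bump_ge0//.
    exact: bump_le1.
  apply: aeW => x; rewrite patchE; case: ifPn => [/set_mem|] xb.
    rewrite -[X in _ --> X]mulr1; apply: cvgM; first exact: cvg_cst.
    by apply: cvg_prod1 => i; apply: bump_cvg; exact: xb.
  rewrite (_ : (fun k => _) = fun=> 0); first exact: cvg_cst.
  apply/funext => k; rewrite /tensor.
  have /existsNP[i /negP xi] : ~ box a' b' x by move=> h; move/negP: xb; apply; exact/mem_set.
  by rewrite (bigD1 i)//= bump_out ?ltr0n// mul0r mulr0.
have : \forall x \ae leb, (w \_ (box a b)) x = 0.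
  apply: (Int_pi_system measurable_open_boxes open_boxes_setI).
  - by apply: L1_indic => //; exact: measurable_box.
  - by apply: H1.
  move=> _ [a' [b' ->]].
  rewrite (_ : w \_ (box a b) \_ (box a' b') =
      w \_ (box (fun i => Num.max (a i) (a' i)) (fun i => Num.min (b i) (b' i)))).
    by apply: H1 => i; rewrite le_max lexx ge_min lexx.
  by rewrite -box_setI setIC patch_setI.
apply: filterS => x; rewrite patchE => + bx.
by rewrite mem_set.
Qed.

(* Tensor products suffice as test functions: they already separate L1
   functions, and 'D_k of a product only touches the k-th factor. *)
Definition weak_partial (U : set vec) (v g : vec -> R) (k : 'I_n) : Prop :=
  forall F a b, (forall i, smooth1 (F i)) -> supported a b F -> cbox a b `<=` U ->
  Int leb (fun x => v x * tens (upd F k (derive1 (F k))) x) =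
  - Int leb (fun x => g x * tens F x).

Local Notation ee k := (delta_mx ord0 k : vec).

Lemma measurable_slide (k : 'I_n) :
  measurable_fun setT (fun p : R * vec => p.2 + p.1 *: ee k).
Proof.
apply: measurable_to_row => i; under eq_fun do rewrite !mxE.
apply: measurable_funD; first exact: measurableT_comp (measurable_row_coord i) measurable_snd.
by apply: measurable_funM => //; exact: measurable_fst.
Qed.

Lemma measurable_slideN (k : 'I_n) :
  measurable_fun setT (fun p : R * vec => p.2 - p.1 *: ee k).
Proof.
apply: measurable_to_row => i; under eq_fun do rewrite !mxE.
apply: measurable_funB; first exact: measurableT_comp (measurable_row_coord i) measurable_snd.
by apply: measurable_funM => //; exact: measurable_fst.
Qed.

Lemma tens_line_continuous F k x : (forall i, smooth1 (F i)) ->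
  continuous (fun s : R => tens F (x - s *: ee k)).
Proof.
move=> sF s; apply: (@continuous_comp _ _ _ (fun s : R => x - s *: ee k)); last exact: tens_continuous.
by apply: cvgB; [exact: cvg_cst|apply: cvgZr_tmp; exact: cvg_id].
Qed.

Lemma L1_slide (g : vec -> R) k h : L1 leb g ->
  L1 (leb1 \x leb)%E (fun p : R * vec => \1_`[0, h] p.1 * g (p.2 + p.1 *: ee k)).
Proof.
move=> Lg; have mg := L1_measurable Lg.
have mG : measurable_fun setT (fun p : R * vec => \1_`[0, h] p.1 * g (p.2 + p.1 *: ee k)).
  apply: measurable_funM; last exact: measurableT_comp mg (measurable_slide k).
  by apply: measurableT_comp measurable_fst; exact: measurable_indic.
apply/integrable12ltyP; first exact/measurable_EFinP.
apply: (@le_lt_trans _ _ (\int[leb1]_s ((\1_`[0, h] s)%:E * \int[leb]_y `|(g y)%:E|))%E).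
  rewrite le_eqVlt; apply/orP; left; apply/eqP; apply: eq_integral => s _ /=.
  rewrite (eq_integral (fun y : vec => (\1_`[0, h] s)%:E * `|g (y + s *: ee k)|%:E)%E); last first.
    by move=> y _; rewrite normrM EFinM (ger0_norm (indic_nonneg _ _)).
  rewrite ge0_integralZl//; last first.
  - by apply/measurable_EFinP; apply: measurableT_comp => //; exact/L1_measurable/L1_shift.
  congr *%E; have := congr1 EFin (Int_shift (s *: ee k) (L1_norm Lg)).
  rewrite /Int /Rintegral !fineK//.
    exact: integrable_fin_num (L1_norm Lg).
  exact: integrable_fin_num (L1_shift (s *: ee k) (L1_norm Lg)).
rewrite ge0_integralZr//; last exact: integral_ge0.
- rewrite integral_indic// setIT.
  have /integrableP[_ Lg'] := Lg.
  rewrite lte_mul_pinfty ?integral_ge0//.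
    by rewrite ge0_fin_numE//; exact: lebesgue_itv_lty.
- by apply/measurable_EFinP; exact: measurable_indic.
Qed.

Lemma tens_slide F k s x :
  tens F (x - s *: ee k) = tens (upd F k (fun y => F k (y - s))) x.
Proof.
apply: eq_bigr => i _; rewrite /upd /row_coord !mxE /=.
by have [->|_] := eqVneq i k; rewrite ?mulr1 ?mulr0 ?subr0.
Qed.

Lemma L1_segment (f : R -> R) h : continuous f -> L1 leb1 (fun s => \1_`[0, h] s * f s).
Proof.
move=> cf; have mI : measurable (`[0, h]%classic : set R) by exact: measurable_itv.
have := @continuous_compact_integrable R f _ (@segment_compact R 0 h).
move=> /(_ (continuous_subspaceT cf)) /(integrable_L1 leb1 f mI).
by congr L1; apply/funext => x; rewrite patchE indicE; case: ifP; rewrite ?mul1r ?mul0r.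
Qed.

Lemma L1_indic_segment h : L1 leb1 (fun s => \1_`[0, h] s).
Proof.
have := @L1_segment (cst 1) h (@cst_continuous _ _ _).
by congr L1; apply/funext => s; rewrite mulr1.
Qed.

Lemma Int_segment (f : R -> R) h :
  Int leb1 (fun s => \1_`[0, h] s * f s) = \int[leb1]_(s in `[0, h]) f s.
Proof.
rewrite Rintegral_Int; congr Int; apply/funext => x.
by rewrite patchE indicE; case: ifP; rewrite ?mul1r ?mul0r.
Qed.

Lemma smooth1_slide (f : R -> R) s : smooth1 f -> smooth1 (fun y => f (y - s)).
Proof.
move=> sf; have := smooth1_affine 1 (- s) sf.
by congr smooth1; apply/funext => y; rewrite mul1r.
Qed.

Lemma derive1_slide (f : R -> R) s : smooth1 f ->
  derive1 (fun y => f (y - s)) = fun y => derive1 f (y - s).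
Proof.
move=> sf; apply/funext => y; rewrite derive1E.
suff h : is_derive y (1 : R) (fun y : R => f (y - s)) (derive1 f (y - s)) by exact: derive_val.
rewrite -[X in is_derive _ _ _ X]mulr1.
apply: (@is_derive1_comp _ f (fun y => y - s)); first exact: smooth1_is_derive.
by apply: is_derive_eq; rewrite subr0.
Qed.

Lemma tens_FTC F k (h : R) x : (forall i, smooth1 (F i)) -> 0 <= h ->
  tens F (x - h *: ee k) - tens F x =
  - Int leb1 (fun s => \1_`[0, h] s * tens (upd F k (derive1 (F k))) (x - s *: ee k)).
Proof.
move=> sF h0; pose C := \prod_(i | i != k) F i (x ord0 i).
have E G s : tens (upd F k G) (x - s *: ee k) = G (x ord0 k - s) * C.
  rewrite /tensor (bigD1 k)//= {1}/upd eqxx; congr (G _ * _).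
    by rewrite /row_coord !mxE !eqxx mulr1.
  by apply: eq_bigr => i /negbTE ik; rewrite /upd /row_coord !mxE ik mulr0 subr0.
have updF : upd F k (F k) = F.
  by apply/funext => i; rewrite /upd; case: eqP => // ->.
pose f := fun s => F k (- 1 * s + x ord0 k).
have sf : smooth1 f by exact: smooth1_affine.
have df s : derive1 f s = - derive1 (F k) (x ord0 k - s).
  rewrite derive1E; suff H : is_derive s (1 : R) f (- derive1 (F k) (x ord0 k - s)) by exact: derive_val.
  rewrite -mulrN1.
  apply: (@is_derive1_comp _ (F k) (fun s => - 1 * s + x ord0 k)).
    by rewrite mulN1r addrC; exact: smooth1_is_derive.
  by apply: is_derive_eq; rewrite addr0 /GRing.scale /= mulr1.
rewrite -{1 2}updF -[X in _ - tens _ X](subr0 x) -(scale0r (ee k)) !E.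
rewrite (_ : (fun s => _) = fun s => (- C) * (\1_`[0, h] s * derive1 f s)); last first.
  by apply/funext => s; rewrite E df; ring.
rewrite IntZ; last by apply: L1_segment; exact/smooth1_continuous/smooth1_derive1.
rewrite Int_segment smooth1_FTC// /f mulN1r mulr0 add0r subr0 addrC.
by rewrite [x ord0 k - h]addrC; ring.
Qed.

Lemma supported_slide a b F k s : 0 <= s -> supported a b F ->
  supported a (fun i => b i + s * (i == k)%:R) (upd F k (fun y => F k (y - s))).
Proof.
move=> s0 F0 i x; rewrite /upd; case: eqP => [->|_]; last by rewrite mulr0 addr0; exact: F0.
rewrite mulr1 => xab; apply: F0; apply: contra xab.
rewrite lerBlDr => /andP[h1 ->]; rewrite andbT (le_trans h1)// gerBl//.
Qed.

(** Tested against a tensor bump F, the shift by h moves onto F, and [F(x - h e_k) - F(x)] is minus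
    the integral of [D_k F (x - s e_k)] over s in [0, h]. Fubini isolates each s, and the weak
    derivative applies to F translated by s e_k, whose support stays in U thanks to the enlarged
    box. *)
Lemma difference_formula (U : set vec) (v g : vec -> R) k (a b : 'I_n -> R) (h : R) :
  L1 leb v -> L1 leb g -> weak_partial U v g k -> 0 <= h ->
  cbox a (fun i => b i + h * (i == k)%:R) `<=` U ->
  \forall x \ae leb, box a b x ->
    v (x + h *: ee k) - v x = Int leb1 (fun s => \1_`[0, h] s * g (x + s *: ee k)).
Proof.
move=> Lv Lg vg h0 abU.
have mv := L1_measurable Lv; have mg := L1_measurable Lg.
pose J x := Int leb1 (fun s => \1_`[0, h] s * g (x + s *: ee k)).
have LJ : L1 leb J := L1_Int2 (L1_slide k h Lg).
have Lvh := L1_shift (h *: ee k) Lv.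
pose w x := v (x + h *: ee k) - v x - J x.
have Lw : L1 leb w by apply: L1B => //; exact: L1B.
suff : \forall x \ae leb, box a b x -> w x = 0.
  by apply: filterS => x H /H /eqP; rewrite subr_eq0 => /eqP.
apply: fundamental_lemma => // a' b' ab m.
pose F i := bump m.+1%:R (a' i) (b' i); rewrite -/F.
have sF i : smooth1 (F i) by exact: smooth1_bump.
have F0 : supported a' b' F.
  move=> i x /negP xab; apply: bump_out => //; apply/negP => /andP[h1 h2].
  by apply: xab; rewrite !ltW.
have [M M0 HM] := tens_bounded sF F0.
have mF := tens_measurable sF.
pose dF := upd F k (derive1 (F k)).
have sdF : forall i, smooth1 (dF i) by apply: upd_smooth => //; exact: smooth1_derive1.
have dF0 : supported a' b' dF by exact: upd_supported.
have [M' M'0 HM'] := tens_bounded sdF dF0.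
have mdF := tens_measurable sdF.
have LIv := @L1_tensor _ _ _ _ R leb1 leb (fun s => \1_`[0, h] s) v
  (L1_indic_segment h) Lv.
have LIv' : L1 (leb1 \x leb)%E (fun p : R * vec =>
    \1_`[0, h] p.1 * v p.2 * tens dF (p.2 - p.1 *: ee k)).
  apply: (L1_mul_bounded LIv (M := M')) => //.
  exact: measurableT_comp mdF (measurable_slideN k).
have LIg' : L1 (leb1 \x leb)%E (fun p : R * vec =>
    \1_`[0, h] p.1 * g (p.2 + p.1 *: ee k) * tens F p.2).
  by apply: (L1_mul_bounded (L1_slide k h Lg) (M := M)) => //; exact: measurableT_comp.
have E1 : Int leb (fun x => (v (x + h *: ee k) - v x) * tens F x) =
   - Int leb (fun x => Int leb1 (fun s => \1_`[0, h] s * v x * tens dF (x - s *: ee k))).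
  rewrite -IntN; last exact: (L1_Int2 LIv').
  transitivity (Int leb (fun x => v x * (tens F (x - h *: ee k) - tens F x))).
    have mFh : measurable_fun setT (fun x : vec => tens F (x - h *: ee k)).
      exact: measurableT_comp mF (measurable_shift _).
    rewrite (eq_Int leb (fun x => mulrBl (tens F x) _ _)).
    rewrite (eq_Int leb (fun x => mulrBr (v x) _ _)).
    rewrite !IntB; first last.
    - exact: (L1_mul_bounded Lv mF HM).
    - exact: (L1_mul_bounded Lvh mF HM).
    - exact: (L1_mul_bounded Lv mF HM).
    - exact: (L1_mul_bounded Lv mFh (fun x => HM _)).
    have LvF : L1 leb (fun x => v x * tens F (x - h *: ee k)).
      exact: (L1_mul_bounded Lv mFh (fun x => HM _)).
    suff -> : Int leb (fun x => v (x + h *: ee k) * tens F x) =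
              Int leb (fun x => v x * tens F (x - h *: ee k)) by [].
    apply: (etrans _ (Int_shift (h *: ee k) LvF)).
    by apply: eq_Int => x; rewrite addrK.
  apply: eq_Int => x; rewrite tens_FTC// mulrN; congr (- _).
  rewrite -IntZ; last exact: (L1_segment h (@tens_line_continuous dF k x sdF)).
  by apply: eq_Int => s; ring.
rewrite (_ : (fun x => _) = fun x => (v (x + h *: ee k) - v x) * tens F x - J x * tens F x); last first.
  by apply/funext => x; rewrite /w mulrBl.
rewrite IntB; first last.
- exact: (L1_mul_bounded LJ mF HM).
- by apply: (L1_mul_bounded _ mF HM); exact: L1B.
apply/eqP; rewrite subr_eq0 E1; apply/eqP.
(* Both sides become integrals over s, compared below for each s separately. *)
rewrite -(Int_swap LIv') -IntN; last exact: (L1_Int1 LIv').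
transitivity (Int leb1 (fun s => Int leb (fun x => \1_`[0, h] s * g (x + s *: ee k) * tens F x))); last first.
  rewrite (Int_swap LIg'); apply: Int_ae.
  - exact: L1_measurable (L1_Int2 LIg').
  - by apply: measurable_funM => //; exact: L1_measurable LJ.
  apply: filterS (L1_fubini2 (L1_slide k h Lg)) => x Lx.
  by rewrite [RHS]mulrC /J -IntZ//; apply: eq_Int => s; rewrite mulrC.
apply: eq_Int => s.
have [sh|sh] := boolP (s \in `[0, h]); last first.
  have z : \1_(`[0, h]%classic : set R) s = 0 :> R by rewrite indicE memNset//; exact/negP.
  transitivity (- Int leb (fun=> 0 : R)).
    by congr (- _); apply: eq_Int => x /=; rewrite z !mul0r.
  rewrite Int0 oppr0; apply/esym; apply: (etrans _ (Int0 leb)).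
  by apply: eq_Int => x; rewrite z !mul0r.
have z : \1_(`[0, h]%classic : set R) s = 1 :> R by rewrite indicE mem_set.
transitivity (- Int leb (fun x => v x * tens dF (x - s *: ee k))).
  by congr (- _); apply: eq_Int => x /=; rewrite z mul1r.
transitivity (Int leb (fun x => g (x + s *: ee k) * tens F x)); last first.
  by apply: eq_Int => x; rewrite z mul1r.
move: sh; rewrite in_itv/= => /andP[s0 sh].
(* A translate of F along e_k is again a tensor product, with only its k-th factor slid, so it is an
   allowed test function. *)
have -> : (fun x => v x * tens dF (x - s *: ee k)) =
   fun x => v x * tens (upd (upd F k (fun y => F k (y - s))) k
      (derive1 (upd F k (fun y => F k (y - s)) k))) x.
  apply/funext => x; rewrite tens_slide; congr (_ * tens _ _).
  apply/funext => i; rewrite /dF /upd eqxx; case: (i == k); last by [].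
  by rewrite derive1_slide.
rewrite (vg _ a' (fun i => b' i + s * (i == k)%:R)).
- have LgF : L1 leb (fun x => g x * tens (upd F k (fun y => F k (y - s))) x).
    apply: (L1_mul_bounded Lg (M := M)) => [|x]; last by rewrite -tens_slide.
    by apply: tens_measurable; apply: upd_smooth => //; exact: smooth1_slide.
  rewrite opprK; apply: (etrans (esym (Int_shift (s *: ee k) LgF))).
  by apply: eq_Int => x; rewrite -tens_slide addrK.
- by apply: upd_smooth => //; exact: smooth1_slide.
- exact: supported_slide.
- move=> x Hx; apply: abU => i; have /andP[h1 h2] := Hx i; have [l1 l2] := ab i.
  rewrite (le_trans l1 h1) (le_trans h2)// lerD// ler_wpM2r//.
Qed.

End fundamental_lemma.

(** * A chain rule along lines *)

Section line_chain_rule.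
Context {R : realType}.
Local Notation leb1 := (@lebesgue_measure R).

Definition primitive (f : R -> R) (s : R) : R :=
  Int leb1 (fun r => \1_`[0, s] r * f r).

Lemma indic_segmentE (s r : R) : \1_(`[0, s]%classic : set R) r = ((0 <= r) && (r <= s))%:R :> R.
Proof. by rewrite indicE mem_setE in_itv. Qed.

Lemma measurable_segment_indic :
  measurable_fun setT (fun p : R * R => \1_(`[0, p.1]%classic : set R) p.2 : R).
Proof.
rewrite (_ : (fun p => _) = \1_([set p : R * R | (0 <= p.2) && (p.2 <= p.1)])).
  apply: measurable_indic.
  rewrite (_ : [set p | _] = (setT `&` (fun p : R * R => 0 <= p.2) @^-1` [set true]) `&`
     (setT `&` (fun p : R * R => p.2 <= p.1) @^-1` [set true])).
    by apply: measurableI; [apply: measurable_fun_ler|apply: measurable_fun_ler].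
  by apply/seteqP; split => [p /= /andP[-> ->]|p /= [[_ ->] [_ ->]]].
apply/funext => p; rewrite indic_segmentE indicE; congr (nat_of_bool _)%:R.
by apply/idP/idP => [h|/set_mem]//; exact/mem_set.
Qed.

Lemma measurable_primitive (f : R -> R) : measurable_fun setT f ->
  measurable_fun setT (primitive f).
Proof.
move=> mf; apply: (@measurable_Int1 _ _ _ _ _ leb1
  (fun p : R * R => \1_(`[0, p.1]%classic : set R) p.2 * f p.2)).
by apply: measurable_funM; [exact: measurable_segment_indic|exact: measurableT_comp].
Qed.

Lemma L1_indicM (f : R -> R) (A : set R) : measurable A -> L1 leb1 f ->
  L1 leb1 (fun r => \1_A r * f r).
Proof.
move=> mA Lf; apply: L1_le (Lf).
  by apply: measurable_funM; [exact: measurable_indic|exact: L1_measurable Lf].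
by move=> r; rewrite normrM indicE; case: (_ \in _); rewrite ?normr1 ?normr0 ?mul1r ?mul0r.
Qed.

Lemma primitive0 f : primitive f 0 = 0.
Proof. by rewrite /primitive Int_segment set_itv1 Rintegral_set1. Qed.

Lemma primitive_diff (f : R -> R) s t : L1 leb1 f -> 0 <= s -> s <= t ->
  primitive f t - primitive f s = Int leb1 (fun r => \1_`]s, t] r * f r).
Proof.
move=> Lf s0 st; rewrite -IntB; [|exact: L1_indicM..].
apply: eq_Int => r; rewrite -mulrBl; congr *%R.
rewrite !indic_segmentE indicE mem_setE in_itv/=.
have [rs|sr] := leP r s; rewrite ?andbT ?andbF ?subr0/=.
  by rewrite (le_trans rs st) !andbT subrr.
by rewrite (le_trans s0 (ltW sr)).
Qed.

Lemma primitive_continuous (f : R -> R) h : L1 leb1 f -> 0 <= h ->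
  {within `[0, h], continuous (primitive f)}.
Proof.
move=> Lf h0.
have := @parameterized_integral_continuous R 0 h f h0.
rewrite (_ : primitive f = fun x => \int[leb1]_(t in `[0, x]) f t).
  by apply; apply/integrable_L1 => //; exact: L1_indic.
by apply/funext => s; rewrite /primitive Int_segment.
Qed.

(* Splitting [s, t] where G takes its midpoint value halves the bound, the
   square (G t - G s)^2 becoming twice a quarter of itself. *)
Lemma bisection_constant (H G : R -> R) (C h : R) : 0 <= h -> {within `[0, h], continuous G} ->
  (forall s t : R, 0 <= s -> s <= t -> t <= h -> `|H t - H s| <= C * (G t - G s) ^+ 2) ->
  H h = H 0.
Proof.
move=> h0 cG HG.
have B n : forall s t, 0 <= s -> s <= t -> t <= h ->
    `|H t - H s| <= C * (G t - G s) ^+ 2 / 2 ^+ n.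
  elim: n => [|n IH] s t s0 st th; first by rewrite expr0 divr1; exact: HG.
  have cst : {within `[s, t], continuous G}.
    apply: continuous_subspaceW cG => x /=; rewrite !in_itv/= => /andP[sx xt].
    by rewrite (le_trans s0 sx) (le_trans xt th).
  have [|m] := IVT (v := (G s + G t) / 2) st cst.
    have [g|g] := leP (G s) (G t); apply/andP; split; lra.
  rewrite in_itv/= => /andP[sm mt] Gm.
  rewrite -(subrKA (H m)); apply: (le_trans (ler_normD _ _)).
  apply: (@le_trans _ _ (C * (G t - G m) ^+ 2 / 2 ^+ n + C * (G m - G s) ^+ 2 / 2 ^+ n)).
    apply: lerD; apply: IH => //; [exact: le_trans sm|exact: le_trans mt th].
  rewrite Gm [2 ^+ n.+1]exprS le_eqVlt; apply/orP; left; apply/eqP.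
  by field; rewrite expf_neq0.
apply/eqP; rewrite -subr_eq0 -normr_le0.
have : (fun n => C * (G h - G 0) ^+ 2 / 2 ^+ n) @ \oo --> (0 : R).
  rewrite -[X in _ --> X](mulr0 (C * (G h - G 0) ^+ 2)).
  have := @cvg_geometric R (C * (G h - G 0) ^+ 2) (2^-1).
  rewrite /geometric/= mulr0 => H1.
  under eq_fun do rewrite -exprVn.
  by apply: H1; rewrite ger0_norm ?invr_ge0// invf_lt1// ltr1n.
move=> cv; have := cvg_lim (@Rhausdorff R) cv => E.
rewrite -[leRHS]E; apply: limr_ge; first by apply/cvg_ex; exists 0.
by apply: nearW => n; exact: B.
Qed.

Variables (f : R -> R) (q : R -> R -> R) (L : R).
Hypothesis fq : forall s t, f s - f t = (s - t) * q s t.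
Hypothesis q1 : forall s t, `|q s t| <= 1.
Hypothesis qL : forall s t z, `|q s t - q z z| <= L * (`|s - z| + `|t - z|).
Hypothesis mq : measurable_fun setT (fun s => q s s).

(** A chain rule for an absolutely continuous V that never differentiates V at a point. Let H be
    f(V) minus the candidate primitive and G the primitive of |g|. On ]s, t] the divided difference
    [q (V t) (V s)] differs from [q (V r) (V r)] by at most a multiple of G t - G s, so the
    increment of H is bounded by a multiple of (G t - G s)^2, and bisection makes H constant. *)
Lemma line_chain_rule (c : R) (g : R -> R) h : L1 leb1 g -> 0 <= h ->
  let V s := c + primitive g s in
  f (V h) - f (V 0) = primitive (fun r => q (V r) (V r) * g r) h.
Proof.
move=> Lg h0 V; have mg := L1_measurable Lg.
have mV : measurable_fun setT V.
  by apply: measurable_funD => //; exact: measurable_primitive.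
have L0 : 0 <= L.
  have := qL 1 0 0; rewrite !subrr subr0 normr0 normr1 addr0 mulr1.
  exact: le_trans.
have LqV : L1 leb1 (fun r => q (V r) (V r) * g r).
  under [X in L1 _ X]eq_fun do rewrite mulrC.
  by apply: (L1_mul_bounded Lg (M := 1)) => //; exact: measurableT_comp mq mV.
pose H s := f (V s) - primitive (fun r => q (V r) (V r) * g r) s.
suff : H h = H 0 by rewrite /H primitive0 subr0 => <-; ring.
pose G := primitive (fun r => `|g r|).
have LG := L1_norm Lg.
have Vdiff s t : 0 <= s -> s <= t -> `|V t - V s| <= G t - G s.
  move=> s0 st; rewrite /V opprD addrACA subrr add0r !primitive_diff//.
  apply: (le_trans (Int_norm (L1_indicM (measurable_itv _) Lg))).
  apply: Int_le; [exact: L1_norm (L1_indicM (measurable_itv _) Lg)|exact: L1_indicM|].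
  by move=> r; rewrite normrM ger0_norm// indic_nonneg.
apply: (@bisection_constant H G (2 * L) h) => //.
  exact: primitive_continuous.
move=> s t s0 st th; rewrite /H.
have -> : f (V t) - primitive (fun r => q (V r) (V r) * g r) t -
    (f (V s) - primitive (fun r => q (V r) (V r) * g r) s) =
    Int leb1 (fun r => \1_`]s, t] r * ((q (V t) (V s) - q (V r) (V r)) * g r)).
  transitivity (Int leb1 (fun r => q (V t) (V s) * (\1_`]s, t] r * g r) -
     \1_`]s, t] r * (q (V r) (V r) * g r))); last by apply: eq_Int => r; ring.
  rewrite IntB; [|exact/L1Z/L1_indicM|exact: L1_indicM].
  rewrite IntZ; last exact: L1_indicM.
  rewrite -!primitive_diff//.
  rewrite (_ : primitive g t - primitive g s = V t - V s); last by rewrite /V; ring.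
  by rewrite [q _ _ * _]mulrC -fq; ring.
have LX : L1 leb1 (fun r => \1_`]s, t] r * ((q (V t) (V s) - q (V r) (V r)) * g r)).
  apply: L1_indicM => //; rewrite (_ : (fun r => _) = fun r => q (V t) (V s) * g r - q (V r) (V r) * g r).
    by apply: L1B => //; exact: L1Z.
  by apply/funext => r; rewrite mulrBl.
apply: (le_trans (Int_norm LX)).
rewrite (_ : _ * _ ^+ 2 = Int leb1 (fun r => (2 * L * (G t - G s)) * (\1_`]s, t] r * `|g r|))); last first.
  by rewrite IntZ ?primitive_diff//; [rewrite expr2; ring|exact: L1_indicM].
apply: Int_le; [exact: L1_norm|exact/L1Z/L1_indicM|move=> r].
rewrite indicE mem_setE in_itv/=; case: (boolP (s < r <= t)) => [/andP[sr rt]|_]; last first.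
  by rewrite !mul0r normr0 mulr0.
rewrite !mul1r normrM ler_wpM2r//; apply: (le_trans (qL _ _ _)).
rewrite -mulrA mulrCA ler_wpM2l//.
have r0 : 0 <= r := le_trans s0 (ltW sr).
have mono x y : 0 <= x -> x <= y -> 0 <= G y - G x.
  by move=> x0 xy; exact: le_trans (Vdiff x y x0 xy).
have := Vdiff r t r0 rt; have := Vdiff s r s0 (ltW sr).
have := mono s r s0 (ltW sr); have := mono r t r0 rt.
by rewrite (distrC (V s)); lra.
Qed.

End line_chain_rule.

(** * A rational truncation and its divided difference *)

Section truncation.
Context {R : realType}.
Variable c : R.

(* Bounded (for c != 0) and 1-Lipschitz, and trunc c s --> s as c --> 0; being
   rational it has an explicit divided difference dtrunc, with
   dtrunc s s = trunc' s. *)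
Definition trunc (s : R) : R := s / (1 + c ^+ 2 * s ^+ 2).
Let psi (s : R) : R := (1 + c ^+ 2 * s ^+ 2)^-1.
Definition dtrunc (s t : R) : R := psi s * psi t - c ^+ 2 * trunc s * trunc t.

Let den_gt0 s : 0 < 1 + c ^+ 2 * s ^+ 2.
Proof. by rewrite ltr_wpDr// mulr_ge0 ?sqr_ge0. Qed.

Let den_neq0 s : 1 + c ^+ 2 * s ^+ 2 != 0.
Proof. by rewrite gt_eqF. Qed.

Let psi_le1 s : `|psi s| <= 1.
Proof.
rewrite ger0_norm ?invr_ge0 ?(ltW (den_gt0 _))// invf_le1//.
by rewrite lerDl mulr_ge0 ?sqr_ge0.
Qed.

Lemma trunc_dtrunc s t : trunc s - trunc t = (s - t) * dtrunc s t.
Proof. by rewrite /trunc /dtrunc /psi /trunc; field; rewrite !exprMn !den_neq0. Qed.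

Lemma trunc_bound s : `|c * trunc s| <= 2^-1.
Proof.
rewrite /trunc mulrA normrM (ger0_norm (x := _^-1)) ?invr_ge0 ?(ltW (den_gt0 _))//.
rewrite ler_pdivrMr// -exprMn -(real_normK (num_real (c * s))).
have := sqr_ge0 (1 - `|c * s|); rewrite !expr2; lra.
Qed.

Lemma dtrunc_le1 s t : `|dtrunc s t| <= 1.
Proof.
(* With x = c s and y = c t the claim becomes [|1 - x y| <= (1 + x^2)(1 + y^2)], which follows from
   [2 |x y| <= x^2 + y^2]. *)
have -> : dtrunc s t = (1 - (c * s) * (c * t)) * (psi s * psi t).
  by rewrite /dtrunc /trunc /psi; ring.
rewrite normrM (ger0_norm (x := psi s * _)); last first.
  by rewrite mulr_ge0// invr_ge0 ltW.
rewrite -invfM ler_pdivrMr ?mulr_gt0// mul1r -!exprMn.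
move: (c * s) (c * t) => x y; apply: (le_trans (ler_normB _ _)); rewrite normr1.
have := mulr_ge0 (sqr_ge0 x) (sqr_ge0 y).
rewrite normrM -(real_normK (num_real x)) -(real_normK (num_real y)).
have := sqr_ge0 (`|x| - `|y|); have := mulr_ge0 (normr_ge0 x) (normr_ge0 y).
rewrite !expr2; nra.
Qed.

Lemma trunc_lip s t : `|trunc s - trunc t| <= `|s - t|.
Proof. by rewrite trunc_dtrunc normrM ler_piMr// dtrunc_le1. Qed.

Let psi_lip s t : `|psi s - psi t| <= `|c| * `|s - t|.
Proof.
have -> : psi s - psi t = (s - t) * - (c * ((c * trunc s) * psi t + psi s * (c * trunc t))).
  by rewrite /trunc /psi; field; rewrite !exprMn !den_neq0.
rewrite normrM normrN normrM [leRHS]mulrC ler_wpM2l// ler_piMr//.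
apply: (le_trans (ler_normD _ _)); rewrite !normrM -!normrM.
have := trunc_bound s; have := trunc_bound t; have := psi_le1 s; have := psi_le1 t.
rewrite (normrM (c * trunc s)) (normrM (psi s)).
have := normr_ge0 (c * trunc s); have := normr_ge0 (c * trunc t).
have := normr_ge0 (psi s); have := normr_ge0 (psi t).
nra.
Qed.

Lemma dtrunc_lip s t z :
  `|dtrunc s t - dtrunc z z| <= (2 * `|c|) * (`|s - z| + `|t - z|).
Proof.
have -> : dtrunc s t - dtrunc z z =
    ((psi s - psi z) * psi t + psi z * (psi t - psi z)) -
    c * ((trunc s - trunc z) * (c * trunc t) + (c * trunc z) * (trunc t - trunc z)).
  by rewrite /dtrunc; ring.
have h1 : `|(psi s - psi z) * psi t| <= `|c| * `|s - z|.
  by rewrite normrM -[leRHS]mulr1; apply: ler_pM => //; exact: psi_lip.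
have h2 : `|psi z * (psi t - psi z)| <= `|c| * `|t - z|.
  by rewrite normrM -[leRHS]mul1r; apply: ler_pM => //; exact: psi_lip.
have b x : `|c * trunc x| <= 1.
  by apply: le_trans (trunc_bound x) _; rewrite invf_le1// ler1n.
have h3 : `|(trunc s - trunc z) * (c * trunc t)| <= `|s - z|.
  by rewrite normrM -[leRHS]mulr1; apply: ler_pM => //; exact: trunc_lip.
have h4 : `|(c * trunc z) * (trunc t - trunc z)| <= `|t - z|.
  by rewrite normrM -[leRHS]mul1r; apply: ler_pM => //; exact: trunc_lip.
apply: (le_trans (ler_normB _ _)).
have h5 : `|c * ((trunc s - trunc z) * (c * trunc t) + c * trunc z * (trunc t - trunc z))| <=
    `|c| * (`|s - z| + `|t - z|).
  rewrite normrM ler_wpM2l//; apply: (le_trans (ler_normD _ _)).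
  by rewrite lerD.
have := le_trans (ler_normD _ _) (lerD h1 h2).
by move: h5; lra.
Qed.

Lemma trunc_norm s : `|trunc s| <= `|s|.
Proof. by have := trunc_lip s 0; rewrite /trunc mul0r !subr0. Qed.

Lemma measurable_dtrunc : measurable_fun setT (fun s => dtrunc s s).
Proof.
apply: continuous_measurable_fun => s.
have cd : (fun s => 1 + c ^+ 2 * s ^+ 2) @ s --> 1 + c ^+ 2 * s ^+ 2.
  by apply: cvgD; [exact: cvg_cst|apply: cvgM; [exact: cvg_cst|exact: exprn_continuous]].
have cpsi : psi @ s --> psi s by apply: cvgV.
have ct : trunc @ s --> trunc s by apply: cvgM; [exact: cvg_id|exact: cpsi].
by apply: cvgB; [apply: cvgM|apply: cvgM => //; apply: cvgM => //; exact: cvg_cst].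
Qed.

Lemma measurable_trunc : measurable_fun setT trunc.
Proof.
apply: continuous_measurable_fun => s.
have cd : (fun s => 1 + c ^+ 2 * s ^+ 2) @ s --> 1 + c ^+ 2 * s ^+ 2.
  by apply: cvgD; [exact: cvg_cst|apply: cvgM; [exact: cvg_cst|exact: exprn_continuous]].
by apply: cvgM; [exact: cvg_id|exact: cvgV].
Qed.

End truncation.

(** * Weak derivatives from difference quotients *)

Section joint_primitive.
Context {R : realType} {d} {Y : measurableType d}.
Local Notation leb1 := (@lebesgue_measure R).

Lemma measurable_primitive2 (f : R * Y -> R) : measurable_fun setT f ->
  measurable_fun setT (fun q : R * Y => primitive (fun s => f (s, q.2)) q.1).
Proof.
move=> mf; apply: (@measurable_Int1 _ _ _ _ _ leb1
  (fun p : (R * Y) * R => \1_(`[0, p.1.1]%classic : set R) p.2 * f (p.2, p.1.2))).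
apply: measurable_funM.
  apply: (measurableT_comp (@measurable_segment_indic R)
    (g := fun p : (R * Y) * R => (p.1.1, p.2))).
  by apply: measurable_fun_pair => //; exact: measurableT_comp.
apply: (measurableT_comp mf (g := fun p : (R * Y) * R => (p.2, p.1.2))).
by apply: measurable_fun_pair => //; exact: measurableT_comp.
Qed.

End joint_primitive.

Lemma Int_indic_segment {R : realType} (h : R) : 0 <= h ->
  Int (@lebesgue_measure R) (fun s => \1_(`[0, h]%classic : set R) s) = h.
Proof.
move=> h0; transitivity (fine (lebesgue_measure (`[0, h]%classic : set R))).
  exact: (Int_indicator (@lebesgue_measure R) (measurable_itv `[0, h])).
rewrite lebesgue_measure_itv/= lte_fin; case: ltP => h0'; first by rewrite -EFinD /= subr0.
by apply/eqP; rewrite eq_le h0 h0'.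
Qed.

(** * Taylor bounds for test functions along a direction *)

Section test_function_bounds.
Context {R : realType} {V : normedModType R}.
Implicit Types (phi : V -> R) (v x : V).

Lemma test_function_bounded (U : set V) phi : test_function U phi ->
  exists2 M : R, 0 <= M & forall x, `|phi x| <= M.
Proof.
move=> [sphi [K [cK KU phi0]]]; apply: compact_support_bounded cK phi0.
exact: (sphi [::]).1.
Qed.

Lemma is_derive_along phi x v (s : R) : derivable phi (x + s *: v) v ->
  is_derive s (1 : R) (fun s => phi (x + s *: v)) ('D_v phi (x + s *: v)).
Proof.
move=> dphi.
have E : (fun h : R => h^-1 *: (phi (x + (h *: (1 : R) + s) *: v) - phi (x + s *: v))) =
  (fun h : R => h^-1 *: (phi (h *: v + (x + s *: v)) - phi (x + s *: v))).
  apply/funext => h; congr (_ *: (phi _ - _)).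
  have -> : h *: (1 : R) = h by rewrite /GRing.scale /= mulr1.
  by rewrite scalerDl addrCA.
by split; rewrite /derivable /derive E.
Qed.

Lemma mean_value_along phi x v (h : R) : smooth phi -> 0 <= h ->
  exists2 s : R, 0 <= s <= h & phi (x + h *: v) - phi x = h * 'D_v phi (x + s *: v).
Proof.
move=> sphi; rewrite le_eqVlt => /predU1P[<-|h0].
  by exists 0; rewrite ?lexx// scale0r addr0 subrr mul0r.
have [_ dphi] := sphi [::].
have df s := @is_derive_along phi x v s (dphi _ _).
have [|c] := @MVT R (fun s => phi (x + s *: v)) (fun s => 'D_v phi (x + s *: v)) 0 h h0 (fun s _ => df s).
  apply: continuous_subspaceT => s.
  by apply: differentiable_continuous; apply/derivable1_diffP; exact: ex_derive.
rewrite in_itv/= => /andP[c0 ch]; rewrite scale0r addr0 subr0 mulrC => E.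
by exists c => //; rewrite !ltW.
Qed.

Lemma smooth_lipschitz_along phi x v (h M : R) : smooth phi -> 0 <= h ->
  (forall y, `|'D_v phi y| <= M) -> `|phi (x + h *: v) - phi x| <= h * M.
Proof.
move=> sphi h0 HM; have [s _ ->] := mean_value_along x v sphi h0.
by rewrite normrM ger0_norm// ler_wpM2l.
Qed.

Lemma smooth_taylor_along phi x v (h M : R) : smooth phi -> 0 <= h ->
  (forall y, `|'D_v ('D_v phi) y| <= M) ->
  `|phi (x + h *: v) - phi x - h * 'D_v phi x| <= h * (h * M).
Proof.
move=> sphi h0 HM; have [s /andP[s0 sh] ->] := mean_value_along x v sphi h0.
rewrite -mulrBr normrM ger0_norm// ler_wpM2l//.
apply: (le_trans (smooth_lipschitz_along x (smooth_derive v sphi) s0 HM)).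
by rewrite ler_wpM2r// (le_trans _ (HM 0)).
Qed.

Lemma derive_opp phi v x : smooth phi -> 'D_(- v) phi x = - 'D_v phi x.
Proof.
move=> sphi; have [_ dphi] := sphi [::].
have d : is_derive (0 : R) (1 : R) (fun s => phi (x + s *: v)) ('D_v phi x).
  have := @is_derive_along phi x v 0 (dphi _ _); rewrite scale0r addr0; exact.
suff H : is_derive x (- v) phi (- 'D_v phi x) by exact: derive_val.
apply: is_derive_line.
rewrite (_ : (fun _ => _) = (fun s => phi (x + s *: v)) \o -%R).
  by rewrite -mulrN1; apply: is_derive1_comp; rewrite oppr0.
by apply/funext => h /=; rewrite addrC scalerN scaleNr.
Qed.

End test_function_bounds.

Section local_difference.
Context {R : realType} {n : nat}.
Local Notation vec := 'rV[R]_n.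
Local Notation leb := (@lebesgue_row R n).
Local Notation leb1 := (@lebesgue_measure R).
Local Notation ee k := (delta_mx ord0 k : vec).
Implicit Types (U : set vec) (v g : vec -> R).

(* Difference quotients: equivalent to g being the weak k-th partial derivative
   of v on U. *)
Definition ac_on U v g k := forall p, U p -> exists2 r : R, 0 < r &
  forall h, 0 <= h -> h <= r -> \forall x \ae leb, ball p r x ->
    v (x + h *: ee k) - v x = primitive (fun s => g (x + s *: ee k)) h.

Lemma weak_partial_ac U v g k : open U -> L1 leb v -> L1 leb g ->
  weak_partial U v g k -> ac_on U v g k.
Proof.
move=> oU Lv Lg vg p Up.
have /nbhs_ballP[r0 /= r00 pr] := open_nbhs_nbhs (conj oU Up).
(* One third of the radius for the box around p and one third for the slide by h leave the closed
   enlarged box inside the ball of radius r0. *)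
have r30 : 0 < r0 / 3 by rewrite divr_gt0.
exists (r0 / 3) => // h h0 hr.
rewrite ballE//; apply: difference_formula Lv Lg vg h0 _ => x Hx.
apply: pr; rewrite ballE// => i; have /andP[h1 h2] := Hx i.
have : h * (i == k)%:R <= r0 / 3.
  by case: eqP; rewrite ?mulr1 ?mulr0// ltW.
move: h1 h2; lra.
Qed.

(** The increment formula holds for each step s at almost every x. Fubini, applied to its defect w
    cut off to [0, r] times the ball, turns this around: on almost every line, v agrees with a
    primitive of g at almost every s, and at s = h by hypothesis. The chain rule along that line
    then gives the formula for the truncation. *)
Lemma ac_on_trunc c U v g k : L1 leb v -> L1 leb g -> ac_on U v g k ->
  ac_on U (fun x => trunc c (v x)) (fun x => dtrunc c (v x) (v x) * g x) k.
Proof.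
move=> Lv Lg vg p /vg[r r0 H]; exists r => // h h0 hr.
have mv := L1_measurable Lv; have mg := L1_measurable Lg.
have mgs : measurable_fun setT (fun q : R * vec => g (q.2 + q.1 *: ee k)).
  exact: measurableT_comp mg (measurable_slide k).
have mvs : measurable_fun setT (fun q : R * vec => v (q.2 + q.1 *: ee k)).
  exact: measurableT_comp mv (measurable_slide k).
pose w (q : R * vec) := \1_(`[0, r]%classic : set R) q.1 * \1_(ball p r : set vec) q.2 *
  (v (q.2 + q.1 *: ee k) - v q.2 - primitive (fun s => g (q.2 + s *: ee k)) q.1).
have mw : measurable_fun setT w.
  apply: measurable_funM.
    apply: measurable_funM.
      by apply: measurableT_comp => //; exact: measurable_indic.
    by apply: measurableT_comp => //; apply: measurable_indic; exact: measurable_rball.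
  apply: measurable_funB; last exact: (measurable_primitive2 mgs).
  by apply: measurable_funB => //; exact: measurableT_comp.
have mA : measurable ([set q | w q = 0] : set (measurableTypeR R * vec)).
  have := mw measurableT [set 0] (measurable_set1 0).
  by rewrite setTI.
have : \forall q \ae (leb1 \x leb)%E, w q = 0.
  apply: ae_prod1 mA _; apply: aeW => s.
  have [/andP[s0 sr]|sr] := boolP (0 <= s <= r); last first.
    apply: aeW => x; rewrite /= /w /= indicE memNset ?mul0r//.
    by rewrite /= in_itv/=; exact/negP.
  apply: filterS (H s s0 sr) => x Hx; rewrite /= /w /=.
  have [/set_mem/Hx->|xb] := boolP (x \in (ball p r : set vec)).
    by rewrite subrr mulr0.
  by rewrite !indicE (negbTE xb) mulr0 mul0r.
move=> /ae_fubini2 Hw.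
apply: filterS3 Hw (H h h0 hr) (L1_fubini2 (L1_slide k h Lg)) => x Hw Hx Lgx px.
pose gam s := \1_(`[0, h]%classic : set R) s * g (x + s *: ee k).
have primE s : 0 <= s <= h -> primitive gam s = primitive (fun s => g (x + s *: ee k)) s.
  move=> /andP[s0 sh]; apply: eq_Int => y; rewrite /gam mulrA; congr *%R.
  rewrite !indic_segmentE; have [ys|_] := leP y s; last by rewrite andbF mul0r.
  by rewrite (le_trans ys sh) !andbT; case: (0 <= y); rewrite ?mul1r ?mul0r.
have := @line_chain_rule R (trunc c) (dtrunc c) (2 * `|c|) (trunc_dtrunc c)
  (dtrunc_le1 c) (dtrunc_lip c) (measurable_dtrunc c) (v x) gam h Lgx h0.
cbv beta zeta; rewrite primitive0 addr0 primE ?h0 ?lexx// -(Hx px) [v x + _]addrC subrK => ->.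
have mgx : measurable_fun setT (fun s : R => g (x + s *: ee k)).
  exact: measurableT_comp mgs (measurable_pair2 x).
have mvx : measurable_fun setT (fun s : R => v (x + s *: ee k)).
  exact: measurableT_comp mvs (measurable_pair2 x).
have mgam : measurable_fun setT gam.
  by apply: measurable_funM => //; exact: measurable_indic.
apply: Int_ae.
- apply: measurable_funM; first exact: measurable_indic.
  apply: measurable_funM => //; apply: measurableT_comp (measurable_dtrunc c) _.
  by apply: measurable_funD => //; exact: measurable_primitive.
- apply: measurable_funM; first exact: measurable_indic.
  by apply: measurable_funM => //; exact: measurableT_comp (measurable_dtrunc c) _.
apply: filterS Hw => s; rewrite /w /= /gam.
rewrite !indic_segmentE; have [/andP[s0 sh]|_] := boolP (0 <= s <= h); last by rewrite !mul0r.
rewrite (le_trans sh hr) s0 indicE mem_set// !mul1r => /eqP.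
rewrite subr_eq0 subr_eq => /eqP ->.
by rewrite primE ?s0// [_ + v x]addrC.
Qed.

(** Finitely many local balls cover K; the least of 1 and their radii is a step length valid on all
    of K. *)
Lemma ac_on_compact U v g k K : ac_on U v g k -> compact K -> K `<=` U ->
  exists2 del : R, 0 < del & forall h, 0 <= h -> h <= del ->
    \forall x \ae leb, K x -> v (x + h *: ee k) - v x = primitive (fun s => g (x + s *: ee k)) h.
Proof.
move=> vg; rewrite compact_cover => cK KU.
have /choice[r Hr] : forall p, exists r : R, 0 < r /\ (U p -> forall h, 0 <= h -> h <= r ->
    \forall x \ae leb, ball p r x ->
    v (x + h *: ee k) - v x = primitive (fun s => g (x + s *: ee k)) h).
  move=> p; have [/vg[r r0 H]|nUp] := pselect (U p); first by exists r.
  by exists 1.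
have [||D' D'K KD'] := cK vec K (fun p => ball p (r p)).
- by move=> p _; apply: (@ball_open R vec) => //; case: (Hr p).
- by move=> p Kp; exists p => //; apply: ballxx; case: (Hr p).
have H (s : seq vec) : (forall p, p \in s -> K p) -> exists2 del : R, 0 < del & forall h, 0 <= h -> h <= del ->
    \forall x \ae leb, (exists2 p, p \in s & ball p (r p) x) ->
     v (x + h *: ee k) - v x = primitive (fun s => g (x + s *: ee k)) h.
  elim: s => [_|p s IH sK]; first by exists 1 => // h _ _; apply: aeW => x [].
  have [|del d0 Hd] := IH; first by move=> q qs; apply: sK; rewrite inE qs orbT.
  have [rp0 Hp] := Hr p; have {}Hp := Hp (KU _ (sK _ (mem_head _ _))).
  exists (Num.min (r p) del); first by rewrite lt_min rp0.
  move=> h h0; rewrite le_min => /andP[hr hd].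
  apply: filterS2 (Hp h h0 hr) (Hd h h0 hd) => x H1 H2 [q].
  by rewrite inE => /predU1P[->/H1//|qs qx]; apply: H2; exists q.
have [p pD|del d0 Hd] := H (finmap.enum_fset D').
  by have := D'K p pD; rewrite inE.
exists del => // h h0 hd; apply: filterS (Hd h h0 hd) => x Hx Kx.
by apply: Hx; have [p pD px] := KD' _ Kx; exists p.
Qed.

(** The integral S of [v(x) (phi(x - h e_k) - phi(x))] is computed twice. Taylor's formula for phi
    gives S = -h A + O(h^2); moving the shift onto v and using the increment formula gives S = h B +
    O(h^2). Hence |A + B| = O(h). *)
Lemma ac_on_weak_derivative U v g k phi : L1 leb v -> L1 leb g -> ac_on U v g k ->
  test_function U phi ->
  Int leb (fun x => v x * 'D_(ee k) phi x) = - Int leb (fun x => g x * phi x).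
Proof.
move=> Lv Lg vg tphi; have [sphi [K [cK KU phi0]]] := tphi.
have [del d0 Hd] := ac_on_compact vg cK KU.
have cphi : continuous phi := (sphi [::]).1.
have mphi := continuous_row_measurable cphi.
have [M0 M00 HM0] := test_function_bounded tphi.
have cdphi : continuous ('D_(ee k) phi) := (sphi [:: ee k]).1.
have mdphi := continuous_row_measurable cdphi.
have [M1 M10 HM1] := test_function_bounded (test_function_derive (ee k) tphi).
have [M2 M20 HM2] := test_function_bounded (test_function_derive (ee k)
   (test_function_derive (ee k) tphi)).
have HM1' y : `|'D_(- ee k) phi y| <= M1 by rewrite derive_opp// normrN.
have HM2' y : `|'D_(- ee k) ('D_(- ee k) phi) y| <= M2.
  rewrite (_ : 'D_(- ee k) phi = \- 'D_(ee k) phi); last first.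
    by apply/funext => z; rewrite derive_opp.
  have sd := smooth_derive (ee k) sphi.
  rewrite deriveN; last exact: (sd [::]).2.
  by rewrite derive_opp// opprK.
have LvD : L1 leb (fun x => v x * 'D_(ee k) phi x) by exact: (L1_mul_bounded Lv mdphi HM1).
have Lgp : L1 leb (fun x => g x * phi x) by exact: (L1_mul_bounded Lg mphi HM0).
set A := Int leb _; set B := Int leb _.
have Nv0 : 0 <= Int leb (fun x => `|v x|) by apply: Int_ge0.
have Ng0 : 0 <= Int leb (fun x => `|g x|) by apply: Int_ge0.
pose Kst := Int leb (fun x => `|v x|) * M2 + Int leb (fun x => `|g x|) * M1.
have key h : 0 < h -> h <= del -> `|A + B| <= h * Kst.
  move=> h0 hd; have h0' := ltW h0.
  have mphis (s : R) : measurable_fun setT (fun x : vec => phi (x - s *: ee k)).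
    exact: measurableT_comp mphi (measurable_shift _).
  have LvS : L1 leb (fun x => v x * phi (x - h *: ee k)).
    exact: (L1_mul_bounded Lv (mphis h) (fun x => HM0 _)).
  have LvP : L1 leb (fun x => v x * phi x) by exact: (L1_mul_bounded Lv mphi HM0).
  pose S := Int leb (fun x => v x * (phi (x - h *: ee k) - phi x)).
  have LS : L1 leb (fun x => v x * (phi (x - h *: ee k) - phi x)).
    by rewrite (funext (fun x => mulrBr (v x) _ _)); exact: L1B.
  have S1 : `|S + h * A| <= h * (h * (Int leb (fun x => `|v x|) * M2)).
    rewrite /S /A -IntZ// -IntD//; last exact: L1Z.
    apply: (le_trans (Int_norm (L1D LS (L1Z h LvD)))).
    rewrite [leRHS](_ : _ = (h * h * M2) * Int leb (fun x => `|v x|)); last by ring.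
    rewrite -IntZ; last exact: L1_norm.
    apply: Int_le; [exact: L1_norm (L1D LS (L1Z h LvD))|exact/L1Z/L1_norm|move=> x].
    rewrite (_ : _ + _ = v x * (phi (x + h *: - ee k) - phi x - h * 'D_(- ee k) phi x)); last first.
      by rewrite derive_opp// scalerN; ring.
    rewrite normrM mulrC ler_wpM2r// -mulrA.
    exact: smooth_taylor_along.
  pose J x := primitive (fun s => g (x + s *: ee k)) h.
  have LJ : L1 leb J := L1_Int2 (L1_slide k h Lg).
  have S2 : S = Int leb (fun x => J x * phi x).
    rewrite /S; transitivity (Int leb (fun x => (v (x + h *: ee k) - v x) * phi x)).
      transitivity (Int leb (fun x => v x * phi (x - h *: ee k) - v x * phi x)).
        by apply: eq_Int => x; rewrite mulrBr.
      transitivity (Int leb (fun x => v (x + h *: ee k) * phi x - v x * phi x)); last first.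
        by apply: eq_Int => x; rewrite mulrBl.
      have LvhP : L1 leb (fun x => v (x + h *: ee k) * phi x).
        exact: (L1_mul_bounded (L1_shift _ Lv) mphi HM0).
      rewrite !IntB//.
      suff -> : Int leb (fun x => v (x + h *: ee k) * phi x) =
                Int leb (fun x => v x * phi (x - h *: ee k)) by [].
      apply: (etrans _ (Int_shift (h *: ee k) LvS)).
      by apply: eq_Int => x; rewrite addrK.
    apply: Int_ae.
    - apply: measurable_funM => //; apply: measurable_funB; last exact: L1_measurable Lv.
      exact: L1_measurable (L1_shift _ Lv).
    - by apply: measurable_funM => //; exact: L1_measurable LJ.
    apply: filterS (Hd h h0' hd) => x Hx.
    by have [/Hx->//|/phi0->] := pselect (K x); rewrite !mulr0.
  have LIg : L1 (leb1 \x leb)%E (fun p : R * vec =>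
      \1_(`[0, h]%classic : set R) p.1 * g (p.2 + p.1 *: ee k) * phi p.2).
    by apply: (L1_mul_bounded (L1_slide k h Lg) (M := M0)) => //; exact: measurableT_comp.
  have S3 : S = Int leb1 (fun s => \1_(`[0, h]%classic : set R) s *
       Int leb (fun x => g x * phi (x - s *: ee k))).
    rewrite S2; transitivity (Int leb (fun x => Int leb1 (fun s =>
       \1_(`[0, h]%classic : set R) s * g (x + s *: ee k) * phi x))).
      apply: Int_ae.
      - by apply: measurable_funM => //; exact: L1_measurable LJ.
      - exact: L1_measurable (L1_Int2 LIg).
      apply: filterS (L1_fubini2 (L1_slide k h Lg)) => x Lx.
      by rewrite mulrC /J /primitive -IntZ//; apply: eq_Int => s; rewrite mulrC.
    rewrite -(Int_swap LIg); apply: eq_Int => s /=.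
    have LgS : L1 leb (fun x => g x * phi (x - s *: ee k)).
      exact: (L1_mul_bounded Lg (mphis s) (fun x => HM0 _)).
    rewrite -(Int_shift (s *: ee k) LgS) -IntZ; last exact: (L1_shift (s *: ee k) LgS).
    by apply: eq_Int => x; rewrite addrK mulrA.
  have LI := @L1_indic_segment R h.
  have IhE : Int leb1 (fun s => \1_(`[0, h]%classic : set R) s) = h.
    exact: Int_indic_segment.
  have LIP : L1 leb1 (fun s => \1_(`[0, h]%classic : set R) s *
       Int leb (fun x => g x * phi (x - s *: ee k))).
    have L : L1 (leb1 \x leb)%E (fun p : R * vec =>
        \1_(`[0, h]%classic : set R) p.1 * g p.2 * phi (p.2 - p.1 *: ee k)).
      apply: (L1_mul_bounded (L1_tensor LI Lg) (M := M0)) => //.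
      exact: measurableT_comp mphi (measurable_slideN k).
    apply: eq_L1 (L1_Int1 L) => s /=.
    rewrite -IntZ; last exact: (L1_mul_bounded Lg (mphis s) (fun x => HM0 _)).
    by apply: eq_Int => x; rewrite mulrA.
  have S4 : `|S - h * B| <= h * (h * (Int leb (fun x => `|g x|) * M1)).
    rewrite -{1}IhE mulrC S3 -IntZ// -IntB//; last exact: L1Z.
    apply: (le_trans (Int_norm (L1B LIP (L1Z B LI)))).
    rewrite [leRHS](_ : _ = (h * (Int leb (fun x => `|g x|) * M1)) *
      Int leb1 (fun s => \1_(`[0, h]%classic : set R) s)); last by rewrite IhE mulrC.
    rewrite -IntZ//.
    apply: Int_le; [exact: L1_norm (L1B LIP (L1Z B LI))|exact/L1Z|move=> s].
    rewrite [B * _]mulrC -mulrBr normrM (ger0_norm (indic_nonneg _ _)) mulrC.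
    rewrite indic_segmentE; case: (boolP (0 <= s <= h)) => [/andP[s0 sh]|_]; last first.
      by rewrite !mulr0.
    rewrite !mulr1 /B -IntB//; last exact: (L1_mul_bounded Lg (mphis s) (fun x => HM0 _)).
    have LX : L1 leb (fun x => g x * phi (x - s *: ee k) - g x * phi x).
      by apply: L1B => //; exact: (L1_mul_bounded Lg (mphis s) (fun x => HM0 _)).
    apply: (le_trans (Int_norm LX)).
    rewrite mulrCA mulrC -IntZ; last exact: L1_norm.
    apply: Int_le; [exact: L1_norm|exact/L1Z/L1_norm|move=> x].
    rewrite -mulrBr normrM mulrC ler_wpM2r//.
    rewrite -[s *: ee k]opprK -scalerN opprK.
    apply: (le_trans (smooth_lipschitz_along x (v := - ee k) sphi s0 HM1')).
    by rewrite ler_wpM2r.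
  rewrite -(ler_pM2l h0) -{1}(ger0_norm h0') -normrM.
  rewrite (_ : h * (A + B) = (S + h * A) - (S - h * B)); last by ring.
  apply: (le_trans (ler_normB _ _)).
  by apply: (le_trans (lerD S1 S4)); rewrite /Kst le_eqVlt; apply/orP; left; apply/eqP; ring.
apply/eqP; rewrite -addr_eq0 -normr_le0.
rewrite leNgt; apply/negP => AB0.
have K1 : 0 < Kst + 1 by rewrite ltr_wpDl// addr_ge0// mulr_ge0.
(* This h makes [h * Kst] at most half of [|A + B|], against the bound [key]; the added 1 guards
   against Kst = 0. *)
pose h := Num.min del (`|A + B| / (2 * (Kst + 1))).
have h0 : 0 < h by rewrite lt_min d0 divr_gt0// mulr_gt0.
have := key h h0; rewrite ge_min lexx => /(_ isT).
have : h * (Kst + 1) <= `|A + B| / 2.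
  rewrite -ler_pdivlMr// -mulrA -invfM ge_min; apply/orP; right.
  by rewrite mulrC.
have : h * Kst <= h * (Kst + 1) by rewrite ler_pM2l// lerDl.
by move: AB0; lra.
Qed.

End local_difference.

(** * Sobolev functions and rigidity of zero symmetric gradients *)

Section sobolev.
Context {R : realType} {n : nat}.
Local Notation vec := 'rV[R]_n.
Local Notation leb := (@lebesgue_row R n).
Local Notation ee k := (delta_mx ord0 k : vec).
Local Notation tens := (tensor (@row_coord R n)).
Implicit Types (U : set vec).

Lemma patchMl {T : Type} (f g : T -> R) (A : set T) :
  (fun x => f x * g x) \_ A = fun x => (f \_ A) x * g x.
Proof. by apply/funext => x; rewrite !patchE; case: ifP; rewrite ?mul0r. Qed.

Lemma in_L2P d (X : measurableType d) (m : {measure set X -> \bar R}) (A : set X) (f : X -> R) :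
  measurable A -> in_L2 m A f <-> L2 m (f \_ A).
Proof.
move=> mA; have [H1 H2] := measurable_restrictT f mA; split=> [[mf foo]|[mf Lf]].
  exact: (L2_finite m mA mf).1.
by split; [exact: H2|apply/(L2_finite m mA (H2 mf))].
Qed.

Lemma bounded_lebesgue_lty U : measurable U -> bounded_set U -> (leb U < +oo)%E.
Proof.
move=> mU [M [_ HM]]; pose N := `|M| + 1.
have N0 : 0 <= N by rewrite addr_ge0.
apply: (@le_lt_trans _ _ (leb (box (fun=> - (N + 1)) (fun=> N + 1)))).
  apply: le_measure; rewrite ?inE//; first exact: measurable_box.
  move=> x Ux i; rewrite -ltr_norml.
  have /(_ x Ux) : forall x, U x -> `|x| <= N by apply: HM; rewrite ltr_pwDr// ler_norm.
  move=> /= xN; apply: (@le_lt_trans _ _ `|x|); last by rewrite (le_lt_trans xN)// ltrDl.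
  rewrite /Num.norm/= mx_normrE; exact: (le_bigmax _ (fun j => `|x j.1 j.2|) (ord0, i)).
by rewrite lebesgue_box ?ltry// => i; lra.
Qed.

Lemma tens_test_function U F a b : (forall i, smooth1 (F i)) -> supported a b F ->
  cbox a b `<=` U -> test_function U (tens F).
Proof.
move=> sF F0 abU; split; first exact/smooth_tensor_smooth/tens_smooth.
by exists (cbox a b); split => //; [exact: cbox_compact|exact: tens_support].
Qed.

Lemma tens_derive F k : (forall i, smooth1 (F i)) ->
  'D_(ee k) (tens F) = tens (upd F k (derive1 (F k))).
Proof.
move=> sF; apply/funext => x.
suff H : is_derive x (ee k) (tens F) (tens (upd F k (derive1 (F k))) x) by exact: derive_val.
apply: tensor_derive => // i; have := row_coord_affine i (ee k).
by rewrite mxE eqxx.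
Qed.

Lemma in_H1_weak_partial U v Dv k : in_H1 U v Dv ->
  weak_partial U (v \_ U) ((fun x => Dv x ord0 k) \_ U) k.
Proof.
move=> [_ _ H] F a b sF F0 abU.
have := H _ (tens_test_function sF F0 abU) k.
by rewrite -(tens_derive k sF) !Rintegral_Int !patchMl.
Qed.

Lemma weak_derivative_in_H1 U v (Dv : vec -> vec) : open U ->
  L2 leb (v \_ U) -> (forall k, L2 leb ((fun x => Dv x ord0 k) \_ U)) ->
  (forall k phi, test_function U phi ->
    Int leb (fun x => (v \_ U) x * 'D_(ee k) phi x) =
    - Int leb (fun x => ((fun x => Dv x ord0 k) \_ U) x * phi x)) ->
  in_H1 U v Dv.
Proof.
move=> oU Lv LDv H; have mU := open_row_measurable oU.
split; first exact/(in_L2P leb).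
  by move=> k; exact/(in_L2P leb).
by move=> phi tphi k; rewrite !Rintegral_Int !patchMl; exact: H.
Qed.

Lemma in_H1_ac_on U v Dv k : open U -> (leb U < +oo)%E -> in_H1 U v Dv ->
  ac_on U (v \_ U) ((fun x => Dv x ord0 k) \_ U) k.
Proof.
move=> oU Uoo Hv; have mU := open_row_measurable oU.
have [/(in_L2P leb _ mU) Lv LDv _] := Hv; have /(in_L2P leb _ mU) LDk := LDv k.
apply: weak_partial_ac => //; last exact: in_H1_weak_partial.
  by have := L2_L1 mU Uoo Lv; rewrite -patch_setI setIid.
by have := L2_L1 mU Uoo LDk; rewrite -patch_setI setIid.
Qed.

Lemma patch_L2_L1 U (f : vec -> R) : measurable U -> (leb U < +oo)%E ->
  L2 leb (f \_ U) -> L1 leb (f \_ U).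
Proof. by move=> mU Uoo Lf; have := L2_L1 mU Uoo Lf; rewrite -patch_setI setIid. Qed.

(** From the weak gradient to increments along lines, through the chain rule there, and back. Finite
    measure of U turns the L2 data into the L1 data of these steps, and [|dtrunc| <= 1] keeps the
    new gradient in L2. *)
Lemma in_H1_trunc c U v Dv : open U -> (leb U < +oo)%E -> in_H1 U v Dv ->
  in_H1 U (fun x => trunc c (v x)) (fun x => dtrunc c (v x) (v x) *: Dv x).
Proof.
move=> oU Uoo Hv; have mU := open_row_measurable oU.
have [/(in_L2P leb _ mU) Lv LDv _] := Hv.
have LD k := (in_L2P leb (fun x => Dv x ord0 k) mU).1 (LDv k).
have E1 : (fun x => trunc c (v x)) \_ U = fun x => trunc c ((v \_ U) x).
  by apply/funext => x; rewrite !patchE; case: ifP => //; rewrite /trunc mul0r.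
have E2 k : (fun x => (dtrunc c (v x) (v x) *: Dv x) ord0 k) \_ U =
    fun x => dtrunc c ((v \_ U) x) ((v \_ U) x) * ((fun x => Dv x ord0 k) \_ U) x.
  by apply/funext => x; rewrite !patchE; case: ifP => //; rewrite ?mulr0// mxE.
have mv := L2_measurable Lv.
have Ltv : L2 leb ((fun x => trunc c (v x)) \_ U).
  rewrite E1; apply: L2_le (Lv); last by move=> x; exact: trunc_norm.
  exact: measurableT_comp (measurable_trunc c) mv.
have LtD k : L2 leb ((fun x => (dtrunc c (v x) (v x) *: Dv x) ord0 k) \_ U).
  rewrite E2; apply: L2_le (LD k).
    apply: measurable_funM; last exact: L2_measurable (LD k).
    exact: measurableT_comp (measurable_dtrunc c) mv.
  by move=> x; rewrite normrM ler_piMl// dtrunc_le1.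
apply: weak_derivative_in_H1 => // k phi tphi.
have Lv1 := patch_L2_L1 mU Uoo Lv; have LD1 := patch_L2_L1 mU Uoo (LD k).
have := patch_L2_L1 mU Uoo Ltv; have := patch_L2_L1 mU Uoo (LtD k).
rewrite E1 E2 => L1D L1t.
apply: ac_on_weak_derivative L1t L1D _ tphi.
by apply: ac_on_trunc => //; exact: in_H1_ac_on.
Qed.

Lemma in_H1_lin U (c : R) v w Dv Dw : open U -> (leb U < +oo)%E ->
  in_H1 U v Dv -> in_H1 U w Dw ->
  in_H1 U (fun x => c * v x + w x) (fun x => c *: Dv x + Dw x).
Proof.
move=> oU Uoo Hv Hw; have mU := open_row_measurable oU.
have [/(in_L2P leb _ mU) Lv LDv Wv] := Hv; have [/(in_L2P leb _ mU) Lw LDw Ww] := Hw.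
have LD k := (in_L2P leb (fun x => Dv x ord0 k) mU).1 (LDv k).
have LE k := (in_L2P leb (fun x => Dw x ord0 k) mU).1 (LDw k).
have E (f g : vec -> R) : (fun x => c * f x + g x) \_ U = fun x => c * (f \_ U) x + (g \_ U) x.
  by apply/funext => x; rewrite !patchE; case: ifP => //; rewrite mulr0 addr0.
have E2 k : (fun x => (c *: Dv x + Dw x) ord0 k) =
    fun x => c * Dv x ord0 k + Dw x ord0 k by apply/funext => x; rewrite !mxE.
apply: weak_derivative_in_H1 => //.
- by rewrite E; apply: L2D => //; exact: L2Z.
- by move=> k; rewrite E2 E; apply: L2D => //; exact: L2Z.
move=> k phi tphi; rewrite E2 !E.
have [M _ HM] := test_function_bounded tphi.
have mphi : measurable_fun setT phi by apply: continuous_row_measurable; exact: (tphi.1 [::]).1.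
have tdphi := test_function_derive (ee k) tphi.
have [M' _ HM'] := test_function_bounded tdphi.
have mdphi : measurable_fun setT ('D_(ee k) phi).
  by apply: continuous_row_measurable; exact: (tdphi.1 [::]).1.
have := Wv _ tphi k; have := Ww _ tphi k; rewrite !Rintegral_Int !patchMl => Ew Ev.
have Lv1 := patch_L2_L1 mU Uoo Lv; have LD1 := patch_L2_L1 mU Uoo (LD k).
have Lw1 := patch_L2_L1 mU Uoo Lw; have LE1 := patch_L2_L1 mU Uoo (LE k).
transitivity (Int leb (fun x => c * ((v \_ U) x * 'D_(ee k) phi x) + (w \_ U) x * 'D_(ee k) phi x)).
  by apply: eq_Int => x; rewrite mulrDl mulrA.
rewrite IntD ?IntZ ?Ev ?Ew; [|exact: (L1_mul_bounded Lv1 mdphi HM')..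
  |exact/L1Z/(L1_mul_bounded Lv1 mdphi HM')|exact: (L1_mul_bounded Lw1 mdphi HM')].
rewrite mulrN -opprD; congr (- _).
rewrite -IntZ -?IntD; [|exact/L1Z/(L1_mul_bounded LD1 mphi HM)|exact: (L1_mul_bounded LE1 mphi HM)
  |exact: (L1_mul_bounded LD1 mphi HM)].
by apply: eq_Int => x; rewrite mulrDl mulrA.
Qed.

Lemma ball_lebesgue_neq0 (p : vec) (r : R) : 0 < r -> leb (ball p r) != 0%E.
Proof.
move=> r0; rewrite ballE// lebesgue_box => [|i]; last by lra.
rewrite gt_eqF// lte_fin; apply: prodr_gt0 => i _; lra.
Qed.

Lemma ae_ex (A : set vec) (P : vec -> Prop) : leb A != 0%E -> measurable A ->
  (\forall x \ae leb, A x -> P x) -> exists2 x, A x & P x.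
Proof.
move=> A0 mA [B [mB B0 PB]]; apply: contrapT => nP.
have AB : A `<=` B.
  by move=> x Ax; apply: PB => /= /(_ Ax) Px; apply: nP; exists x.
move/eqP : A0; apply; apply/eqP; rewrite eq_le measure_ge0 andbT.
apply: (@le_trans _ _ (leb B)); last by rewrite B0.
by apply: le_measure; rewrite ?inE.
Qed.

Lemma fundamental_lemma_open U (w : vec -> R) : open U -> L1 leb w ->
  (forall F a b, (forall i, smooth1 (F i)) -> supported a b F -> cbox a b `<=` U ->
    Int leb (fun x => w x * tens F x) = 0) ->
  \forall x \ae leb, U x -> w x = 0.
Proof.
move=> oU Lw H; apply: ae_local => p Up.
have /nbhs_ballP[r0 /= r00 pr] := open_nbhs_nbhs (conj oU Up).
have r20 : 0 < r0 / 2 by rewrite divr_gt0.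
exists (r0 / 2) => //; rewrite ballE//.
apply: fundamental_lemma => // a' b' ab k.
apply: (H _ a' b') => [i|i x|x Hx]; first exact: smooth1_bump.
  move=> /negP xab; apply: bump_out => //; apply/negP => /andP[h1 h2].
  by apply: xab; rewrite !ltW.
apply: pr; rewrite ballE// => i; have /andP[h1 h2] := Hx i; have [l1 l2] := ab i.
by move: l1 l2 h1 h2; lra.
Qed.

End sobolev.

(** * Functions with constant weak partial derivatives *)

Section local_constancy.
Context {R : realType} {n : nat}.
Local Notation vec := 'rV[R]_n.
Local Notation leb := (@lebesgue_row R n).
Local Notation ee k := (delta_mx ord0 k : vec).
Implicit Types (U : set vec).

Lemma steps_coord (h x : vec) (s : seq 'I_n) j : uniq s ->
  (x + \sum_(i <- s) h ord0 i *: ee i) ord0 j = x ord0 j + (if j \in s then h ord0 j else 0).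
Proof.
move=> us; rewrite mxE summxE; congr (_ + _).
elim: s us => [|i s IH] /=; first by rewrite big_nil.
move=> /andP[ns us]; rewrite big_cons IH// !mxE eqxx inE /=.
have [->|ji] := eqVneq j i; first by rewrite (negbTE ns) mulr1 addr0.
by rewrite mulr0 add0r.
Qed.

(* By Fubini, some x0 satisfies w (x0 + h) = w x0 for almost every h. *)
Lemma shift_invariant_constant (w : vec -> R) (p : vec) (r : R) : 0 < r ->
  measurable_fun setT w ->
  (forall k h, 0 <= h -> h <= r -> \forall x \ae leb, ball p r x -> w (x + h *: ee k) = w x) ->
  exists C, \forall x \ae leb, ball p (r / 4) x -> w x = C.
Proof.
move=> r0 mw H.
(* Starting points in B0 moved by any part of a step in H0 stay in the ball of radius r, and from
   any x0 in B0 the steps in H0 reach the whole ball of radius r / 4. *)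
pose B0 : set vec := box (fun i => p ord0 i - r / 2) (fun i => p ord0 i - r / 4).
pose H0 : set vec := box (fun=> 0) (fun=> 3 * r / 4).
have Hs (h : vec) (s : seq 'I_n) : H0 h -> uniq s ->
    \forall x \ae leb, B0 x -> w (x + \sum_(i <- s) h ord0 i *: ee i) = w x.
  move=> Hh; elim: s => [_|i s IH /= /andP[ns us]].
    by apply: aeW => x _; rewrite big_nil addr0.
  have /andP[hi0 hi1] := Hh i.
  have hir : h ord0 i <= r by move: hi1; lra.
  apply: filterS2 (IH us) (ae_shift (\sum_(i <- s) h ord0 i *: ee i) (H i _ (ltW hi0) hir)) => x H1 H2 Bx.
  rewrite big_cons [_ + \sum_(_ <- _) _]addrC addrA H2 ?H1//.
  rewrite ballE// => j; rewrite steps_coord//.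
  have /andP[b1 b2] := Bx j; have /andP[c1 c2] := Hh j.
  by case: ifP => _; move: b1 b2 c1 c2; lra.
have Hh (h : vec) : H0 h -> \forall x \ae leb, B0 x -> w (x + h) = w x.
  move=> Hh; apply: filterS (Hs h (index_enum _) Hh (index_enum_uniq _)) => x.
  by rewrite {2}(row_sum_delta h).
have mB0 : measurable B0 by exact: measurable_box.
have mH0 : measurable H0 by exact: measurable_box.
pose W (q : vec * vec) := \1_H0 q.1 * \1_B0 q.2 * (w (q.2 + q.1) - w q.2).
have mW : measurable_fun setT W.
  apply: measurable_funM.
    by apply: measurable_funM; apply: measurableT_comp => //; exact: measurable_indic.
  apply: measurable_funB; last exact: measurableT_comp.
  apply: (measurableT_comp mw (g := fun q : vec * vec => q.2 + q.1)).
  apply: measurable_to_row => i; under eq_fun do rewrite mxE.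
  by apply: measurable_funD; apply: measurableT_comp (measurable_row_coord i) _.
have : \forall q \ae (leb \x leb)%E, W q = 0.
  apply: ae_prod1.
    by have := mW measurableT [set 0] (measurable_set1 0); rewrite setTI.
  apply: aeW => h; rewrite /W /=.
  have [/set_mem Hh0|hn] := boolP (h \in H0); last first.
    by apply: aeW => x; rewrite !indicE (negbTE hn) !mul0r.
  apply: filterS (Hh h Hh0) => x Hx; rewrite !indicE.
  by have [/set_mem/Hx->|_] := boolP (x \in B0); rewrite ?subrr ?mulr0// mul0r.
move=> /ae_fubini2 HW.
have [x0 Bx0 Hx0] : exists2 x0, B0 x0 & \forall h \ae leb, W (h, x0) = 0.
  apply: ae_ex mB0 _; last by apply: filterS HW.
  rewrite lebesgue_box => [|i]; last by lra.
  rewrite gt_eqF// lte_fin; apply: prodr_gt0 => i _; lra.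
exists (w x0).
apply: filterS (ae_shift (- x0) Hx0) => y Hy py.
move: Hy; rewrite /W /= [x0 + _]addrC subrK !indicE mem_set; last first.
  move=> i; have /andP[b1 b2] := Bx0 i.
  move: py; rewrite ballE ?divr_gt0// => /(_ i) /andP[c1 c2].
  by rewrite !mxE; move: b1 b2 c1 c2; lra.
by rewrite mem_set// !mul1r => /eqP; rewrite subr_eq0 => /eqP.
Qed.

(** Points with local value C0 and points with another local value form two open sets, disjoint
    because every ball has positive measure; connectedness rules out the second. *)
Lemma locally_constant_constant U (w : vec -> R) : open U -> connected U ->
  (forall p, U p -> exists r C, 0 < r /\ \forall x \ae leb, ball p r x -> w x = C) ->
  exists C, \forall x \ae leb, U x -> w x = C.
Proof.
move=> oU cU loc.
have [U0|/set0P[p0 Up0]] := eqVneq U set0.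
  by exists 0; apply: aeW => x; rewrite U0.
have [r0 [C0 [r00 H0]]] := loc _ Up0; exists C0.
have openS (P : R -> Prop) : open [set p : vec | exists r C, [/\ 0 < r, P C & \forall x \ae leb, ball p r x -> w x = C]].
  move=> p [r [C [rp PC H]]]; apply/nbhs_ballP; exists (r / 2); first by rewrite /= divr_gt0.
  move=> q pq; exists (r / 2), C; split; [by rewrite divr_gt0|by []|].
  apply: filterS H => x Hx qx; apply: Hx.
  by rewrite (splitr r); exact: ball_triangle pq qx.
have uni p r C r' C' : 0 < r -> 0 < r' -> (\forall x \ae leb, ball p r x -> w x = C) ->
    (\forall x \ae leb, ball p r' x -> w x = C') -> C = C'.
  move=> rp rp' H H'.
  have rr : 0 < Num.min r r' by rewrite lt_min rp.
  have [|||x _ [<- <-]//] := @ae_ex R n (ball p (Num.min r r')) (fun x => w x = C /\ w x = C').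
  - exact: ball_lebesgue_neq0.
  - exact: measurable_rball.
  apply: filterS2 H H' => x Hx Hx' px; split.
    by apply: Hx; apply: le_ball px; rewrite ge_min lexx.
  by apply: Hx'; apply: le_ball px; rewrite ge_min lexx orbT.
suff E : U `&` [set p : vec | exists r C, [/\ 0 < r, C = C0 & \forall x \ae leb, ball p r x -> w x = C]] = U.
  apply: ae_local => p; rewrite -E => -[_ [r [C [rp -> H]]]].
  by exists r.
apply: cU.
- by exists p0; split => //; exists r0, C0.
- by exists [set p : vec | exists r C, [/\ 0 < r, C = C0 & \forall x \ae leb, ball p r x -> w x = C]] => //; exact: openS.
exists (~` [set p : vec | exists r C, [/\ 0 < r, C <> C0 & \forall x \ae leb, ball p r x -> w x = C]]).
  by apply: open_closedC; exact: openS.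
apply/seteqP; split => p [Up].
  move=> [r [C [rp CC H]]]; split => // -[r' [C' [rp' CC' H']]].
  by apply: CC'; rewrite -CC; exact: uni H' H.
move=> nS; split => //; have [r [C [rp H]]] := loc _ Up.
have [CC|CC] := pselect (C = C0); first by exists r, C.
by exfalso; apply: nS; exists r, C.
Qed.

Lemma constant_partials_affine U (v : vec -> R) (c : 'I_n -> R) : open U -> connected U ->
  (leb U < +oo)%E -> L1 leb (v \_ U) ->
  (forall k, weak_partial U (v \_ U) ((cst (c k)) \_ U) k) ->
  exists C, \forall x \ae leb, U x -> v x = \sum_k x ord0 k * c k + C.
Proof.
move=> oU cU Uoo Lv H; have mU := open_row_measurable oU.
pose w x := (v \_ U) x - \sum_k x ord0 k * c k.
have mw : measurable_fun setT w.
  apply: measurable_funB; first exact: L1_measurable Lv.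
  apply: measurable_sum => k; apply: measurable_funM => //.
  exact: (measurable_row_coord k).
have Lc k : L1 leb ((cst (c k)) \_ U).
  have := L1Z (c k) (L1_indicator mU Uoo); apply: eq_L1 => x.
  by rewrite patchE indicE; case: ifP; rewrite ?mulr1 ?mulr0.
have [C HC] : exists C, \forall x \ae leb, U x -> w x = C.
  apply: locally_constant_constant => // p Up.
  have /nbhs_ballP[r0 /= r00 pr] := open_nbhs_nbhs (conj oU Up).
  have /choice[r Hr] : forall k, exists r : R, 0 < r /\ forall h, 0 <= h -> h <= r ->
      \forall x \ae leb, ball p r x -> (v \_ U) (x + h *: ee k) - (v \_ U) x =
        primitive (fun s => ((cst (c k)) \_ U) (x + s *: ee k)) h.
    by move=> k; have [r ? ?] := weak_partial_ac oU Lv (Lc k) (H k) Up; exists r.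
  (* Below every r k, so that all increment formulas hold, and below r0 / 2, so that the slid points
     stay in U, where the partials are not cut to zero. *)
  pose rho := \big[Num.min/(r0 / 2)]_k r k.
  have rho0 : 0 < rho.
    by rewrite /rho; elim/big_ind: _ => //[|x y x0 y0|k _]; rewrite ?divr_gt0// ?lt_min ?x0//; case: (Hr k).
  have rhor k : rho <= r k by exact: bigmin_le_cond || exact: bigmin_inf.
  have rhor0 : rho <= r0 / 2 by exact: bigmin_le_id.
  have [|C HC] := @shift_invariant_constant w p rho rho0 mw.
    move=> k h h0 hr; have [_ /(_ h h0 (le_trans hr (rhor k)))] := Hr k.
    apply: filterS => x Hx px.
    have inU s : 0 <= s -> s <= h -> U (x + s *: ee k).
      move=> s0 sh; apply: pr; rewrite ballE// => i; rewrite !mxE eqxx /=.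
      move: px; rewrite ballE// => /(_ i) /andP[b1 b2].
      have : 0 <= s * (i == k)%:R <= rho.
        case: eqP => _; rewrite ?mulr1 ?mulr0 ?s0 ?(le_trans sh hr)//.
        by rewrite lexx ltW.
      by move=> /andP[]; move: b1 b2 rhor0; lra.
    have /Hx : ball p (r k) x by exact: le_ball px.
    have -> : primitive (fun s => ((cst (c k)) \_ U) (x + s *: ee k)) h = c k * h.
      rewrite /primitive; transitivity (Int (@lebesgue_measure R) (fun s => c k * \1_(`[0, h]%classic : set R) s)).
        apply: eq_Int => s; rewrite indic_segmentE mulrC.
        have [/andP[s0 sh]|_] := boolP (0 <= s <= h); last by rewrite !mulr0.
        by rewrite patchE mem_set//; exact: inU.
      rewrite IntZ; last exact: L1_indic_segment.
      by rewrite Int_indic_segment.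
    move=> E; rewrite /w (eq_bigr (fun i => x ord0 i * c i + (if i == k then h * c i else 0))); last first.
      move=> i _; rewrite !mxE eqxx /= mulrDl; congr (_ + _).
      by case: eqP; rewrite ?mulr1 ?mulr0 ?mul0r.
    by rewrite big_split/= -big_mkcond big_pred1_eq; move: E; lra.
  by exists (rho / 4), C; rewrite divr_gt0.
exists C; apply: filterS HC => x Hx Ux; rewrite -(Hx Ux) /w patchE mem_set//.
by rewrite addrC subrK.
Qed.

End local_constancy.

(** * Fields with vanishing symmetric gradient *)

Section rigidity.
Context {R : realType} {n : nat}.
Local Notation vec := 'rV[R]_n.
Local Notation leb := (@lebesgue_row R n).
Local Notation tens := (tensor (@row_coord R n)).
Local Notation dd k F := (upd F k (derive1 (F k))).

(** Schwarz's theorem is immediate on tensor products: for j different from k the two derivatives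
    act on different factors. *)
Lemma dd_comm (F : 'I_n -> R -> R) j k : dd j (dd k F) = dd k (dd j F).
Proof.
have [->//|jk] := eqVneq j k; apply/funext => i; rewrite /upd.
rewrite (eq_sym k j) (negbTE jk).
have [->|ij] := eqVneq i j; first by rewrite (negbTE jk).
by case: (i == k).
Qed.

Lemma dd_smooth (F : 'I_n -> R -> R) k : (forall i, smooth1 (F i)) ->
  forall i, smooth1 (dd k F i).
Proof. by move=> sF; apply: upd_smooth => //; exact: smooth1_derive1. Qed.

(* D_k D_j w_i is symmetric in (j, k) and antisymmetric in (i, j), hence zero. *)
Lemma zero_symmetric_gradient_rigid (U : set vec) (w : vec -> vec) (Dw : vec -> 'M[R]_n) :
  open U -> connected U -> U !=set0 -> (leb U < +oo)%E -> in_H1v U w Dw ->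
  (\forall x \ae leb, U x -> sym_part (Dw x) = 0) -> rigid_displacement U w.
Proof.
move=> oU cU [p Up] Uoo Hw Hsym; have mU := open_row_measurable oU.
pose wi i := (fun x => w x ord0 i) \_ U.
pose D i j := (fun x => Dw x i j) \_ U.
have rowE i j : (fun x => row i (Dw x) ord0 j) = fun x => Dw x i j.
  by apply/funext => x; rewrite mxE.
have WP i j : weak_partial U (wi i) (D i j) j.
  by have := in_H1_weak_partial j (Hw i); rewrite rowE.
have LD i j : L1 leb (D i j).
  have [_ /(_ j)/(in_L2P leb _ mU) + _] := Hw i.
  by rewrite rowE; exact: patch_L2_L1.
have Lw i : L1 leb (wi i).
  by have [/(in_L2P leb _ mU) + _ _] := Hw i; exact: patch_L2_L1.
have anti i j : \forall x \ae leb, D i j x = - D j i x.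
  apply: filterS Hsym => x Hx; rewrite /D !patchE; case: ifPn => [/set_mem/Hx|]; last by rewrite oppr0.
  move=> /matrixP/(_ i j); rewrite !mxE => /eqP; rewrite mulf_eq0 invr_eq0 pnatr_eq0 /=.
  by rewrite addr_eq0 => /eqP.
have WP0 i j k : weak_partial U (D i j) ((cst 0) \_ U) k.
  move=> F a b sF F0 abU.
  have sdF := dd_smooth _ sF.
  (* The second distributional derivative D_k D_j w_i paired with F. All derivatives fall on F,
     where they commute. *)
  pose A i j k := Int leb (fun x => wi i x * tens (dd j (dd k F)) x).
  have AP i' j' k' : Int leb (fun x => D i' j' x * tens (dd k' F) x) = - A i' j' k'.
    by rewrite /A (WP i' j' _ a b (sdF k') (upd_supported _ F0) abU) opprK.
  have Asym i' j' k' : A i' j' k' = A i' k' j' by rewrite /A dd_comm.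
  clearbody A.
  have Aanti i' j' k' : A i' j' k' = - A j' i' k'.
    apply: oppr_inj; rewrite -(AP i' j' k') -(AP j' i' k').
    have LT : L1 leb (fun x => D j' i' x * tens (dd k' F) x).
      have [M _ HM] := tens_bounded (sdF k') (upd_supported k' F0).
      by apply: (L1_mul_bounded (LD _ _) (M := M)) => //; apply: tens_measurable; exact: sdF.
    apply: (etrans _ (IntN LT)).
    have mT : measurable_fun setT (tens (dd k' F)) by apply: tens_measurable; exact: sdF.
    apply: Int_ae.
    - by apply: measurable_funM => //; exact: L1_measurable (LD _ _).
    - apply: measurableT_comp => //; apply: measurable_funM => //; exact: L1_measurable (LD _ _).
    by apply: filterS (anti i' j') => x ->; rewrite mulNr.
  have A0 : A i j k = 0.
    (* Three antisymmetries in the first two indices alternate with three symmetries in the last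
       two: ijk, jik, jki, kji, kij, ikj, ijk. The number of sign changes is odd. *)
    have : A i j k = - A i j k.
      rewrite {1}Aanti Asym {1}Aanti opprK Asym Aanti Asym; congr (- _).
    by move=> /eqP; rewrite -addr_eq0 -mulr2n mulrn_eq0 /= => /eqP.
  rewrite AP A0 oppr0; apply/esym/eqP; rewrite oppr_eq0; apply/eqP.
  apply: (etrans _ (Int0 leb)); apply: eq_Int => x.
  by rewrite patchE; case: ifP; rewrite mul0r.
have /choice[S HS] : forall ij : 'I_n * 'I_n, exists S, \forall x \ae leb, U x -> Dw x ij.1 ij.2 = S.
  move=> [i j]; have [C HC] := constant_partials_affine oU cU Uoo (LD i j) (WP0 i j).
  exists C; apply: filterS HC => x Hx /Hx ->.
  by rewrite big1 ?add0r// => k _; rewrite mulr0.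
have WS i k : weak_partial U (wi i) ((cst (S (i, k))) \_ U) k.
  move=> F a b sF F0 abU; rewrite (WP i k _ a b)//; congr (- _).
  have mT : measurable_fun setT (tens F) by exact: tens_measurable.
  apply: Int_ae.
  - by apply: measurable_funM => //; exact: L1_measurable (LD _ _).
  - by apply: measurable_funM => //; apply: measurable_patch => //; exact: measurable_cst.
  apply: filterS (HS (i, k)) => x Hx; rewrite /D !patchE; case: ifP => //.
  by move=> /set_mem/Hx ->.
have /choice[C HC] : forall i, exists C, \forall x \ae leb, U x ->
    w x ord0 i = \sum_k x ord0 k * S (i, k) + C.
  by move=> i; exact: constant_partials_affine oU cU Uoo (Lw i) (WS i).
pose SS : 'M[R]_n := \matrix_(k, i) S (i, k).
exists SS, (\row_i C i); split.
  (* Skew-symmetry of the constant matrix is read off at a single point, available because U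
     contains a ball and so has positive measure. *)
  have [|||x Ux Hx] := @ae_ex R n U (fun x => forall ij : 'I_n * 'I_n,
      Dw x ij.1 ij.2 = S ij /\ sym_part (Dw x) = 0).
  - have /nbhs_ballP[r /= r0 pr] := open_nbhs_nbhs (conj oU Up).
    apply: contra (ball_lebesgue_neq0 p r0) => /eqP U0.
    rewrite eq_le measure_ge0 andbT -U0; apply: le_measure; rewrite ?inE//.
    exact: measurable_rball.
  - exact: mU.
  - have : \forall x \ae leb, forall ij : 'I_n * 'I_n, U x -> Dw x ij.1 ij.2 = S ij.
      exact: ae_forall_fin.
    by apply: filterS2 Hsym => x H1 H2 Ux ij; split; [exact: H2|exact: H1].
  apply/matrixP => i j; rewrite !mxE.
  have [<- _] := Hx (i, j); have [<- H] := Hx (j, i); move: H.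
  move=> /matrixP/(_ i j); rewrite !mxE => /eqP; rewrite mulf_eq0 invr_eq0 pnatr_eq0 /=.
  by rewrite addr_eq0 => /eqP.
have : \forall x \ae leb, forall i, U x -> w x ord0 i = \sum_k x ord0 k * S (i, k) + C i.
  exact: ae_forall_fin.
apply: filterS => x Hx Ux; apply/rowP => i; rewrite !mxE Hx//; congr (_ + _).
by apply: eq_bigr => k _; rewrite !mxE.
Qed.

End rigidity.

(** * Primitives of integrable functions *)

Section line_integrals.
Context {R : realType}.
Local Notation leb1 := (@lebesgue_measure R).
Local Notation mR := (measurableTypeR R).

Definition shift1 (t s : mR) : mR := s + t.

Lemma measurable_shift1 t : measurable_fun setT (shift1 t).
Proof. by apply: measurable_funD. Qed.

Definition shifted1 (t : mR) : set mR -> \bar R := pushforward leb1 (shift1 t).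

HB.instance Definition _ t := Measure.copy (shifted1 t)
  (measure_function_pushforward__canonical__measure_function_Measure
     leb1 (measurable_shift1 t)).

Lemma lebesgue_shift1 t (A : set mR) : measurable A -> leb1 (shift1 t @^-1` A) = leb1 A.
Proof.
move=> mA; apply/esym; apply: (lebesgue_measure_unique (mu := shifted1 t)) mA.
move=> _ [[a b] _ <-]; rewrite /= /shifted1 /pushforward.
have -> : shift1 t @^-1` (`]a, b]%classic) = `]a - t, b - t]%classic.
  by apply/seteqP; split => s /=; rewrite !in_itv/= ltrBlDr lerBrDr.
rewrite !lebesgue_measure_itv/= !lte_fin ltrD2r; case: ifP => // _.
by rewrite -!EFinD; congr _%:E; ring.
Qed.

Lemma L1_shift1 t (f : R -> R) : L1 leb1 f -> L1 leb1 (fun s => f (s + t)).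
Proof.
move=> Lf; have mf := L1_measurable Lf.
have mft : measurable_fun setT (fun s : mR => f (s + t)).
  exact: measurableT_comp mf (measurable_shift1 t).
apply/integrableP; split; first exact/measurable_EFinP.
have /integrableP[_] := Lf; congr (_ < _)%E.
transitivity (\int[shifted1 t]_x `|(EFin \o f) x|)%E.
  by apply: eq_measure_integral => A mA _; exact/esym/lebesgue_shift1.
rewrite ge0_integral_pushforward//; first exact: measurable_shift1.
by apply: measurableT_comp => //; exact/measurable_EFinP.
Qed.

Lemma Int_shift1 t (f : R -> R) : L1 leb1 f -> Int leb1 (fun s => f (s + t)) = Int leb1 f.
Proof.
move=> Lf; have mf := L1_measurable Lf.
rewrite /Int /Rintegral; congr fine; apply/esym.
transitivity (\int[shifted1 t]_x (f x)%:E)%E.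
  by apply: eq_measure_integral => A mA _; exact/esym/lebesgue_shift1.
rewrite (integral_pushforward (measurable_shift1 t))//.
- exact/measurable_EFinP.
- exact: L1_shift1 Lf.
Qed.

Lemma primitive_shift (f : R -> R) (t h : R) : L1 leb1 f -> 0 <= t -> 0 <= h ->
  primitive (fun s => f (t + s)) h = primitive f (t + h) - primitive f t.
Proof.
move=> Lf t0 h0; rewrite primitive_diff//; last by rewrite lerDl.
transitivity (Int leb1 (fun r => \1_(`[t, t + h]%classic : set R) r * f r)); last first.
  apply: Int_ae.
  - by apply: measurable_funM; [exact: measurable_indic|exact: L1_measurable Lf].
  - by apply: measurable_funM; [exact: measurable_indic|exact: L1_measurable Lf].
  (* The closed and the half-open interval differ only in the null set {t}. *)
  exists [set t]; split => //; first exact: lebesgue_measure_set1.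
  move=> r /= H; apply: contrapT => rt; apply: H; congr *%R.
  rewrite !indicE !mem_setE !in_itv/= le_eqVlt eq_sym.
  by have /eqP/negbTE -> : r <> t by exact: rt.
rewrite -(Int_shift1 t); last exact: L1_indicM.
apply: eq_Int => s; rewrite [t + s]addrC; congr *%R.
by rewrite !indicE !mem_setE !in_itv/= lerDr [t + h]addrC lerD2r.
Qed.

Lemma primitive_norm_diff (f : R -> R) s t : L1 leb1 f -> 0 <= s -> s <= t ->
  `|primitive f t - primitive f s| <= primitive (fun r => `|f r|) t - primitive (fun r => `|f r|) s.
Proof.
move=> Lf s0 st; have LG := L1_norm Lf; rewrite !primitive_diff//.
apply: (le_trans (Int_norm (L1_indicM (measurable_itv _) Lf))).
apply: Int_le; [exact: L1_norm (L1_indicM (measurable_itv _) Lf)|exact: L1_indicM|].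
by move=> r; rewrite normrM ger0_norm// indic_nonneg.
Qed.

Lemma primitive_bounded (f : R -> R) t : L1 leb1 f -> `|primitive f t| <= Int leb1 (fun r => `|f r|).
Proof.
move=> Lf; apply: (le_trans (Int_norm (L1_indicM (measurable_itv _) Lf))).
apply: Int_le; [exact: L1_norm (L1_indicM (measurable_itv _) Lf)|exact: L1_norm|move=> r].
by rewrite normrM indicE; case: (_ \in _); rewrite ?normr1 ?normr0 ?mul1r ?mul0r.
Qed.

(** The product rule for primitives, by bisection: the increment of F K minus the candidate
    primitive is the integral over ]s, t] of [f (K t - K r) + (F s - F r) k], at most the square of
    the increment of the primitive of |f| + |k|. *)
Lemma primitive_mul (f k : R -> R) (h : R) : L1 leb1 f -> L1 leb1 k -> 0 <= h ->
  primitive f h * primitive k h =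
  primitive (fun r => f r * primitive k r + primitive f r * k r) h.
Proof.
move=> Lf Lk h0; have mf := L1_measurable Lf; have mk := L1_measurable Lk.
pose F := primitive f; pose K := primitive k; rewrite -/F -/K.
have LfK : L1 leb1 (fun r => f r * K r).
  apply: (L1_mul_bounded Lf (M := Int leb1 (fun r => `|k r|))).
    exact: measurable_primitive.
  by move=> r; exact: primitive_bounded.
have LFk : L1 leb1 (fun r => F r * k r).
  apply: eq_L1 (L1_mul_bounded Lk (M := Int leb1 (fun r => `|f r|)) (measurable_primitive mf) _).
    by move=> r; rewrite mulrC.
  by move=> r; exact: primitive_bounded.
have Lfk := L1D LfK LFk.
pose H s := F s * K s - primitive (fun r => f r * K r + F r * k r) s.
suff : H h = H 0 by rewrite /H /F /K !primitive0 mulr0 subrr => /eqP; rewrite subr_eq0 => /eqP.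
pose g r := `|f r| + `|k r|; pose G := primitive g.
have Lf' := L1_norm Lf; have Lk' := L1_norm Lk.
have Lg : L1 leb1 g by exact: L1D.
have gD s t : 0 <= s -> s <= t -> G t - G s =
   (primitive (fun r => `|f r|) t - primitive (fun r => `|f r|) s) +
   (primitive (fun r => `|k r|) t - primitive (fun r => `|k r|) s).
  move=> _ _; have GE r : G r = primitive (fun r => `|f r|) r + primitive (fun r => `|k r|) r.
    have mI : measurable (`[0, r]%classic : set R) by exact: measurable_itv.
    apply: etrans (IntD (L1_indicM mI Lf') (L1_indicM mI Lk')).
    by apply: eq_Int => x; rewrite /g mulrDr.
  by rewrite !GE; ring.
have fd s t (s0 : 0 <= s) (st : s <= t) := primitive_norm_diff Lf s0 st.
have kd s t (s0 : 0 <= s) (st : s <= t) := primitive_norm_diff Lk s0 st.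
have Fd s t : 0 <= s -> s <= t -> `|F t - F s| <= G t - G s.
  move=> s0 st; rewrite gD//; apply: (le_trans (fd s t s0 st)); rewrite lerDl.
  exact: le_trans (kd s t s0 st).
have Kd s t : 0 <= s -> s <= t -> `|K t - K s| <= G t - G s.
  move=> s0 st; rewrite gD//; apply: (le_trans (kd s t s0 st)); rewrite lerDr.
  exact: le_trans (fd s t s0 st).
apply: (@bisection_constant R H G 1 h) => //; first exact: primitive_continuous.
move=> s t s0 st th; rewrite /H mul1r.
have -> : F t * K t - primitive (fun r => f r * K r + F r * k r) t -
    (F s * K s - primitive (fun r => f r * K r + F r * k r) s) =
    Int leb1 (fun r => \1_`]s, t] r * (f r * (K t - K r) + (F s - F r) * k r)).
  transitivity (Int leb1 (fun r => K t * (\1_`]s, t] r * f r) + F s * (\1_`]s, t] r * k r) -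
     \1_`]s, t] r * (f r * K r + F r * k r))); last by apply: eq_Int => r; ring.
  rewrite IntB; [|by apply: L1D; apply: L1Z; exact: L1_indicM|exact: L1_indicM].
  rewrite IntD; [|by apply: L1Z; exact: L1_indicM..].
  rewrite !IntZ; [|exact: L1_indicM..].
  rewrite -!primitive_diff// -/F -/K; ring.
have LX : L1 leb1 (fun r => \1_`]s, t] r * (f r * (K t - K r) + (F s - F r) * k r)).
  apply: L1_indicM => //.
  rewrite (_ : (fun r => _) = fun r => (K t * f r + F s * k r) - (f r * K r + F r * k r)).
    by apply: L1B => //; apply: L1D; exact: L1Z.
  by apply/funext => r; ring.
apply: (le_trans (Int_norm LX)).
rewrite (_ : _ ^+ 2 = Int leb1 (fun r => (G t - G s) * (\1_`]s, t] r * g r))); last first.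
  by apply/esym; apply: (etrans (IntZ _ _)); [exact: L1_indicM|rewrite -(primitive_diff Lg s0 st) expr2].
apply: Int_le; [exact: L1_norm|exact/L1Z/L1_indicM|move=> r].
rewrite indicE mem_setE in_itv/=; case: (boolP (s < r <= t)) => [/andP[sr rt]|_]; last first.
  by rewrite !mul0r normr0 mulr0.
rewrite !mul1r /g [leRHS]mulrDr; apply: (le_trans (ler_normD _ _)); rewrite !normrM.
have r0 : 0 <= r := le_trans s0 (ltW sr).
have mono x y : 0 <= x -> x <= y -> 0 <= G y - G x.
  by move=> x0 xy; exact: le_trans (Fd x y x0 xy).
have h1 := mono s r s0 (ltW sr); have h2 := mono r t r0 rt.
apply: lerD.
  rewrite mulrC ler_wpM2r//; apply: (le_trans (Kd r t r0 rt)); move: h1; lra.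
rewrite ler_wpM2r// distrC; apply: (le_trans (Fd s r s0 (ltW sr))); move: h2; lra.
Qed.

Lemma Int_indic_sqr t : 0 <= t -> Int leb1 (fun s => \1_(`[0, t]%classic : set R) s ^+ 2) = t.
Proof.
move=> t0; rewrite -[RHS](Int_indic_segment t0); apply: eq_Int => s.
by rewrite indic_segmentE; case: (_ && _); rewrite ?expr1n ?expr0n.
Qed.

Lemma L2_indic_segment t : L2 leb1 (fun s => \1_(`[0, t]%classic : set R) s).
Proof.
split; first exact: measurable_indic.
apply: eq_L1 (L1_indic_segment t) => s.
by rewrite indic_segmentE; case: (_ && _); rewrite ?expr1n ?expr0n.
Qed.

Lemma primitive_sqr_le (f : R -> R) t : L2 leb1 f -> 0 <= t ->
  primitive f t ^+ 2 <= t * Int leb1 (fun s => f s ^+ 2).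
Proof.
move=> Lf t0; have := Cauchy_Schwarz (L2_indic_segment t) Lf.
by rewrite Int_indic_sqr.
Qed.

Lemma primitive_supported (f : R -> R) (T : R) : (forall s, ~~ (0 < s < T) -> f s = 0) ->
  primitive f T = Int leb1 f.
Proof.
move=> f0; apply: eq_Int => s; rewrite indic_segmentE.
have [|/f0->] := boolP (0 < s < T); last by rewrite mulr0.
by move=> /andP[h1 h2]; rewrite !ltW// mul1r.
Qed.

Lemma ae_ex_itv (a b : R) (P : R -> Prop) : a < b ->
  (\forall t \ae leb1, a < t < b -> P t) -> exists2 t, a < t < b & P t.
Proof.
move=> ab [B [mB B0 PB]]; apply: contrapT => nP.
have AB : `]a, b[%classic `<=` B.
  move=> x; rewrite /= in_itv/= => abx; apply: PB => /= /(_ abx) Px; apply: nP; by exists x.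
have : (lebesgue_measure (`]a, b[%classic : set R) <= 0)%E.
  apply: (@le_trans _ _ (leb1 B)); last by rewrite B0.
  by apply: le_measure; rewrite ?inE.
by rewrite lebesgue_measure_itv/= lte_fin ab -EFinD lee_fin leNgt subr_gt0 ab.
Qed.

End line_integrals.

(** * Space-time R x R^D as R^(D+1) *)

Section spacetime.
Context {R : realType} {D : nat}.
Local Notation vec := 'rV[R]_D.
Local Notation leb1 := (@lebesgue_measure R).
Local Notation mR := (measurableTypeR R).
Local Notation leb := (@lebesgue_row R D).
Local Notation sp := (@spacetime_measure R D).
Local Notation leb' := (@lebesgue_row R D.+1).
Local Notation tens' := (tensor (@row_coord R D.+1)).
Local Notation tenst := (tensor (fun i (p : R * vec) => row_coord i (row_cons p))).

Lemma row_uncons_continuous : continuous (@row_uncons R D).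
Proof.
move=> x A /nbhs_ballP[e /= e0 eA]; apply/nbhs_ballP; exists e => //= y [_ H].
by apply: eA; split => /=; [exact: H|split => // i j; rewrite !mxE; exact: H].
Qed.

Lemma measurable_uncons_comp (f : R * vec -> R) : measurable_fun setT f ->
  measurable_fun setT (fun x => f (row_uncons x)).
Proof. by move=> mf; exact: measurableT_comp mf measurable_row_uncons. Qed.

(** By construction [lebesgue_row D.+1] is the image of the space-time measure under [row_cons], so
    integrals transfer unchanged. *)
Lemma L1_row_uncons (f : R * vec -> R) : L1 sp f -> L1 leb' (fun x => f (row_uncons x)).
Proof.
move=> Lf; have mf := measurable_uncons_comp (L1_measurable Lf).
apply/integrableP; split; first exact/measurable_EFinP.
have /integrableP[_] := Lf; congr (_ < _)%E.
transitivity (\int[lebesgue_row_step leb]_x `|(f (row_uncons x))%:E|)%E; last by [].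
rewrite ge0_integral_pushforward//; first by apply: eq_integral => p _; rewrite /= row_consK.
- exact: measurable_row_cons.
- by apply: measurableT_comp => //; exact/measurable_EFinP.
Qed.

Lemma Int_row_uncons (f : R * vec -> R) : L1 sp f ->
  Int leb' (fun x => f (row_uncons x)) = Int sp f.
Proof.
move=> Lf; have mf := measurable_uncons_comp (L1_measurable Lf).
rewrite /Int /Rintegral; congr fine.
transitivity (\int[lebesgue_row_step leb]_x (f (row_uncons x))%:E)%E; first by [].
have mE : measurable_fun setT (fun x => (f (row_uncons x))%:E) by exact/measurable_EFinP.
have LE : sp.-integrable (row_cons @^-1` setT) ((fun x => (f (row_uncons x))%:E) \o row_cons).
  by apply: eq_L1 Lf => p; rewrite /= row_consK.
have mrc : measurable_fun setT (row_cons : mR * vec -> 'rV[R]_D.+1) := measurable_row_cons.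
have E := integral_pushforward mrc mE LE measurableT.
apply: (etrans E); by apply: eq_integral => p _; rewrite /= row_consK.
Qed.

Lemma ae_row_uncons (P : R * vec -> Prop) : (\forall x \ae leb', P (row_uncons x)) ->
  \forall p \ae sp, P p.
Proof.
move=> [A [mA A0 PA]]; exists (row_cons @^-1` A); split.
- by rewrite -[X in measurable X]setTI; exact: measurable_row_cons.
- exact: A0.
- by move=> p /= Pp; apply: PA => /=; rewrite row_consK.
Qed.

Lemma spacetime_coord i (p v : R * vec) (h : R) :
  row_coord i (row_cons (h *: v + p)) = row_coord i (row_cons p) + h * row_coord i (row_cons v).
Proof.
rewrite /row_coord /row_cons !mxE; case: unliftP => [j|] _ /=; last by rewrite addrC.
by rewrite !mxE addrC.
Qed.

Lemma spacetime_coord_continuous i : continuous (fun p : R * vec => row_coord i (row_cons p)).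
Proof.
move=> p; rewrite /row_coord /row_cons; have [j ->|->] := unliftP ord0 i.
  rewrite (_ : (fun _ => _) = fun p : R * vec => row_coord j p.2).
    exact: (continuous_comp cvg_snd (@row_coord_continuous R D j _)).
  by apply/funext => q; rewrite mxE liftK.
rewrite (_ : (fun _ => _) = fst); first exact: cvg_fst.
by apply/funext => q; rewrite mxE unlift_none.
Qed.

Lemma tenst_tens F (x : 'rV[R]_D.+1) : tenst F (row_uncons x) = tens' F x.
Proof. by rewrite /tensor row_unconsK. Qed.

Lemma tenst_smooth F : (forall i, smooth1 (F i)) -> smooth_tensor (tenst F).
Proof.
move=> sF; apply: tensor_smooth => //; first exact: spacetime_coord_continuous.
by move=> i v; exists (row_coord i (row_cons v)) => p h; exact: spacetime_coord.
Qed.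

Lemma tenst_test_function Q F a b : (forall i, smooth1 (F i)) -> supported a b F ->
  cbox a b `<=` @row_uncons R D @^-1` Q -> test_function Q (tenst F).
Proof.
move=> sF F0 abQ; split; first exact/smooth_tensor_smooth/tenst_smooth.
exists (row_uncons @` cbox a b); split.
- apply: continuous_compact; last exact: cbox_compact.
  exact/continuous_subspaceT/row_uncons_continuous.
- by move=> _ [x xab <-]; exact: abQ.
- move=> p np; rewrite -[p]row_consK tenst_tens; apply: tens_support F0 _ _.
  by move=> xab; apply: np; exists (row_cons p) => //; rewrite row_consK.
Qed.

Lemma tenst_derive F : (forall i, smooth1 (F i)) ->
  'D_(1, 0) (tenst F) = tenst (upd F ord0 (derive1 (F ord0))).
Proof.
move=> sF; apply/funext => x.
suff H : is_derive x (1, 0) (tenst F) (tenst (upd F ord0 (derive1 (F ord0))) x) by exact: derive_val.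
apply: tensor_derive => // i p h; rewrite spacetime_coord; congr (_ + _ * _).
by rewrite /row_coord mxE; case: unliftP => [k ->|->] /=; rewrite ?mxE.
Qed.

Section cylinder.
Variables (T : R) (Omega : set vec).
Hypothesis oO : open Omega.
Local Notation Q := (cylinder T Omega).

Lemma measurable_cylinder : measurable (Q : set (mR * vec)).
Proof. by apply: measurableX => //; exact: open_row_measurable. Qed.

Lemma open_uncons_cylinder : open (@row_uncons R D @^-1` Q).
Proof.
apply: open_comp => [x _|]; first exact: row_uncons_continuous.
rewrite openE => -[t x] [/= Ht Ox]; exists (`]0, T[%classic, Omega) => //; split => /=.
  by apply: open_nbhs_nbhs; split => //; exact: interval_open.
by apply: open_nbhs_nbhs.
Qed.

Lemma integrable_cylinder (f : R * vec -> R) :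
  sp.-integrable Q (fun p => (f p)%:E) <-> L1 sp (f \_ Q).
Proof. exact: (integrable_L1 sp f measurable_cylinder). Qed.

Lemma weak_dt_Int (f g : R -> vec -> R) phi : weak_dt T Omega f g ->
  test_function Q phi ->
  [/\ L1 sp (fun p => ((fun p => f p.1 p.2) \_ Q) p * 'D_(1, 0) phi p),
      L1 sp (fun p => ((fun p => g p.1 p.2) \_ Q) p * phi p) &
      Int sp (fun p => ((fun p => f p.1 p.2) \_ Q) p * 'D_(1, 0) phi p) =
      - Int sp (fun p => ((fun p => g p.1 p.2) \_ Q) p * phi p)].
Proof.
move=> H tphi; have [/integrable_cylinder + /integrable_cylinder] := H _ tphi.
by rewrite !Rintegral_Int !patchMl.
Qed.

Lemma weak_dtB (f1 f2 g1 g2 : R -> vec -> R) : weak_dt T Omega f1 g1 ->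
  weak_dt T Omega f2 g2 ->
  weak_dt T Omega (fun t x => f1 t x - f2 t x) (fun t x => g1 t x - g2 t x).
Proof.
move=> H1 H2 phi tphi; have [Lf1 Lg1 E1] := weak_dt_Int H1 tphi.
have [Lf2 Lg2 E2] := weak_dt_Int H2 tphi.
have EB (u v w : R * vec -> R) : ((fun p => (u p - v p) * w p) \_ Q) =
    fun p => (u \_ Q) p * w p - (v \_ Q) p * w p.
  by apply/funext => p; rewrite !patchE; case: ifP => _; rewrite ?mulrBl// !mul0r subrr.
split.
- by apply/integrable_cylinder; rewrite EB; exact: L1B.
- by apply/integrable_cylinder; rewrite EB; exact: L1B.
- by rewrite !Rintegral_Int !EB !IntB// E1 E2 opprB opprK addrC.
Qed.

Lemma weak_dt_weak_partial (f g : R -> vec -> R) : weak_dt T Omega f g ->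
  L1 sp ((fun p => f p.1 p.2) \_ Q) -> L1 sp ((fun p => g p.1 p.2) \_ Q) ->
  weak_partial (@row_uncons R D @^-1` Q)
    (fun x => ((fun p => f p.1 p.2) \_ Q) (row_uncons x))
    (fun x => ((fun p => g p.1 p.2) \_ Q) (row_uncons x)) ord0.
Proof.
move=> H Lf Lg F a b sF F0 abQ.
have [L L' E] := weak_dt_Int H (tenst_test_function sF F0 abQ).
rewrite -(Int_row_uncons L) -(Int_row_uncons L') in E.
apply: etrans (etrans _ E) _.
  by apply: eq_Int => x; rewrite -tenst_tens; congr *%R; rewrite -(tenst_derive sF).
by congr (- _); apply: eq_Int => x; rewrite tenst_tens.
Qed.

(** Only the products of g and h with test functions are known to be integrable. Near each point g -
    h is therefore multiplied by a positive bump G, which is absorbed into the test function and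
    divided out at the end. The lemma identifies the time derivative of b in the weak formulation
    with the square-integrable one of the regularity class. *)
Lemma weak_dt_unique (f g h : R -> vec -> R) : weak_dt T Omega f g ->
  weak_dt T Omega f h -> \forall p \ae sp, Q p -> g p.1 p.2 = h p.1 p.2.
Proof.
move=> Hg Hh.
suff : \forall x \ae leb', (@row_uncons R D @^-1` Q) x ->
    g (row_uncons x).1 (row_uncons x).2 = h (row_uncons x).1 (row_uncons x).2.
  by move=> H; exact: (ae_row_uncons (P := fun p => Q p -> g p.1 p.2 = h p.1 p.2)).
have H0 := weak_dtB Hg Hh.
have {H0} Z phi : test_function Q phi ->
    L1 sp (fun p => ((fun p => g p.1 p.2 - h p.1 p.2) \_ Q) p * phi p) /\
    Int sp (fun p => ((fun p => g p.1 p.2 - h p.1 p.2) \_ Q) p * phi p) = 0.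
  move=> tphi; have [_ L E] := weak_dt_Int H0 tphi; split => //.
  apply/eqP; rewrite -oppr_eq0 -E; apply/eqP; rewrite -[RHS](@Int0 _ _ _ sp); apply: eq_Int => p.
  by rewrite patchE; case: ifP => _; rewrite ?subrr mul0r.
apply: ae_local => p Up.
have /nbhs_ballP[r0 /= r00 pr] := open_nbhs_nbhs (conj open_uncons_cylinder Up).
have r20 : 0 < r0 / 2 by rewrite divr_gt0.
exists (r0 / 2) => //.
pose l i := p ord0 i - r0 / 2; pose u i := p ord0 i + r0 / 2.
have lu : cbox l u `<=` @row_uncons R D @^-1` Q.
  move=> x Hx; apply: pr; rewrite ballE// => i; have /andP[] := Hx i.
  by rewrite /l /u; lra.
pose G i := bump 1 (l i) (u i).
have sG i : smooth1 (G i) by exact: smooth1_bump.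
have G0 : supported l u G.
  move=> i x /negP xab; apply: bump_out => //; apply/negP => /andP[h1 h2].
  by apply: xab; rewrite !ltW.
have [L1w _] := Z _ (tenst_test_function sG G0 lu).
have H : forall a' b', (forall i, l i <= a' i /\ b' i <= u i) -> forall k : nat,
    Int leb' (fun x => ((fun p => g p.1 p.2 - h p.1 p.2) \_ Q) (row_uncons x) *
      tenst G (row_uncons x) * tens' (fun i => bump k.+1%:R (a' i) (b' i)) x) = 0.
  move=> a' b' ab k.
  pose F i := bump k.+1%:R (a' i) (b' i).
  have sF i : smooth1 (fun x => G i x * F i x) by apply: smooth1_mul => //; exact: smooth1_bump.
  have F0 : supported l u (fun i x => G i x * F i x) by move=> i x /G0 ->; rewrite mul0r.
  have [L E] := Z _ (tenst_test_function sF F0 lu).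
  rewrite -E -(Int_row_uncons L); apply: eq_Int => x.
  by rewrite !tenst_tens -mulrA; congr *%R; rewrite /tensor -big_split.
have := fundamental_lemma (L1_row_uncons L1w) H.
apply: filterS => x Hx; rewrite (ballE _ r20) => xb.
have Qx : Q (row_uncons x) by apply: lu => i; have /andP[h1 h2] := xb i; rewrite !ltW.
have := Hx xb; rewrite patchE mem_set// tenst_tens => /eqP; rewrite mulf_eq0 => /orP[|].
  by rewrite subr_eq0 => /eqP.
rewrite prodf_seq_eq0 => /hasP[i _] /=; rewrite gt_eqF// bump_gt0//; exact: xb.
Qed.

End cylinder.

End spacetime.

(** * Functions with a square-integrable time derivative *)

Lemma quarters_le {R : realFieldType} (x y e : R) :
  x <= e / 4 -> y <= e / 4 -> 2 * x + 2 * y <= e.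
Proof. lra. Qed.

Section time_primitives.
Context {R : realType} {D : nat}.
Local Notation vec := 'rV[R]_D.
Local Notation leb1 := (@lebesgue_measure R).
Local Notation mR := (measurableTypeR R).
Local Notation leb := (@lebesgue_row R D).
Local Notation sp := (@spacetime_measure R D).

Lemma primitive_diff_sqr_le (f : R -> R) s t : L1 leb1 f -> L2 leb1 f -> 0 <= s -> s <= t ->
  (primitive f t - primitive f s) ^+ 2 <= (t - s) * Int leb1 (fun r => f r ^+ 2).
Proof.
move=> Lf L2f s0 st; rewrite primitive_diff//.
have sqE (r : R) : \1_(`]s, t]%classic : set R) r ^+ 2 = \1_(`]s, t]%classic : set R) r :> R.
  by rewrite indicE; case: (_ \in _); rewrite ?expr1n ?expr0n.
have Lst : L1 leb1 (fun r => \1_(`]s, t]%classic : set R) r).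
  by apply: L1_indicator; [exact: measurable_itv|exact: lebesgue_itv_lty].
have <- : Int leb1 (fun r => \1_(`]s, t]%classic : set R) r ^+ 2) = t - s.
  transitivity (fine (lebesgue_measure (`]s, t]%classic : set R))).
    apply: etrans (Int_indicator leb1 (measurable_itv `]s, t])).
    by apply: eq_Int => r; exact: sqE.
  rewrite lebesgue_measure_itv/= lte_fin; move: st; rewrite le_eqVlt => /predU1P[->|st].
    by rewrite ltxx subrr.
  by rewrite st -EFinD.
apply: Cauchy_Schwarz => //; split; first exact: measurable_indic.
by apply: eq_L1 Lst => r; rewrite sqE.
Qed.

Lemma L2_fubini2 (f : R * vec -> R) : L2 sp f ->
  \forall x \ae leb, L2 leb1 (fun s => f (s, x)).
Proof.
move=> [mf Lf]; apply: filterS (L1_fubini2 Lf) => x Lx; split => //.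
exact: measurableT_comp mf (measurable_pair2 x).
Qed.

Lemma L2_fubini1 (f : R * vec -> R) : L2 sp f ->
  \forall t \ae leb1, L2 leb (fun x => f (t, x)).
Proof.
move=> [mf Lf]; apply: filterS (L1_fubini1 Lf) => x Lx; split => //.
exact: measurableT_comp mf (measurable_pair1 x).
Qed.

Lemma measurable_primitive_at (f : R * vec -> R) t : measurable_fun setT f ->
  measurable_fun setT (fun x => primitive (fun s => f (s, x)) t).
Proof.
by move=> mf; exact: measurableT_comp (measurable_primitive2 mf) (measurable_pair1 t).
Qed.

Lemma primitive_L2_diff (f : R * vec -> R) s t : L1 sp f -> L2 sp f -> 0 <= s -> s <= t ->
  L2 leb (fun x => primitive (fun r => f (r, x)) t - primitive (fun r => f (r, x)) s) /\
  Int leb (fun x => (primitive (fun r => f (r, x)) t - primitive (fun r => f (r, x)) s) ^+ 2)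
    <= (t - s) * Int sp (fun p => f p ^+ 2).
Proof.
move=> Lf L2f s0 st; have mf := L1_measurable Lf.
pose P x := primitive (fun r => f (r, x)) t - primitive (fun r => f (r, x)) s; rewrite -/P.
have mP : measurable_fun setT P by apply: measurable_funB; exact: measurable_primitive_at.
pose G x := (t - s) * Int leb1 (fun r => f (r, x) ^+ 2).
have LG : L1 leb G by apply: L1Z; exact: L1_Int2 L2f.2.
have PG : \forall x \ae leb, P x ^+ 2 <= G x.
  apply: filterS2 (L1_fubini2 Lf) (L2_fubini2 L2f) => x Lx L2x.
  exact: primitive_diff_sqr_le.
have mP2 : measurable_fun setT (fun x => P x ^+ 2) by exact: measurable_funX.
have LP : L1 leb (fun x => P x ^+ 2).
  by apply: (L1_ae_le mP2 LG); apply: filterS PG => x; rewrite ger0_norm ?sqr_ge0.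
split => //; apply: (le_trans (Int_ae_le LP LG PG)).
by rewrite /G IntZ ?(Int_fubini2 L2f.2)//; exact: L1_Int2 L2f.2.
Qed.

Lemma primitive_L2 (f : R * vec -> R) t : L1 sp f -> L2 sp f -> 0 <= t ->
  L2 leb (fun x => primitive (fun r => f (r, x)) t).
Proof.
move=> Lf L2f t0; have [H _] := primitive_L2_diff Lf L2f (lexx 0) t0.
by congr (L2 leb _): H; apply/funext => x; rewrite primitive0 subr0.
Qed.

Definition L2_continuous (T : R) (f : R -> vec -> R) := forall e : R, 0 < e ->
  exists2 d : R, 0 < d & forall s t, 0 <= s <= T -> 0 <= t <= T -> `|s - t| <= d ->
    Int leb (fun x => (f s x - f t x) ^+ 2) <= e.

Lemma primitive_L2_continuous (T : R) (f : R * vec -> R) : L1 sp f -> L2 sp f ->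
  L2_continuous T (fun t x => primitive (fun r => f (r, x)) t).
Proof.
move=> Lf L2f e e0; pose K := Int sp (fun p => f p ^+ 2).
have K0 : 0 <= K by apply: Int_ge0 => p; rewrite sqr_ge0.
have dK : e / (K + 1) * K <= e by rewrite mulrAC ler_pdivrMr ?ltr_wpDl// ler_wpM2l ?lerDl// ltW.
exists (e / (K + 1)) => [|s t /andP[s0 _] /andP[t0 _] st]; first by rewrite divr_gt0// ltr_wpDl.
apply: le_trans dK; have [ts|/ltW ts] := leP t s.
  apply: (le_trans (primitive_L2_diff Lf L2f t0 ts).2); rewrite ler_wpM2r//.
  exact: le_trans (ler_norm _) st.
have := (primitive_L2_diff Lf L2f s0 ts).2.
under eq_Int do rewrite -sqrrN opprB.
move=> H; apply: (le_trans H); rewrite ler_wpM2r//.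
by rewrite distrC in st; exact: le_trans (ler_norm _) st.
Qed.

Lemma L2_continuousB (T : R) (f g : R -> vec -> R) :
  (forall t, 0 <= t <= T -> L2 leb (f t)) -> (forall t, 0 <= t <= T -> L2 leb (g t)) ->
  L2_continuous T f -> L2_continuous T g ->
  L2_continuous T (fun t x => f t x - g t x).
Proof.
move=> Lf Lg cf cg e e0; have e40 : 0 < e / 4 by rewrite divr_gt0.
have [d d0 Hd] := cf _ e40; have [d' d'0 Hd'] := cg _ e40.
exists (Num.min d d') => [|s t sT tT]; first by rewrite lt_min d0.
rewrite le_min => /andP[sd sd'].
have L1' := L2B (Lf s sT) (Lf t tT); have L2' := L2B (Lg t tT) (Lg s sT).
apply: (@le_trans _ _ (Int leb (fun x => ((f s x - f t x) + (g t x - g s x)) ^+ 2))).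
  by rewrite le_eqVlt; apply/orP; left; apply/eqP/eq_Int => x; ring.
apply: (le_trans (Int_sqr_add L1' L2')).
have h1 := Hd s t sT tT sd; have h2 := Hd' t s tT sT; rewrite distrC in h2.
by have := h2 sd'; lra.
Qed.

Lemma hoelder_L2_continuous (T : R) (Omega : set vec) (f : R -> vec -> R) :
  measurable Omega -> hoelder_L2 4^-1 T Omega f ->
  (forall t, 0 <= t <= T -> L2 leb ((f t) \_ Omega)) /\
  L2_continuous T (fun t => (f t) \_ Omega).
Proof.
move=> mO [Lf [K HK]].
have L2f t : 0 <= t <= T -> L2 leb ((f t) \_ Omega) by move=> /Lf/(in_L2P leb _ mO).
(* For |s - t| <= r^4 the Hoelder bound is at most |K| r <= sqrt e; the added 1 keeps the
   denominator positive. *)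
split => // e e0; pose r := Num.sqrt e / (`|K| + 1).
have K1 : 0 < `|K| + 1 by rewrite ltr_wpDl.
have r0 : 0 < r by rewrite divr_gt0// sqrtr_gt0.
exists (r ^+ 4) => [|s t sT tT st]; first exact: exprn_gt0.
have E : Int leb (fun x => (((f s) \_ Omega) x - ((f t) \_ Omega) x) ^+ 2) =
    L2_norm Omega (fun x => f s x - f t x) ^+ 2.
  rewrite /L2_norm sqr_sqrtr; last first.
    rewrite Rintegral_Int; apply: Int_ge0 => x; rewrite patchE.
    by case: ifP => _; rewrite ?sqr_ge0.
  rewrite Rintegral_Int; apply: eq_Int => x; rewrite !patchE.
  by case: ifP => _; rewrite ?subrr ?expr0n.
rewrite E; have N0 : 0 <= L2_norm Omega (fun x => f s x - f t x) by exact: sqrtr_ge0.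
apply: (@le_trans _ _ (Num.sqrt e ^+ 2)); last by rewrite (sqr_sqrtr (ltW e0)).
apply: lerXn2r; rewrite ?nnegrE ?sqrtr_ge0//.
apply: (le_trans (HK s t sT tT)).
have P : `|s - t| `^ 4^-1 <= r.
  have E4 : (r ^+ 4) `^ 4^-1 = r.
    by rewrite -powR_mulrn ?(ltW r0)// -powRrM mulfV// powRr1// ltW.
  rewrite -E4; apply: ge0_ler_powR => //; rewrite ?nnegrE// ?exprn_ge0// ltW//.
apply: (@le_trans _ _ (`|K| * r)); last first.
  by rewrite /r mulrA ler_pdivrMr// mulrC ler_wpM2l ?sqrtr_ge0// lerDl.
by apply: (le_trans (ler_wpM2r (powR_ge0 _ _) (ler_norm K))); rewrite ler_wpM2l.
Qed.

Section time_representation.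
Variables (T : R) (Omega : set vec).
Hypotheses (T0 : 0 < T) (oO : open Omega).
Local Notation Q := (cylinder T Omega).

Lemma patch_cylinder (f : R -> vec -> R) t x : 0 < t < T ->
  ((fun p => f p.1 p.2) \_ Q) (t, x) = ((f t) \_ Omega) x.
Proof.
move=> tT; rewrite !patchE; suff -> : ((t, x) \in Q) = (x \in Omega) by [].
apply/idP/idP => /set_mem H; apply/mem_set; first by case: H.
by split => //=; rewrite in_itv.
Qed.

Lemma patch_cylinder_out (f : R * vec -> R) t x : ~~ (0 < t < T) -> (f \_ Q) (t, x) = 0.
Proof.
move=> /negP tT; rewrite patchE memNset// => -[] /=.
by rewrite in_itv.
Qed.

(** The difference formula in direction 0 of R^(D+1), sliced by Fubini into almost every t and then
    almost every x. The margin T - h keeps t + h inside the time interval. *)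
Lemma weak_dt_increment (f g : R -> vec -> R) h : weak_dt T Omega f g ->
  L1 sp ((fun p => f p.1 p.2) \_ Q) -> L1 sp ((fun p => g p.1 p.2) \_ Q) -> 0 <= h ->
  \forall t \ae leb1, 0 < t < T - h -> \forall x \ae leb,
    ((f (t + h)) \_ Omega) x - ((f t) \_ Omega) x =
    primitive (fun s => ((fun p => g p.1 p.2) \_ Q) (s, x)) (t + h) -
    primitive (fun s => ((fun p => g p.1 p.2) \_ Q) (s, x)) t.
Proof.
move=> H Lf Lg h0; pose f' := (fun p => f p.1 p.2) \_ Q; pose g' := (fun p => g p.1 p.2) \_ Q.
have WP := weak_dt_weak_partial oO H Lf Lg.
have ee0 (x : 'rV[R]_D.+1) (s : R) :
    row_uncons (x + s *: (delta_mx ord0 ord0 : 'rV[R]_D.+1)) =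
    ((row_uncons x).1 + s, (row_uncons x).2).
  rewrite /row_uncons !mxE/= mulr1; congr pair; apply/rowP => j; rewrite !mxE/=.
  by rewrite mulr0 addr0.
suff A : \forall x \ae lebesgue_row D.+1,
    (@row_uncons R D @^-1` [set p | 0 < p.1 < T - h /\ Omega p.2]) x ->
    f' ((row_uncons x).1 + h, (row_uncons x).2) - f' (row_uncons x) =
    primitive (fun s => g' ((row_uncons x).1 + s, (row_uncons x).2)) h.
  have /ae_fubini1 := @ae_row_uncons R D (fun p => 0 < p.1 < T - h /\ Omega p.2 ->
    f' (p.1 + h, p.2) - f' p = primitive (fun s => g' (p.1 + s, p.2)) h) A.
  apply: filterS => t Ht /[dup] tT /andP[t0 th]; apply: filterS2 Ht (L1_fubini2 Lg) => x Hx Lx.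
  have thT : 0 < t + h < T by move: h0 t0 th; lra.
  have t0T : 0 < t < T by move: h0 t0 th; lra.
  rewrite -(primitive_shift Lx (ltW t0) h0).
  have [Ox|Ox] := pselect (Omega x).
    by rewrite -!patch_cylinder//; apply: Hx.
  rewrite !patchE memNset// subrr -[LHS](@Int0 _ _ _ leb1); apply: eq_Int => s.
  by rewrite patchE memNset ?mulr0// => -[].
pose U : set 'rV[R]_D.+1 := @row_uncons R D @^-1` [set p | 0 < p.1 < T - h /\ Omega p.2].
have oU : open U.
  rewrite (_ : U = @row_uncons R D @^-1` cylinder (T - h) Omega).
    exact: open_uncons_cylinder.
  by apply/seteqP; split => x; rewrite /cylinder /U /= in_itv.
apply: ae_local => p Up.
have /nbhs_ballP[r0 /= r00 pr] := open_nbhs_nbhs (conj oU Up).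
have r20 : 0 < r0 / 2 by rewrite divr_gt0.
exists (r0 / 2) => //.
pose l i := p ord0 i - r0 / 2; pose u i := p ord0 i + r0 / 2.
have lu : cbox l u `<=` U.
  move=> x Hx; apply: pr; rewrite ballE// => i; have /andP[] := Hx i.
  by rewrite /l /u; lra.
(* Time now ranges over [[l 0, u 0 + h]]; since both l 0 and u 0 lie in ]0, T - h[, the enlarged box
   remains in the cylinder. *)
have luQ : cbox l (fun i => u i + h * (i == ord0)%:R) `<=` @row_uncons R D @^-1` Q.
  move=> x Hx.
  have point c : l ord0 <= c <= u ord0 -> 0 < c < T - h /\ Omega (row_uncons x).2.
    move=> Hc; suff : U (row_cons (c, (row_uncons x).2)).
      by rewrite /U /preimage /mkset row_consK.
    apply: lu => i; rewrite /row_cons !mxE; case: unliftP => [j ->|->] //=.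
    by rewrite mxE; have := Hx (lift ord0 j); rewrite mulr0 addr0.
  have /point : l ord0 <= l ord0 <= u ord0 by rewrite /l /u; lra.
  have /point : l ord0 <= u ord0 <= u ord0 by rewrite /l /u; lra.
  move=> -[h1 Ox] [h2 _].
  have := Hx ord0; rewrite eqxx mulr1 => h3.
  by split => //=; rewrite in_itv/=; move: h1 h2 h3; lra.
have := difference_formula (L1_row_uncons Lf) (L1_row_uncons Lg) WP h0 luQ.
apply: filterS => x Hx; rewrite (ballE _ r20) => xb.
have := Hx xb; rewrite ee0 => E; apply: etrans E _.
by apply: eq_Int => s; rewrite ee0.
Qed.

(* W = f - P has W (s + h) = W s for almost every s; take s near 0 and s + h
   near t and use the continuity of W in L2. *)
Lemma weak_dt_primitive (f g : R -> vec -> R) : (leb Omega < +oo)%E ->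
  weak_dt T Omega f g ->
  L1 sp ((fun p => f p.1 p.2) \_ Q) -> L1 sp ((fun p => g p.1 p.2) \_ Q) ->
  L2 sp ((fun p => g p.1 p.2) \_ Q) ->
  (forall t, 0 <= t <= T -> L2 leb ((f t) \_ Omega)) ->
  L2_continuous T (fun t => (f t) \_ Omega) ->
  (\forall x \ae leb, ((f 0) \_ Omega) x = 0) ->
  forall t, 0 <= t <= T -> \forall x \ae leb,
    ((f t) \_ Omega) x = primitive (fun s => ((fun p => g p.1 p.2) \_ Q) (s, x)) t.
Proof.
move=> Ooo H Lf Lg L2g Lft cf f0 t /[dup] tT /andP[]; rewrite le_eqVlt => /predU1P[<- _|t0 tleT].
  by apply: filterS f0 => x ->; rewrite primitive0.
pose P t x := primitive (fun s => ((fun p => g p.1 p.2) \_ Q) (s, x)) t.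
have LP s : 0 <= s <= T -> L2 leb (P s) by move=> /andP[s0 _]; exact: primitive_L2.
pose W s x := ((f s) \_ Omega) x - P s x.
have LW s : 0 <= s <= T -> L2 leb (W s) by move=> sT; apply: L2B; [exact: Lft|exact: LP].
have cW : L2_continuous T W by apply: L2_continuousB => //; exact: primitive_L2_continuous.
have T00 : 0 <= (0 : R) <= T by rewrite lexx ltW.
suff W0 : Int leb (fun x => W t x ^+ 2) = 0.
  have := Int_eq0 (LW _ tT).2 (fun x => sqr_ge0 _) W0.
  by apply: filterS => x /eqP; rewrite sqrf_eq0 subr_eq0 => /eqP.
apply/eqP; rewrite eq_le Int_ge0 ?andbT => [|x]; last exact: sqr_ge0.
apply/ler_addgt0Pr => e e0; rewrite add0r.
have e40 : 0 < e / 4 by rewrite divr_gt0.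
have [d d0 Hd] := cW _ e40.
(* For 0 < s < r, the times s and s + (t - r) are within d of 0 and of t respectively; r <= t / 2
   keeps the increment t - r nonnegative. *)
pose r := Num.min d (t / 2); have r0 : 0 < r by rewrite lt_min d0 divr_gt0.
have rd : r <= d by rewrite ge_min lexx.
have rt : r <= t / 2 by rewrite ge_min lexx orbT.
have h0 : 0 <= t - r by move: t0 rt; lra.
have [s sr Ws] : exists2 s, 0 < s < r & \forall x \ae leb, W (s + (t - r)) x = W s x.
  apply: (@ae_ex_itv R 0 r _ r0).
  apply: ae_mono (weak_dt_increment H Lf Lg h0) => s Hs sr.
  have /Hs : 0 < s < T - (t - r) by move: sr tleT; lra.
  apply: filterS => x; rewrite /W => E; apply/eqP.
  by rewrite subr_eq -addrA [- _ + _]addrC -/(P s x) /P -E addrC subrK.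
have sT : 0 <= s <= T by move: sr rt tleT; lra.
have srT : 0 <= s + (t - r) <= T by move: sr rt tleT; lra.
have n1 : `|t - (s + (t - r))| <= d by rewrite ger0_norm; move: sr rd; lra.
have n2 : `|s - 0| <= d by rewrite ger0_norm; move: sr rd; lra.
have B1 := Hd _ _ tT srT n1; have B2 := Hd _ _ sT T00 n2.
have LA := L2B (LW _ tT) (LW _ srT); have LB := L2B (LW _ sT) (LW _ T00).
(* Since [W (s + (t - r)) = W s] and [W 0 = 0] almost everywhere, W t is the sum of two increments
   between times at distance at most d. *)
apply: (@le_trans _ _ (Int leb (fun x => (W t x - W (s + (t - r)) x + (W s x - W 0 x)) ^+ 2))); last first.
  exact: le_trans (Int_sqr_add LA LB) (quarters_le B1 B2).
rewrite le_eqVlt; apply/orP; left; apply/eqP/esym/Int_ae.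
- exact: measurable_funX (L2_measurable (L2D LA LB)).
- exact: measurable_funX (L2_measurable (LW _ tT)).
apply: filterS2 Ws f0 => x -> E0.
have -> : W 0 x = 0 by rewrite /W E0 /P primitive0 subrr.
by congr (_ ^+ 2); ring.
Qed.

End time_representation.

End time_primitives.

(** * Product test functions *)

Lemma C1_FTC {R : realType} (f g : R -> R) (h : R) : 0 <= h ->
  (forall x : R, is_derive x (1 : R) f (g x)) -> continuous g -> primitive g h = f h - f 0.
Proof.
rewrite le_eqVlt => /predU1P[<-|h0] df cg; first by rewrite primitive0 subrr.
have cf x : {for x, continuous f}.
  by apply: differentiable_continuous; apply/derivable1_diffP; have [] := df x.
rewrite /primitive Int_segment -[RHS]/(fine ((f h)%:E - (f 0)%:E)%E) /Rintegral; congr fine.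
apply: continuous_FTC2 h0 _ _ _.
- exact: continuous_subspaceT.
- split; first by move=> x _; have [] := df x.
    by apply: cvg_at_right_filter; exact: cf.
  by apply: cvg_at_left_filter; exact: cf.
- by move=> x _; rewrite derive1E; exact: derive_val.
Qed.

Lemma tonelli1 {d1 d2} {T1 : measurableType d1} {T2 : measurableType d2} {R : realType}
    (m1 : {sigma_finite_measure set T1 -> \bar R}) (m2 : {sigma_finite_measure set T2 -> \bar R})
    (f : T1 * T2 -> R) : measurable_fun setT f -> (forall p, 0 <= f p) ->
  (\int[m1 \x m2]_p (f p)%:E = \int[m1]_x \int[m2]_y (f (x, y))%:E)%E.
Proof.
move=> mf f0; have mf' : measurable_fun setT (EFin \o f) by exact/measurable_EFinP.
have f0' p : (0 <= (EFin \o f) p)%E by rewrite lee_fin.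
have H := @fubini_tonelli1 _ _ T1 T2 R m1 m2 (EFin \o f) mf' f0'; exact: H.
Qed.

Lemma pair_continuous {R : realType} {V : normedModType R} (x : V) :
  continuous (fun s : R => (s, x)).
Proof.
move=> s A /nbhs_ballP[e /= e0 eA]; apply/nbhs_ballP; exists e => //= z Bz.
by apply: eA; split => //=; exact: ballxx.
Qed.

Lemma patch_sqr {R : realType} {X : Type} (A : set X) (f : X -> R) x :
  ((fun y => f y ^+ 2) \_ A) x = (f \_ A) x ^+ 2.
Proof. by rewrite !patchE; case: ifP => // _; rewrite expr0n. Qed.

Section spacetime_tests.
Context {R : realType} {D : nat}.
Local Notation vec := 'rV[R]_D.
Local Notation leb1 := (@lebesgue_measure R).
Local Notation mR := (measurableTypeR R).
Local Notation leb := (@lebesgue_row R D).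
Local Notation sp := (@spacetime_measure R D).
Variables (T : R) (Omega : set vec).
Hypotheses (T0 : 0 < T) (oO : open Omega) (Ooo : (leb Omega < +oo)%E).
Local Notation Q := (cylinder T Omega).

Let mO : measurable Omega. Proof. exact: open_row_measurable. Qed.
Let mQ : measurable (Q : set (mR * vec)). Proof. exact: measurable_cylinder. Qed.

Lemma continuous_spacetime_measurable (phi : R * vec -> R) : continuous phi ->
  measurable_fun setT (phi : mR * vec -> R).
Proof.
move=> cphi.
have m' : measurable_fun setT (fun x => phi (@row_uncons R D x)).
  apply: continuous_row_measurable => x.
  by apply: continuous_comp; [exact: row_uncons_continuous|exact: cphi].
have mrc : measurable_fun setT (row_cons : mR * vec -> 'rV[R]_D.+1) := measurable_row_cons.
rewrite (_ : phi = (fun x => phi (@row_uncons R D x)) \o row_cons).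
  exact: measurableT_comp m' mrc.
by apply/funext => p; rewrite /= row_consK.
Qed.

Lemma cylinder_lty : (sp Q < +oo)%E.
Proof.
have mI : measurable (`]0, T[%classic : set mR) by exact: measurable_itv.
have -> : sp Q = (lebesgue_measure (`]0%R, T[%classic : set mR) * leb Omega)%E.
  exact: product_measure1E.
by rewrite lte_mul_pinfty// ge0_fin_numE//; exact: lebesgue_itv_lty.
Qed.

Lemma patch_L2_L1_cylinder (f : R * vec -> R) : L2 sp (f \_ Q) -> L1 sp (f \_ Q).
Proof. by move=> Lf; have := L2_L1 mQ cylinder_lty Lf; rewrite -patch_setI setIid. Qed.

Let mI : measurable (`]0, T[%classic : set R). Proof. exact: measurable_itv. Qed.

Let Ioo : (leb1 `]0%R, T[%classic < +oo)%E. Proof. exact: lebesgue_itv_lty. Qed.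

Lemma patch_supported (r : R -> R) : (forall s, ~~ (0 < s < T) -> r s = 0) ->
  r \_ `]0, T[%classic = r.
Proof.
move=> r0; apply/funext => s; rewrite patchE; case: ifPn => // /negP sT.
by apply/esym/r0/negP => h; apply: sT; rewrite mem_setE in_itv.
Qed.

Lemma supported_L2_L1 (r : R -> R) : L2 leb1 r -> (forall s, ~~ (0 < s < T) -> r s = 0) ->
  L1 leb1 r.
Proof. by move=> Lr r0; have := L2_L1 (mu := leb1) mI Ioo Lr; rewrite patch_supported. Qed.

Lemma bounded_patch_L2 (f : R -> R) (M : R) : measurable_fun setT f ->
  (forall s, `|f s| <= M) -> L2 leb1 (f \_ `]0, T[%classic).
Proof.
move=> mf fM; have m : measurable_fun setT (f \_ `]0, T[%classic).
  by apply: measurable_patch => //; exact: measurable_funS mf.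
split => //; apply: L1_le (L1Z (M ^+ 2) (L1_indicator (mu := leb1) mI Ioo)) => [|s].
  exact: measurable_funX.
rewrite patchE indicE; case: (s \in _); last by rewrite expr0n mulr0.
rewrite mulr1 ger0_norm ?sqr_ge0// ger0_norm ?sqr_ge0//.
by rewrite -[leLHS]real_normK ?num_real// lerXn2r ?nnegrE ?(le_trans _ (fM s)).
Qed.

Lemma L2_tensor (r : R -> R) (w : vec -> R) : L2 leb1 r -> L2 leb w ->
  L2 sp (fun p => r p.1 * w p.2).
Proof.
move=> [mr Lr] [mw Lw]; split.
  by apply: measurable_funM; exact: measurableT_comp.
by apply: eq_L1 (L1_tensor Lr Lw) => p; rewrite exprMn.
Qed.

(** * L2(0, T; H^1) as square-integrability on the cylinder *)

Section energy_space.
Variables (f : R -> vec -> R) (Df : R -> vec -> vec).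
Hypothesis mf : measurable_H1 T Omega f Df.
Let f' := (fun p : R * vec => f p.1 p.2) \_ Q.
Let Df' i := (fun p : R * vec => Df p.1 p.2 ord0 i) \_ Q.
Let E (p : R * vec) : R := f' p ^+ 2 + \sum_i Df' i p ^+ 2.

Let mf' : measurable_fun setT (f' : mR * vec -> R).
Proof. by apply: measurable_patch => //; case: mf. Qed.

Let mDf' i : measurable_fun setT (Df' i : mR * vec -> R).
Proof. by apply: measurable_patch => //; case: mf => _ /(_ i). Qed.

Let mE : measurable_fun setT (E : mR * vec -> R).
Proof.
apply: measurable_funD; first exact: measurable_funX.
by apply: measurable_sum => i; apply: measurable_funX; exact: mDf'.
Qed.

Let E_ge0 p : 0 <= E p.
Proof. by rewrite addr_ge0 ?sqr_ge0// sumr_ge0// => i _; rewrite sqr_ge0. Qed.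

Let H1_sqnormE : (\int[leb1]_(t in `]0%R, T[) H1_sqnorm Omega (f t) (Df t) =
  \int[sp]_p `|(E p)%:E|)%E.
Proof.
have -> : (\int[sp]_p `|(E p)%:E| = \int[sp]_p (E p)%:E)%E.
  by apply: eq_integral => p _; rewrite gee0_abs// lee_fin.
have TE := @tonelli1 _ _ _ _ R (@lebesgue_measure R) leb E mE E_ge0.
apply: (etrans _ (esym TE)).
rewrite integral_mkcond; apply: eq_integral => t _; rewrite patchE.
case: ifPn => [/set_mem|/negP tT]; last first.
  rewrite -[LHS](integral0 leb setT); apply: eq_integral => x _.
  have tT' : ~~ (0 < t < T) by apply/negP => h; apply: tT; rewrite mem_setE in_itv.
  rewrite /E /f' /Df' patch_cylinder_out// big1 ?expr0n ?addr0// => i _.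
  by rewrite patch_cylinder_out// expr0n.
rewrite /= in_itv/= => tT; rewrite /H1_sqnorm integral_mkcond; apply: eq_integral => x _.
rewrite /E /f' patch_cylinder// !patchE.
have -> : \sum_i Df' i (t, x) ^+ 2 = \sum_i ((fun y => Df t y ord0 i) \_ Omega) x ^+ 2.
  apply: eq_bigr => i _; congr (_ ^+ 2).
  exact: (@patch_cylinder R D T Omega (fun t y => Df t y ord0 i)).
case: ifPn => xO.
  by congr (_ + _)%:E; apply: eq_bigr => i _; rewrite patchE xO expr2.
by rewrite expr0n big1 ?addr0// => i _; rewrite patchE (negbTE xO) expr0n.
Qed.

(** By Tonelli the iterated H^1 norm is one space-time integral of E, which dominates the square of
    the function and of each gradient component. *)
Lemma in_L2H1_L2 : in_L2H1 T Omega f Df -> L2 sp f' /\ forall i, L2 sp (Df' i).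
Proof.
move=> [_]; rewrite H1_sqnormE => Eoo.
have LE : L1 sp E by apply/integrableP; split => //; exact/measurable_EFinP.
split=> [|i]; split => //; apply: L1_le (LE) => [|p].
- exact: measurable_funX.
- by rewrite !ger0_norm ?sqr_ge0// lerDl sumr_ge0// => i _; rewrite sqr_ge0.
- exact: measurable_funX.
rewrite !ger0_norm ?sqr_ge0// /E (bigD1 i)//= addrCA lerDl.
by rewrite addr_ge0 ?sqr_ge0// sumr_ge0// => j _; rewrite sqr_ge0.
Qed.

Lemma L2_in_L2H1 : L2 sp f' -> (forall i, L2 sp (Df' i)) -> in_L2H1 T Omega f Df.
Proof.
move=> [_ Lf] LD; split => //; rewrite H1_sqnormE.
have LE : L1 sp E by apply: L1D => //; apply: L1_sum => i _; exact: (LD i).2.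
by have /integrableP[] := LE.
Qed.

End energy_space.

Section product_tests.
Variables (r : R -> R) (v : vec -> R) (Dv : vec -> vec) (M : R).
Hypotheses (Lr : L2 leb1 r) (r0 : forall s, ~~ (0 < s < T) -> r s = 0)
  (Hv : in_H1 Omega v Dv) (vM : forall x, `|v x| <= M).

(* The antiderivative of - r vanishing at T, so that tail_integral t * v x is an
   admissible test function. *)
Definition tail_integral (t : R) : R := primitive r T - primitive r t.

Let L1r : L1 leb1 r. Proof. exact: supported_L2_L1. Qed.

Lemma measurable_tail_integral : measurable_fun setT tail_integral.
Proof.
apply: measurable_funB; first exact: measurable_cst.
exact: measurable_primitive (L1_measurable L1r).
Qed.

Lemma tail_integral_bounded t : `|tail_integral t| <= 2 * Int leb1 (fun s => `|r s|).
Proof.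
apply: (le_trans (ler_normB _ _)); rewrite mulr_natl mulr2n.
by apply: lerD; exact: primitive_bounded L1r.
Qed.

Lemma tail_integral_patch_L2 : L2 leb1 (tail_integral \_ `]0, T[%classic).
Proof.
exact: bounded_patch_L2 measurable_tail_integral tail_integral_bounded.
Qed.

Let Lv : L2 leb (v \_ Omega). Proof. by have [/(in_L2P leb _ mO)] := Hv. Qed.
Let LDv i : L2 leb ((fun x => Dv x ord0 i) \_ Omega).
Proof. by have [_ /(_ i)/(in_L2P leb _ mO)] := Hv. Qed.

Lemma patch_tensor (q : R -> R) (w : vec -> R) :
  (fun p : R * vec => q p.1 * w p.2) \_ Q =
  fun p => (q \_ `]0, T[%classic) p.1 * (w \_ Omega) p.2.
Proof.
apply/funext => -[t x]; rewrite !patchE /=.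
have -> : ((t, x) \in Q) = (t \in `]0, T[%classic) && (x \in Omega).
  apply/idP/idP => [/set_mem[/= h1 h2]|/andP[/set_mem h1 /set_mem h2]].
    by apply/andP; split; exact: mem_set.
  exact: mem_set.
by case: (t \in _); case: (x \in _); rewrite ?mul0r ?mulr0.
Qed.

Lemma measurable_of_patch (f : R * vec -> R) : measurable_fun setT ((f \_ Q) : mR * vec -> R) ->
  measurable_fun (Q : set (mR * vec)) f.
Proof. by move=> m; apply: (measurable_restrictT _ mQ).2. Qed.

Lemma product_in_L2H1 : in_L2H1 T Omega (fun t x => tail_integral t * v x)
  (fun t x => tail_integral t *: Dv x).
Proof.
have E1 := patch_tensor tail_integral v.
have E2 i : (fun p : R * vec => (tail_integral p.1 *: Dv p.2) ord0 i) \_ Q =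
    fun p => (tail_integral \_ `]0, T[%classic) p.1 * ((fun x => Dv x ord0 i) \_ Omega) p.2.
  by rewrite -patch_tensor; congr (_ \_ _); apply/funext => p; rewrite mxE.
have LA := L2_tensor tail_integral_patch_L2 Lv.
have LB i := L2_tensor tail_integral_patch_L2 (LDv i).
apply: L2_in_L2H1; [|by rewrite E1|by move=> i; rewrite E2].
split=> [|i|].
- by apply: measurable_of_patch; rewrite E1; exact: LA.1.
- by apply: measurable_of_patch; rewrite E2; exact: (LB i).1.
(* A scalar multiple c v is obtained from closure under linear combinations as (c - 1) v + v. *)
apply: aeW => t _; have := in_H1_lin (tail_integral t - 1) oO Ooo Hv Hv.
congr in_H1; apply/funext => x; first by rewrite mulrBl mul1r subrK.
by rewrite scalerBl scale1r subrK.
Qed.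

(** For each x, integration by parts in time. The slice phi(., x) is the primitive of its time
    derivative and vanishes at T, which removes the boundary term and the constant [primitive r T]
    of the tail. *)
Lemma product_weak_dt :
  weak_dt T Omega (fun t x => tail_integral t * v x) (fun t x => - r t * v x).
Proof.
move=> phi tphi.
have td := @test_function_derive R (R * vec)%type Q phi (1, 0) tphi.
have [M1 M10 HM1] := test_function_bounded tphi.
have [M2 M20 HM2] := test_function_bounded td.
have mphi := continuous_spacetime_measurable (tphi.1 [::]).1.
have mdphi := continuous_spacetime_measurable (td.1 [::]).1.
pose k := 'D_(1, 0) phi; rewrite -/k in td HM2 mdphi *.
have E1 : (fun p : R * vec => tail_integral p.1 * v p.2 * k p) \_ Q =
    fun p => (tail_integral \_ `]0, T[%classic) p.1 * (v \_ Omega) p.2 * k p.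
  by rewrite patchMl patch_tensor.
have E2 : (fun p : R * vec => - r p.1 * v p.2 * phi p) \_ Q =
    fun p => - (r p.1 * (v \_ Omega) p.2 * phi p).
  rewrite patchMl (patch_tensor (fun s => - r s)).
  apply/funext => p; rewrite -[in RHS](patch_supported r0) !patchE; case: ifP; rewrite ?mulNr// !mul0r oppr0.
  by [].
have LvL1 := patch_L2_L1 mO Ooo Lv.
have Lt : L1 leb1 (tail_integral \_ `]0, T[%classic).
  have := L2_L1 (mu := leb1) mI Ioo tail_integral_patch_L2.
  by rewrite -patch_setI setIid.
have LA := L1_mul_bounded (L1_tensor Lt LvL1) mdphi HM2.
have LB := L1_mul_bounded (L1_tensor L1r LvL1) mphi HM1.
have sup (psi : R * vec -> R) t x : test_function Q psi -> ~~ (0 < t < T) -> psi (t, x) = 0.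
  move=> [_ [K [_ KQ psi0]]] /negP tT; apply: psi0 => /KQ[/=].
  by rewrite in_itv.
split.
- by apply: (integrable_cylinder T oO (fun p : R * vec => tail_integral p.1 * v p.2 * k p)).2; rewrite E1.
- apply: (integrable_cylinder T oO (fun p : R * vec => - r p.1 * v p.2 * phi p)).2.
  by rewrite E2; exact: L1N.
rewrite !Rintegral_Int E1 E2 IntN// opprK (Int_fubini2 LA) (Int_fubini2 LB).
apply: eq_Int => x /=.
have cphi : continuous (fun s : R => phi (s, x)).
  move=> s; apply: (@continuous_comp _ _ _ (fun s : R => (s, x)) phi); last exact: (tphi.1 [::]).1.
  exact: pair_continuous.
have ck : continuous (fun s : R => k (s, x)).
  move=> s; apply: (@continuous_comp _ _ _ (fun s : R => (s, x)) k); last exact: (td.1 [::]).1.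
  exact: pair_continuous.
have dphi (s : R) : is_derive s (1 : R) (fun s => phi (s, x)) (k (s, x)).
  have := is_derive_along ((tphi.1 [::]).2 ((0, x) + s *: (1, 0)) (1, 0)).
  have shE (z : R) : ((0 : R, x) + z *: ((1 : R), (0 : vec))) = (z, x).
    by congr pair; rewrite /= ?scaler0 ?addr0// add0r /GRing.scale/= mulr1.
  by rewrite shE; congr is_derive; apply/funext => z; rewrite shE.
have Pk t : 0 <= t -> primitive (fun s => k (s, x)) t = phi (t, x).
  move=> t0; rewrite (C1_FTC t0 dphi ck) (sup phi 0 x tphi) ?subr0//.
  by rewrite ltxx.
have Lk : L1 leb1 (fun s => k (s, x)).
  apply: eq_L1 (L1_segment T ck) => s; rewrite indic_segmentE.
  have [h|h] := boolP (0 < s < T); last by rewrite (sup k)// mulr0.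
  by have /andP[h1 h2] := h; rewrite !ltW// mul1r.
have LPk : L1 leb1 (fun s => primitive r s * k (s, x)).
  apply: eq_L1 (L1_mul_bounded (M := Int leb1 (fun s => `|r s|)) Lk
    (measurable_primitive (L1_measurable L1r)) _) => [s|s]; first by rewrite mulrC.
  exact: primitive_bounded.
have phiT : phi (T, x) = 0 by rewrite (sup phi)// ltxx andbF.
have key := primitive_mul L1r Lk (ltW T0).
rewrite Pk ?ltW// phiT mulr0 in key.
transitivity ((v \_ Omega) x * Int leb1 (fun s => primitive r T * k (s, x) - primitive r s * k (s, x))).
  rewrite -IntZ.
    apply: eq_Int => s; have [h|h] := boolP (0 < s < T); last by rewrite (sup k)// !mulr0 subrr mulr0.
    have -> : (tail_integral \_ `]0, T[%classic) s = tail_integral s.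
      by rewrite patchE mem_set//= in_itv.
    rewrite /tail_integral; ring.
  by apply: L1B; [exact: L1Z|exact: LPk].
rewrite IntB; [|exact: L1Z|exact: LPk].
rewrite IntZ// -(primitive_supported (T := T)); last by move=> s h; rewrite (sup k).
rewrite Pk ?ltW// phiT mulr0 sub0r.
have {key}key : Int leb1 (fun s => r s * phi (s, x) + primitive r s * k (s, x)) = 0.
  rewrite -(primitive_supported (T := T)); last first.
    by move=> s h; rewrite r0// (sup k)// mul0r mulr0 addr0.
  apply/esym; apply: etrans key _; apply: eq_Int => s; rewrite indic_segmentE.
  have [/andP[h _]|] := boolP (0 <= s <= T); last by rewrite !mul0r.
  by rewrite Pk.
have Lphi : L1 leb1 (fun s => r s * phi (s, x)).
  apply: (L1_mul_bounded (M := M1) L1r) => [|s]; last exact: HM1.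
  exact: measurableT_comp mphi (measurable_pair2 x).
rewrite IntD// in key.
have -> : - Int leb1 (fun s => primitive r s * k (s, x)) = Int leb1 (fun s => r s * phi (s, x)).
  by apply/eqP; rewrite eq_sym -addr_eq0; apply/eqP.
by rewrite -IntZ//; apply: eq_Int => s; ring.
Qed.

Lemma tail_integral_cvg t : 0 <= t <= T ->
  tail_integral s - tail_integral t @[s --> within `[0, T]%classic (nbhs t)] --> (0 : R).
Proof.
move=> tT; have /subspace_continuousP := primitive_continuous L1r (ltW T0).
move=> /(_ t); rewrite /= in_itv/= => /(_ tT) ct.
rewrite (_ : (fun _ => _) = fun s => primitive r t - primitive r s); last first.
  by apply/funext => s; rewrite /tail_integral; ring.
rewrite -[X in _ --> X](subrr (primitive r t)).
by apply: cvgB; [exact: cvg_cst|exact: ct].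
Qed.

Lemma product_continuous_L2 : continuous_L2 T Omega (fun t x => tail_integral t * v x).
Proof.
have patchZ c : (fun x => c * v x) \_ Omega = fun x => c * (v \_ Omega) x.
  by apply/funext => x; rewrite !patchE; case: ifP; rewrite ?mulr0.
split=> t tT; first by apply/(in_L2P leb _ mO); rewrite patchZ; exact: L2Z.
pose N := Num.sqrt (Int leb (fun x => (v \_ Omega) x ^+ 2)).
rewrite (_ : (fun s => _) = fun s => `|tail_integral s - tail_integral t| * N); last first.
  apply/funext => s; rewrite /L2_norm Rintegral_Int.
  transitivity (Num.sqrt (Int leb (fun x => (tail_integral s - tail_integral t) ^+ 2 * (v \_ Omega) x ^+ 2))).
    congr (Num.sqrt _); apply: eq_Int => x; rewrite patch_sqr -exprMn; congr (_ ^+ 2).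
    by rewrite !patchE; case: ifP => _; rewrite ?mulr0//; ring.
  by rewrite IntZ; [rewrite sqrtrM ?sqr_ge0// sqrtr_sqr|exact: Lv.2].
rewrite -[X in _ --> X](mul0r N); apply: cvgM; last exact: cvg_cst.
by rewrite -[X in _ --> X](normr0 R); apply: cvg_norm; exact: tail_integral_cvg.
Qed.

Lemma product_admissible : admissible_test_T T Omega (fun t x => tail_integral t * v x)
  (fun t x => - r t * v x) (fun t x => tail_integral t *: Dv x).
Proof.
split.
- split; first exact: product_in_L2H1.
  exists (2 * Int leb1 (fun s => `|r s|) * M); apply: aeW => p _; rewrite normrM.
  by apply: ler_pM => //; exact: tail_integral_bounded.
- apply/(in_L2P sp _ mQ); rewrite (patch_tensor (fun s => - r s)).
  apply: L2_tensor => //; apply: (L2_ae _ (L2N Lr)); last first.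
    apply: aeW => s; rewrite -[in RHS](patch_supported r0) !patchE; case: ifP => _ //.
    by rewrite oppr0.
  by apply: measurable_patch => //; apply: measurable_funS (L2N Lr).1.
- exact: product_weak_dt.
- exact: product_continuous_L2.
- by apply: aeW => x _; rewrite /tail_integral subrr mul0r.
Qed.

End product_tests.

End spacetime_tests.

(** * The time-integrated mass balance *)

Lemma cvg_sum_seq {R : realType} (I : Type) (s : seq I) (u : nat -> I -> R) (l : I -> R) :
  (forall i, u k i @[k --> \oo] --> l i) ->
  \sum_(i <- s) u k i @[k --> \oo] --> \sum_(i <- s) l i.
Proof.
move=> H; elim: s => [|i s IH].
  by rewrite big_nil; under eq_fun do rewrite big_nil; exact: cvg_cst.
by rewrite big_cons; under eq_fun do rewrite big_cons; exact: cvgD.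
Qed.

Section pairings.
Context {R : realType} {D : nat}.
Local Notation vec := 'rV[R]_D.
Local Notation leb1 := (@lebesgue_measure R).
Local Notation mR := (measurableTypeR R).
Local Notation leb := (@lebesgue_row R D).
Local Notation sp := (@spacetime_measure R D).

Lemma L2_pairing (f : R * vec -> R) (w : vec -> R) : L2 sp f -> L2 leb w ->
  L2 leb1 (fun t => Int leb (fun x => f (t, x) * w x)).
Proof.
move=> Lf Lw; have [mf Lf2] := Lf; have [mw Lw2] := Lw.
have mfw : measurable_fun setT (fun p : mR * vec => f p * w p.2).
  by apply: measurable_funM => //; exact: measurableT_comp mw measurable_snd.
have mG := measurable_Int1 leb mfw.
split => //; apply: (@L1_ae_le _ _ _ leb1 _
    (fun t => Int leb (fun x => w x ^+ 2) * Int leb (fun x => f (t, x) ^+ 2))).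
- exact: measurable_funX.
- by apply: L1Z; exact: L1_Int1 Lf2.
apply: ae_mono (L2_fubini1 Lf) => t Lft; rewrite ger0_norm ?sqr_ge0// mulrC.
exact: Cauchy_Schwarz.
Qed.

Lemma L1_pairing (f : R * vec -> R) (r : R -> R) (w : vec -> R) : L2 sp f -> L2 leb1 r ->
  L2 leb w -> L1 sp (fun p => f p * (r p.1 * w p.2)).
Proof. by move=> Lf Lr Lw; apply: L2M => //; exact: L2_tensor. Qed.

Lemma Int_pairing (f : R * vec -> R) (r : R -> R) (w : vec -> R) : L2 sp f -> L2 leb1 r ->
  L2 leb w -> Int sp (fun p => f p * (r p.1 * w p.2)) =
  Int leb1 (fun t => r t * Int leb (fun x => f (t, x) * w x)).
Proof.
move=> Lf Lr Lw; apply: (etrans (Int_fubini1 (L1_pairing Lf Lr Lw))).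
apply: Int_ae.
- have m := measurable_Int1 leb (L1_measurable (L1_pairing Lf Lr Lw)); exact: m.
- by apply: measurable_funM; [exact: Lr.1|exact: (L2_pairing Lf Lw).1].
apply: ae_mono (L2_fubini1 Lf) => t Lft.
by rewrite -IntZ; [apply: eq_Int => x /=; ring|exact: L2M].
Qed.

Lemma primitive_pairing (f : R * vec -> R) (w : vec -> R) t : L2 sp f -> L2 leb w -> 0 <= t ->
  primitive (fun s => Int leb (fun x => f (s, x) * w x)) t =
  Int leb (fun x => primitive (fun s => f (s, x)) t * w x).
Proof.
move=> Lf Lw t0.
have Lfw := L1_pairing Lf (L2_indic_segment t) Lw.
rewrite /primitive -(Int_pairing Lf (L2_indic_segment t) Lw) (Int_fubini2 Lfw).
apply: Int_ae.
- have m := measurable_Int2 (@lebesgue_measure R) (L1_measurable Lfw); exact: m.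
- apply: measurable_funM; last exact: Lw.1.
  exact: measurable_primitive_at Lf.1.
apply: ae_mono (L2_fubini2 Lf) => x Lfx.
rewrite mulrC -IntZ; first by apply: eq_Int => s /=; ring.
exact: L2M (L2_indic_segment t) Lfx.
Qed.

(** Integration by parts in time without boundary terms, as the tail of r vanishes at T and the
    primitive of h at 0. It moves the antiderivative from the test function to the data. *)
Lemma tail_integral_pairing (T : R) (r h : R -> R) : 0 < T -> L2 leb1 r -> L2 leb1 h ->
  (forall s, ~~ (0 < s < T) -> r s = 0) -> (forall s, ~~ (0 < s < T) -> h s = 0) ->
  Int leb1 (fun t => (tail_integral T r \_ `]0, T[%classic) t * h t) =
  Int leb1 (fun t => r t * primitive h t).
Proof.
move=> T0 L2r L2h r0 h0; have Lr := supported_L2_L1 L2r r0; have Lh := supported_L2_L1 L2h h0.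
have LPh : L1 leb1 (fun s => primitive r s * h s).
  apply: eq_L1 (L1_mul_bounded (M := Int leb1 (fun s => `|r s|)) Lh
    (measurable_primitive (L1_measurable Lr)) _) => [s|s]; first by rewrite mulrC.
  exact: primitive_bounded.
have LrP : L1 leb1 (fun s => r s * primitive h s).
  apply: (L1_mul_bounded (M := Int leb1 (fun s => `|h s|)) Lr
    (measurable_primitive (L1_measurable Lh))) => s.
  exact: primitive_bounded.
have key := primitive_mul Lr Lh (ltW T0).
rewrite (primitive_supported h0) in key.
have E : primitive (fun s => r s * primitive h s + primitive r s * h s) T =
    Int leb1 (fun s => r s * primitive h s + primitive r s * h s).
  by apply: primitive_supported => s sT; rewrite r0// h0// mul0r mulr0 addr0.
rewrite E IntD// in key.
transitivity (Int leb1 (fun s => primitive r T * h s - primitive r s * h s)).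
  apply: eq_Int => s; have [sT|sT] := boolP (0 < s < T); last by rewrite h0// !mulr0 subr0.
  by rewrite patchE mem_set/= ?in_itv// /tail_integral mulrBl.
by rewrite IntB// ?IntZ// ?key ?addrK//; exact: L1Z.
Qed.

Definition ucont (T : R) (z : R -> R) := forall e : R, 0 < e ->
  exists2 d : R, 0 < d & forall s t, 0 <= s <= T -> 0 <= t <= T ->
    `|s - t| <= d -> `|z s - z t| <= e.

Lemma ucontD T z w : ucont T z -> ucont T w -> ucont T (fun t => z t + w t).
Proof.
move=> cz cw e e0; have e20 : 0 < e / 2 by rewrite divr_gt0.
have [d d0 Hd] := cz _ e20; have [d' d'0 Hd'] := cw _ e20.
exists (Num.min d d') => [|s t sT tT]; first by rewrite lt_min d0.
rewrite le_min => /andP[sd sd'].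
rewrite (_ : _ - _ = (z s - z t) + (w s - w t)); last by ring.
by rewrite (splitr e) (le_trans (ler_normD _ _))// lerD ?Hd ?Hd'.
Qed.

Lemma ucontZ T c z : ucont T z -> ucont T (fun t => c * z t).
Proof.
move=> cz e e0; have c0 : 0 < `|c| + 1 by rewrite ltr_wpDl.
have [d d0 Hd] := cz _ (divr_gt0 e0 c0); exists d => // s t sT tT st.
rewrite -mulrBr normrM; apply: (@le_trans _ _ ((`|c| + 1) * (e / (`|c| + 1)))).
  by apply: ler_pM => //; [rewrite lerDl|exact: Hd].
by rewrite mulrC divfK ?gt_eqF.
Qed.

Lemma ucont_sum T (I : Type) (s : seq I) (z : I -> R -> R) :
  (forall i, ucont T (z i)) -> ucont T (fun t => \sum_(i <- s) z i t).
Proof.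
move=> cz; elim: s => [|i s IH].
  move=> e e0; exists 1 => // r t _ _ _; by rewrite !big_nil subrr normr0 ltW.
rewrite (_ : (fun t => _) = fun t => z i t + \sum_(j <- s) z j t); first exact: ucontD.
by apply/funext => t; rewrite big_cons.
Qed.

Lemma L2_continuous_pairing (T : R) (f : R -> vec -> R) (w : vec -> R) :
  (forall t, 0 <= t <= T -> L2 leb (f t)) -> L2_continuous T f -> L2 leb w ->
  ucont T (fun t => Int leb (fun x => f t x * w x)).
Proof.
move=> Lf cf Lw e e0; pose W := Int leb (fun x => w x ^+ 2).
have W0 : 0 <= W by apply: Int_ge0 => x; exact: sqr_ge0.
have e'0 : 0 < e ^+ 2 / (W + 1) by rewrite divr_gt0 ?exprn_gt0// ltr_wpDl.
have [d d0 Hd] := cf _ e'0; exists d => // s t sT tT st.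
have LB := L2B (Lf s sT) (Lf t tT).
rewrite -IntB; [|exact: L2M (Lf s sT) Lw|exact: L2M (Lf t tT) Lw].
suff -> : Int leb (fun x => f s x * w x - f t x * w x) =
    Int leb (fun x => (f s x - f t x) * w x).
  rewrite -(@ler_pXn2r _ 2)// ?nnegrE ?(ltW e0)// real_normK ?num_real//.
  apply: (le_trans (Cauchy_Schwarz LB Lw)); rewrite -/W.
  apply: (@le_trans _ _ (e ^+ 2 / (W + 1) * W)); first by rewrite ler_wpM2r// Hd.
  by rewrite mulrAC ler_pdivrMr ?ltr_wpDl// ler_wpM2l ?sqr_ge0// lerDl.
by apply: eq_Int => x; rewrite mulrBl.
Qed.

(** Every neighbourhood of t meets ]0, T[ in an interval of positive length, hence contains a zero
    of z; the end points are included. *)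
Lemma continuous_ae_zero (T : R) (z : R -> R) : 0 < T -> ucont T z ->
  (\forall t \ae leb1, 0 < t < T -> z t = 0) -> forall t, 0 <= t <= T -> z t = 0.
Proof.
move=> T0 cz z0 t tT; apply/eqP; rewrite -normr_eq0 eq_le normr_ge0 andbT.
apply/ler_addgt0Pr => e e0; rewrite add0r.
have [d d0 Hd] := cz e e0.
pose l := Num.max 0 (t - d); pose u := Num.min T (t + d).
have lu : l < u.
  by rewrite gt_max !lt_min T0/=; move: tT d0 => /andP[]; lra.
have [s /andP[ls su] zs] : exists2 s, l < s < u & z s = 0.
  apply: (ae_ex_itv lu); apply: ae_mono z0 => s Hs /andP[].
  rewrite gt_max lt_min => /andP[s0 _] /andP[sT _].
  by apply: Hs; rewrite s0.
move: ls su; rewrite gt_max lt_min => /andP[s0 sl] /andP[sT su].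
have := Hd t s tT; rewrite zs subr0; apply; first by rewrite !ltW.
by rewrite ler_norml; apply/andP; split; move: sl su; lra.
Qed.

End pairings.

Section mass_balance.
Context {R : realType} {D : nat}.
Local Notation vec := 'rV[R]_D.
Local Notation leb1 := (@lebesgue_measure R).
Local Notation mR := (measurableTypeR R).
Local Notation leb := (@lebesgue_row R D).
Local Notation sp := (@spacetime_measure R D).
Variables (T : R) (Omega : set vec).
Hypotheses (T0 : 0 < T) (oO : open Omega) (Ooo : (leb Omega < +oo)%E).
Local Notation Q := (cylinder T Omega).
Variables (lam : R) (a : R -> vec -> R) (Dm : R -> vec -> vec).
Let a' := (fun p : R * vec => a p.1 p.2) \_ Q.
Let nu i := (fun p : R * vec => Dm p.1 p.2 ord0 i) \_ Q.
Let flux i t x := primitive (fun s => nu i (s, x)) t.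
Hypotheses (La : forall t, 0 <= t <= T -> L2 leb ((a t) \_ Omega))
  (ca : L2_continuous T (fun t => (a t) \_ Omega))
  (La' : L2 sp a') (Lnu : forall i, L2 sp (nu i)).
Hypothesis balance : forall xi dxi Dxi, admissible_test_T T Omega xi dxi Dxi ->
  Int sp (fun p => - (a' p * dxi p.1 p.2) + lam * \sum_i nu i p * Dxi p.1 p.2 ord0 i) = 0.

Let mO : measurable Omega. Proof. exact: open_row_measurable. Qed.
Let Lnu1 i : L1 sp (nu i). Proof. exact: (patch_L2_L1_cylinder oO Ooo (Lnu i)). Qed.

(** With [flux i] the i-th component of G(t), the vanishing of this functional is the
    time-integrated mass balance. *)
Definition mass_functional (v : vec -> R) (Dv : vec -> vec) (t : R) : R :=
  Int leb (fun x => ((a t) \_ Omega) x * (v \_ Omega) x) +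
  lam * \sum_i Int leb (fun x => flux i t x * ((fun y => Dv y ord0 i) \_ Omega) x).

(* Take r = mass_functional v Dv itself, so that the balance reads int r^2 = 0. *)
Lemma mass_functional_ae (v : vec -> R) (Dv : vec -> vec) (M : R) : in_H1 Omega v Dv ->
  (forall x, `|v x| <= M) -> \forall t \ae leb1, 0 < t < T -> mass_functional v Dv t = 0.
Proof.
move=> Hv vM; have [/(in_L2P leb _ mO) Lv LDv0 _] := Hv.
have LDv i := (in_L2P leb (fun y => Dv y ord0 i) mO).1 (LDv0 i).
pose A t := Int leb (fun x => a' (t, x) * (v \_ Omega) x).
pose h i t := Int leb (fun x => nu i (t, x) * ((fun y => Dv y ord0 i) \_ Omega) x).
have LA : L2 leb1 A := L2_pairing La' Lv.
have Lh i : L2 leb1 (h i) := L2_pairing (Lnu i) (LDv i).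
have zero (f : R * vec -> R) (w : vec -> R) s : ~~ (0 < s < T) ->
    Int leb (fun x => (f \_ Q) (s, x) * w x) = 0.
  move=> sT; rewrite -[RHS](@Int0 _ _ _ leb); apply: eq_Int => x.
  by rewrite patch_cylinder_out// mul0r.
have A0 s : ~~ (0 < s < T) -> A s = 0 by exact: zero.
have h0 i s : ~~ (0 < s < T) -> h i s = 0 by exact: zero.
have Lh1 i : L1 leb1 (h i) := supported_L2_L1 (Lh i) (h0 i).
pose r := (fun s => A s + lam * \sum_i primitive (h i) s) \_ `]0, T[%classic.
have r0 s : ~~ (0 < s < T) -> r s = 0.
  by move=> /negP sT; rewrite /r patchE memNset// => /=; rewrite in_itv.
have LPh i : L2 leb1 ((primitive (h i)) \_ `]0, T[%classic).
  apply: bounded_patch_L2; first exact: measurable_primitive (L1_measurable (Lh1 i)).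
  by move=> s; exact: primitive_bounded.
have rE s : r s = A s + lam * \sum_i ((primitive (h i)) \_ `]0, T[%classic) s.
  rewrite /r patchE; case: ifPn => sT.
    by congr (_ + _ * _); apply: eq_bigr => i _; rewrite patchE sT.
  rewrite A0 ?add0r; last by move: sT; rewrite mem_setE in_itv.
  by rewrite big1 ?mulr0// => i _; rewrite patchE (negbTE sT).
have Lr : L2 leb1 r.
  rewrite (_ : r = fun s => A s + lam * \sum_i ((primitive (h i)) \_ `]0, T[%classic) s).
    by apply: L2D => //; apply: L2Z; apply: L2_sum => i _; exact: LPh.
  by apply/funext.
have Lt := tail_integral_patch_L2 Lr r0.
have Bal := balance (product_admissible T0 oO Ooo Lr r0 Hv vM).
have LX := L1_pairing La' Lr Lv.
pose Y i (p : R * vec) := nu i p * ((tail_integral T r \_ `]0, T[%classic) p.1 *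
  ((fun y => Dv y ord0 i) \_ Omega) p.2).
have LY i : L1 sp (Y i) := L1_pairing (Lnu i) Lt (LDv i).
have Bal2 : Int sp (fun p => a' p * (r p.1 * (v \_ Omega) p.2)) +
    lam * \sum_i Int sp (Y i) = 0.
  have LYs := L1_fsum LY.
  rewrite -[RHS]Bal -(Int_fsum LY) -IntZ//.
  rewrite -IntD//; last exact: L1Z.
  apply: eq_Int => -[t x] /=; have [Qp|Qp] := pselect (Q (t, x)); last first.
    rewrite /a' patchE memNset// !mul0r oppr0; congr (_ + _ * _); apply: eq_bigr => i _.
    by rewrite /Y /nu patchE memNset// !mul0r.
  have [tT Ox] := Qp; rewrite !(patchE v) (mem_set Ox); congr (_ + _ * _).
    by rewrite mulNr mulrN opprK.
  by apply: eq_bigr => i _; rewrite /Y mxE !patchE (mem_set Ox) (mem_set tT).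
rewrite (Int_pairing La' Lr Lv) in Bal2.
pose G i t := r t * primitive (h i) t.
(* The flux term thereby acquires the factor r undifferentiated, as in the term with a, and the two
   terms combine into r^2. *)
have E i : Int sp (Y i) = Int leb1 (G i).
  apply: etrans (Int_pairing (Lnu i) Lt (LDv i)) _.
  exact: tail_integral_pairing (Lh i) r0 (h0 i).
rewrite (eq_bigr _ (fun i _ => E i)) in Bal2.
have LrP i : L1 leb1 (G i).
  apply: (L1_mul_bounded (M := Int leb1 (fun s => `|h i s|)) (supported_L2_L1 Lr r0)
    (measurable_primitive (L1_measurable (Lh1 i)))) => s.
  exact: primitive_bounded.
have Z : Int leb1 (fun t => r t ^+ 2) = 0.
  have LrPs := L1_fsum LrP.
  rewrite -[RHS]Bal2 -(Int_fsum LrP) -IntZ//.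
  rewrite -IntD//; [|exact: L2M Lr LA|exact: L1Z].
  apply: eq_Int => t; rewrite /G -mulr_sumr mulrCA -mulrDr expr2.
  have [tT|/r0 ->] := boolP (0 < t < T); last by rewrite !mul0r.
  by congr (_ * _); rewrite /r patchE mem_set/= ?in_itv.
have := Int_eq0 Lr.2 (fun t => sqr_ge0 _) Z.
apply: ae_mono => t /eqP; rewrite sqrf_eq0 => /eqP + tT.
rewrite /r patchE mem_set/= ?in_itv// => rt; rewrite -[RHS]rt /mass_functional.
congr (_ + _ * _).
  by apply: eq_Int => x; rewrite /a' patch_cylinder.
by apply: eq_bigr => i _; rewrite (primitive_pairing (Lnu i) (LDv i))//; case/andP: tT => /ltW.
Qed.

Lemma flux_L2 i t : 0 <= t -> L2 leb (flux i t).
Proof. exact: (primitive_L2 (Lnu1 i) (Lnu i)). Qed.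

(** Both terms are continuous in t as L2 pairings of continuous curves with a fixed function, so
    vanishing at almost every time extends to all of [0, T]. *)
Lemma mass_functional_bounded (v : vec -> R) (Dv : vec -> vec) (M : R) : in_H1 Omega v Dv ->
  (forall x, `|v x| <= M) -> forall t, 0 <= t <= T -> mass_functional v Dv t = 0.
Proof.
move=> Hv vM; apply: (continuous_ae_zero T0) (mass_functional_ae Hv vM).
have [/(in_L2P leb _ mO) Lv LDv0 _] := Hv.
have LDv i := (in_L2P leb (fun y => Dv y ord0 i) mO).1 (LDv0 i).
apply: ucontD; first exact: L2_continuous_pairing.
apply/ucontZ/ucont_sum => i.
apply: L2_continuous_pairing => //; first by move=> t /andP[t0 _]; exact: flux_L2.
exact: (primitive_L2_continuous T (Lnu1 i) (Lnu i)).
Qed.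

(** The truncations with c = 1/(n+1) are bounded by 1/(2 c), so the bounded case applies to them. As
    c tends to 0, they and their gradients converge pointwise on Omega, dominated by |v| and the
    components of Dv, and dominated convergence concludes. *)
Lemma mass_functional_eq0 (v : vec -> R) (Dv : vec -> vec) : in_H1 Omega v Dv ->
  forall t, 0 <= t <= T -> mass_functional v Dv t = 0.
Proof.
move=> Hv t tT; have [/(in_L2P leb _ mO) Lv LDv0 _] := Hv.
have LDv i := (in_L2P leb (fun y => Dv y ord0 i) mO).1 (LDv0 i).
pose c (n : nat) : R := n.+1%:R^-1.
have c0 n : c n != 0 by rewrite invr_eq0 pnatr_eq0.
have cvgc : c @ \oo --> (0 : R) by exact: cvg_harmonic.
have Zn n : mass_functional (fun x => trunc (c n) (v x)) (fun x => dtrunc (c n) (v x) (v x) *: Dv x) t = 0.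
  apply: (@mass_functional_bounded _ _ (2^-1 / `|c n|) (in_H1_trunc (c n) oO Ooo Hv)) => // x.
  by rewrite ler_pdivlMr ?normr_gt0// mulrC -normrM trunc_bound.
have E1 n : (fun x => trunc (c n) (v x)) \_ Omega = fun x => trunc (c n) ((v \_ Omega) x).
  by apply/funext => x; rewrite !patchE; case: ifP => //; rewrite /trunc mul0r.
have E2 n i : (fun x => (dtrunc (c n) (v x) (v x) *: Dv x) ord0 i) \_ Omega =
    fun x => dtrunc (c n) ((v \_ Omega) x) ((v \_ Omega) x) * ((fun x => Dv x ord0 i) \_ Omega) x.
  by apply/funext => x; rewrite !patchE; case: ifP => //; rewrite ?mulr0// mxE.
have mv := Lv.1.
have den (s : R) n : 1 + c n ^+ 2 * s ^+ 2 != 0.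
  by rewrite gt_eqF// ltr_wpDr// mulr_ge0 ?sqr_ge0.
have cvgden (s : R) : 1 + c n ^+ 2 * s ^+ 2 @[n --> \oo] --> (1 : R).
  rewrite -[X in _ --> X](_ : 1 + 0 ^+ 2 * s ^+ 2 = 1); last by ring.
  apply: cvgD; first exact: cvg_cst.
  by apply: cvgM; [rewrite expr2; exact: cvgM|exact: cvg_cst].
have cvgtr (s : R) : trunc (c n) s @[n --> \oo] --> s.
  rewrite -[X in _ --> X](_ : s / 1 = s); last by rewrite divr1.
  by apply: cvgM; [exact: cvg_cst|apply: cvgV => //; exact: oner_neq0].
have cvgdtr (s : R) : dtrunc (c n) s s @[n --> \oo] --> (1 : R).
  rewrite -[X in _ --> X](_ : 1^-1 * 1^-1 - 0 ^+ 2 * s * s = 1); last by rewrite invr1; ring.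
  apply: cvgB.
    by apply: cvgM; apply: cvgV => //; exact: oner_neq0.
  apply: cvgM => //; apply: cvgM => //.
  by rewrite expr2; exact: cvgM.
have t0 : 0 <= t by case/andP: tT.
have A1 : Int leb (fun x => ((a t) \_ Omega) x * ((fun x => trunc (c n) (v x)) \_ Omega) x) @[n --> \oo]
    --> Int leb (fun x => ((a t) \_ Omega) x * (v \_ Omega) x).
  have Lav := L2M (La tT) Lv.
  apply: (Int_cvg _ (L1_measurable Lav) (L1_norm Lav)).
  - move=> n; rewrite E1; apply: measurable_funM; first exact: (La tT).1.
    exact: measurableT_comp (measurable_trunc (c n)) mv.
  - by move=> n x; rewrite E1 normrM [leRHS]normrM ler_wpM2l// trunc_norm.
  apply: aeW => x; apply: cvgM; first exact: cvg_cst.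
  by under eq_fun do rewrite E1; exact: cvgtr.
have A2 i : Int leb (fun x => flux i t x *
      ((fun y => (dtrunc (c n) (v y) (v y) *: Dv y) ord0 i) \_ Omega) x) @[n --> \oo]
    --> Int leb (fun x => flux i t x * ((fun y => Dv y ord0 i) \_ Omega) x).
  have Lf := flux_L2 i t0; have Lfv := L2M Lf (LDv i).
  apply: (Int_cvg _ (L1_measurable Lfv) (L1_norm Lfv)).
  - move=> n; rewrite E2; apply: measurable_funM; first exact: Lf.1.
    apply: measurable_funM; last exact: (LDv i).1.
    exact: measurableT_comp (measurable_dtrunc (c n)) mv.
  - by move=> n x; rewrite E2 normrM [leRHS]normrM ler_wpM2l// normrM ler_piMl// dtrunc_le1.
  apply: aeW => x; apply: cvgM; first exact: cvg_cst.
  pose V := (v \_ Omega) x; pose W := ((fun y => Dv y ord0 i) \_ Omega) x.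
  have H : dtrunc (c n) V V * W @[n --> \oo] --> 1 * W.
    by apply: cvgM; [exact: cvgdtr|exact: cvg_cst].
  by rewrite mul1r in H; under eq_fun do rewrite E2.
have A3 : mass_functional (fun x => trunc (c n) (v x))
    (fun x => dtrunc (c n) (v x) (v x) *: Dv x) t @[n --> \oo] --> mass_functional v Dv t.
  apply: cvgD => //; apply: cvgM; first exact: cvg_cst.
  by apply: cvg_sum_seq => i; exact: A2.
rewrite -(cvg_lim (@Rhausdorff R) A3) (_ : (fun n => _) = fun=> 0); last exact/funext.
exact: lim_cst.
Qed.

End mass_balance.

(** * The energy estimate *)

Section gronwall.
Context {R : realType}.
Local Notation leb1 := (@lebesgue_measure R).

Lemma primitive_expR (k t : R) : 0 < k -> 0 <= t ->
  k * primitive (fun s => expR (2 * k * s)) t = (expR (2 * k * t) - 1) / 2.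
Proof.
move=> k0 t0; have k2 : 2 * k != 0 by rewrite gt_eqF// mulr_gt0.
pose f (s : R) := (2 * k)^-1 * expR (2 * k * s).
have df (s : R) : is_derive s (1 : R) f (expR (2 * k * s)).
  have H : is_derive s (1 : R) (fun z : R => 2 * k * z) (2 * k).
    by apply: is_derive_eq; rewrite /GRing.scale /= mulr1.
  have H2 := is_derive1_comp (is_derive_expR (2 * k * s)) H.
  apply: (@is_derive_eq _ _ _ _ _ _ _ _ (is_deriveZ (2 * k)^-1 H2)).
  by rewrite /GRing.scale/= mulrC mulfK.
have cg : continuous (fun s : R => expR (2 * k * s)).
  move=> s; apply: continuous_comp; last exact: continuous_expR.
  by apply: cvgM; [exact: cvg_cst|exact: cvg_id].
rewrite (C1_FTC t0 df cg) /f mulr0 expR0 mulr1.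
by field; rewrite gt_eqF.
Qed.

(** W is merely integrable, so the inequality is iterated instead of differentiated. With the weight
    exp(2 k t), each application of k times the primitive at least halves the bound, giving
    [W t <= M 2^-n exp(2 k t)] for every n; the first bound M is k times the integral of W. *)
Lemma gronwall_eq0 (W : R -> R) (T k : R) : 0 < k -> L1 leb1 W -> (forall t, 0 <= W t) ->
  (forall t, ~~ (0 < t < T) -> W t = 0) ->
  (forall t, 0 < t < T -> W t <= k * primitive W t) -> forall t, W t = 0.
Proof.
move=> k0 LW W0 Wout HW; pose M := k * Int leb1 W.
have M0 : 0 <= M by apply: mulr_ge0; [exact: ltW|exact: Int_ge0].
have expL t : L1 leb1 (fun s => \1_(`[0, t]%classic : set R) s * expR (2 * k * s)).
  apply: L1_segment => s; apply: continuous_comp; last exact: continuous_expR.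
  by apply: cvgM; [exact: cvg_cst|exact: cvg_id].
have exp1 t : 0 < t < T -> 1 <= expR (2 * k * t).
  by move=> /andP[t0 _]; rewrite -expR0 ler_expR !mulr_ge0// ltW.
have iter (n : nat) t : 0 < t < T -> W t <= M * 2^-1 ^+ n * expR (2 * k * t).
  elim: n t => [|n IH] t tT.
    rewrite mulr1; apply: (le_trans (HW t tT)); apply: (@le_trans _ _ M).
      rewrite ler_wpM2l ?(ltW k0)//; apply: (le_trans (ler_norm _)).
      apply: (le_trans (primitive_bounded t LW)).
      by rewrite le_eqVlt; apply/orP; left; apply/eqP/eq_Int => s; rewrite ger0_norm.
    by rewrite ler_peMr// exp1.
  have t0 : 0 <= t by case/andP: tT => /ltW.
  apply: (le_trans (HW t tT)).
  apply: (@le_trans _ _ (k * (M * 2^-1 ^+ n * primitive (fun s => expR (2 * k * s)) t))).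
    rewrite ler_wpM2l ?(ltW k0)// -IntZ; last exact: expL.
    apply: Int_le; [exact: L1_indicM|by apply: L1Z; exact: expL|move=> s].
    rewrite indic_segmentE; case: (boolP (0 <= s <= t)) => st; last by rewrite !mul0r mulr0.
    rewrite !mul1r; have [sT|/Wout ->] := boolP (0 < s < T); first exact: IH.
    by rewrite mulr_ge0 ?expR_ge0// mulr_ge0// exprn_ge0// invr_ge0.
  rewrite mulrCA primitive_expR//.
  rewrite (_ : _ * expR _ = M * 2^-1 ^+ n * (expR (2 * k * t) / 2)); last by rewrite exprSr; ring.
  have Mq : 0 <= M * 2^-1 ^+ n by apply: mulr_ge0 => //; rewrite exprn_ge0 ?invr_ge0.
  apply: ler_wpM2l => //; by rewrite ler_wpM2r ?invr_ge0// gerBl.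
move=> t; have [tT|/Wout//] := boolP (0 < t < T).
apply/eqP; rewrite eq_le W0 andbT; set e := expR (2 * k * t) in iter *.
have H : M * 2^-1 ^+ n * expR (2 * k * t) @[n --> \oo] --> M * 0 * expR (2 * k * t).
  apply: cvgM; last exact: cvg_cst.
  apply: cvgM; first exact: cvg_cst.
  by apply: cvg_expr; rewrite ger0_norm ?invr_ge0// invf_lt1// ltr1n.
rewrite mulr0 mul0r in H.
have := cvg_lim (@Rhausdorff R) H => <-.
apply: limr_ge; first by apply/cvg_ex; exists 0.
by apply: nearW => n; exact: iter.
Qed.

End gronwall.

(** Here xb, xf, xd, xc stand for the time integrals of |b|^2, |G|^2, |grad a|^2, G . grad a, and B,
    y for |b(t)|^2, |G(t)|^2. The a term has become -2 k1 lam xc; the hypothesis from completing the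
    square absorbs it into lam xd at the cost lam k1^2 xf, which is 2 k1^2 times lam/2 xf. Likewise
    2 k2 xb is 4 k2 times xb/2. Hence the constant. *)
Lemma energy_arith {R : realFieldType} (lam k1 k2 xc xf xd y B xb : R) :
  0 < lam -> 0 < k1 -> 0 < k2 ->
  2^-1 * B - 2 * k1 * (- lam * xc) - 2 * k2 * xb + lam * xd <= - lam * (2^-1 * y) ->
  - (2 * k1) * xc <= xd + k1 ^+ 2 * xf -> 0 <= xb -> 0 <= xf ->
  2^-1 * B + lam / 2 * y <= (4 * k2 + 2 * k1 ^+ 2) * (2^-1 * xb + lam / 2 * xf).
Proof.
move=> lam0 k10 k20 E C xb0 xf0.
have C' : lam * (- (2 * k1) * xc) <= lam * (xd + k1 ^+ 2 * xf) by apply: ler_wpM2l C; exact: ltW.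
have h1 : 0 <= k1 ^+ 2 * xb by rewrite mulr_ge0 ?sqr_ge0.
have h2 : 0 <= k2 * (lam * xf) by apply: mulr_ge0; [exact: ltW|apply: mulr_ge0 => //; exact: ltW].
nra.
Qed.

Section energy_estimate.
Context {R : realType} {D : nat}.
Local Notation vec := 'rV[R]_D.
Local Notation leb1 := (@lebesgue_measure R).
Local Notation mR := (measurableTypeR R).
Local Notation leb := (@lebesgue_row R D).
Local Notation sp := (@spacetime_measure R D).
Local Notation chi t := (\1_(`[0, t]%classic : set R)).

Lemma ae_snd (P : vec -> Prop) : (\forall x \ae leb, P x) -> \forall p \ae sp, P p.2.
Proof.
move=> [A [mA A0 PA]]; exists (setT `*` A); split.
- exact: measurableX.
- rewrite -[LHS]/((leb1 \x leb)%E (setT `*` A)) product_measure1E//.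
  by rewrite [X in (_ * X)%E]A0 mule0.
- by move=> [t x] Px; split => //=; apply: PA => /= Px'; exact: Px.
Qed.

Lemma measurable_chi (t : R) : measurable_fun setT (fun p : mR * vec => chi t p.1 : R).
Proof.
have m : measurable_fun setT (chi t : mR -> R) by exact: measurable_indic.
exact: measurableT_comp m measurable_fst.
Qed.

Lemma chi_bound (t s : R) : `|chi t s : R| <= 1.
Proof. by rewrite indicE; case: (_ \in _); rewrite ?normr1 ?normr0. Qed.

Lemma L1_chi (f : R * vec -> R) t : L1 sp f -> L1 sp (fun p => chi t p.1 * f p).
Proof.
move=> Lf; apply: eq_L1 (L1_mul_bounded Lf (measurable_chi t) (fun p => chi_bound t p.1)).
by move=> p; rewrite mulrC.
Qed.

Lemma Int_chi (f : R * vec -> R) t : L1 sp f ->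
  Int sp (fun p => chi t p.1 * f p) = primitive (fun s => Int leb (fun x => f (s, x))) t.
Proof.
move=> Lf; have Lc := L1_chi t Lf; apply: (etrans (Int_fubini1 Lc)).
have m1 := measurable_Int1 leb (L1_measurable Lc).
have m2 : measurable_fun setT (fun s => chi t s * Int leb (fun x => f (s, x))).
  apply: measurable_funM; first exact: measurable_indic.
  by have m := measurable_Int1 leb (L1_measurable Lf); exact: m.
by apply: (Int_ae m1 m2); apply: ae_mono (L1_fubini1 Lf) => s Lfs /=; exact: (IntZ (chi t s) Lfs).
Qed.

Lemma primitive_L2_spacetime (f : R * vec -> R) t : L1 sp f -> L2 sp f -> 0 <= t ->
  L2 sp (fun p => chi t p.1 * primitive (fun s => f (s, p.2)) p.1).
Proof.
move=> Lf L2f t0.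
have m : measurable_fun setT (fun p : mR * vec => chi t p.1 * primitive (fun s => f (s, p.2)) p.1).
  by apply: measurable_funM; [exact: measurable_chi|exact: measurable_primitive2 L2f.1].
split => //.
have LN := L1_tensor (L1_indic_segment t) (L1Z t (L1_Int2 L2f.2)).
apply: (L1_ae_le (measurable_funX 2 m) LN).
have H : \forall x \ae leb, L1 leb1 (fun s => f (s, x)) /\ L2 leb1 (fun s => f (s, x)).
  by apply: ae_mono2 (L1_fubini2 Lf) (L2_fubini2 L2f).
apply: ae_mono (ae_snd H) => -[s x] [/= L1x L2x].
rewrite ger0_norm ?sqr_ge0// indic_segmentE.
case: (boolP (0 <= s <= t)) => [/andP[s0 st]|_]; last by rewrite !mul0r expr0n.
rewrite !mul1r; apply: (le_trans (primitive_sqr_le L2x s0)).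
by rewrite ler_wpM2r// Int_ge0// => z; rewrite sqr_ge0.
Qed.

Lemma L1_primitive_mul (f g : R * vec -> R) t : L1 sp f -> L2 sp f -> L2 sp g -> 0 <= t ->
  L1 sp (fun p => chi t p.1 * (primitive (fun s => f (s, p.2)) p.1 * g p)).
Proof.
move=> Lf L2f Lg t0; apply: eq_L1 (L2M (primitive_L2_spacetime Lf L2f t0) Lg) => p.
by rewrite mulrA.
Qed.

(** For almost every x the integrand is the time derivative of half the square of the primitive;
    this is the origin of the factors 1/2 in the energy. *)
Lemma Int_primitive_mul (f : R * vec -> R) t : L1 sp f -> L2 sp f -> 0 <= t ->
  Int sp (fun p => chi t p.1 * (primitive (fun s => f (s, p.2)) p.1 * f p)) =
  2^-1 * Int leb (fun x => primitive (fun s => f (s, x)) t ^+ 2).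
Proof.
move=> Lf L2f t0; have LX := L1_primitive_mul Lf L2f L2f t0.
rewrite (Int_fubini2 LX) -IntZ; last exact: (primitive_L2 Lf L2f t0).2.
apply: Int_ae.
- by have m := measurable_Int2 (@lebesgue_measure R) (L1_measurable LX); exact: m.
- apply: measurable_funM; first exact: measurable_cst.
  exact: measurable_funX (primitive_L2 Lf L2f t0).1.
apply: ae_mono (L1_fubini2 Lf) => x Lx /=.
have key := primitive_mul Lx Lx t0.
rewrite expr2 key -IntZ; last first.
  apply: L1_indicM; first exact: measurable_itv.
  have LPf : L1 leb1 (fun r => f (r, x) * primitive (fun s => f (s, x)) r).
    apply: (L1_mul_bounded Lx (measurable_primitive (L1_measurable Lx))) => s.
    exact: primitive_bounded.
  by apply: L1D => //; apply: eq_L1 LPf => r; rewrite mulrC.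
by apply: eq_Int => s; field.
Qed.

Variables (T : R) (Omega : set vec).
Hypotheses (T0 : 0 < T) (oO : open Omega) (Ooo : (leb Omega < +oo)%E).
Local Notation Q := (cylinder T Omega).
Local Notation patch f := ((fun p : R * vec => f p.1 p.2) \_ Q).
Local Notation patchi f i := ((fun p : R * vec => f p.1 p.2 ord0 i) \_ Q).
Local Notation flux f i t x := (primitive (fun s => patchi f i (s, x)) t).
Variables (lam : R) (a : R -> vec -> R) (Dm : R -> vec -> vec).
Hypotheses (La' : L2 sp (patch a)) (Lnu : forall i, L2 sp (patchi Dm i)).
Hypothesis mass0 : forall v Dv, in_H1 Omega v Dv -> forall t, 0 <= t <= T ->
  mass_functional T Omega lam a Dm v Dv t = 0.

Let Lnu1 i : L1 sp (patchi Dm i).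
Proof. exact: (patch_L2_L1_cylinder oO Ooo (Lnu i)). Qed.

(** For almost every s the slice v(s) lies in H^1 and is a legitimate test function at time s,
    bounded or not; integrating over [0, t] prepares the choices v = mu and v = a. *)
Lemma mass_time_integral (v : R -> vec -> R) (Dv : R -> vec -> vec) t :
  in_L2H1 T Omega v Dv -> 0 <= t <= T ->
  Int sp (fun p => chi t p.1 * (patch a p * patch v p)) =
  - lam * \sum_i Int sp (fun p => chi t p.1 * (flux Dm i p.1 p.2 * patchi Dv i p)).
Proof.
move=> Hv /andP[t0 tT]; have [Lv LDv] := in_L2H1_L2 oO Hv.1 Hv.
have Lav := L2M La' Lv.
have LX i := L1_primitive_mul (Lnu1 i) (Lnu i) (LDv i) t0.
rewrite (Int_chi t Lav) -(Int_fsum LX).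
have LXs := L1_fsum LX.
rewrite (Int_fubini1 LXs) -IntZ; last exact: L1_Int1 LXs.
apply: Int_ae.
- apply: measurable_funM; first exact: measurable_indic.
  by have m := measurable_Int1 leb (L1_measurable Lav); exact: m.
- apply: measurable_funM; first exact: measurable_cst.
  by have m := measurable_Int1 leb (L1_measurable LXs); exact: m.
have [[_ _ H1v] _] := Hv.
have LXt : \forall s \ae leb1, forall i, L1 leb (fun x => chi t s * (flux Dm i s x * patchi Dv i (s, x))).
  by apply: ae_forall_fin => i; exact: (L1_fubini1 (LX i)).
have LXu : \forall s \ae leb1, forall i, L2 leb (fun x => patchi Dv i (s, x)).
  by apply: ae_forall_fin => i; exact: (L2_fubini1 (LDv i)).
apply: ae_mono2 (LXu) (ae_mono2 (fun s P Q => conj P Q) H1v LXt) => s LDs [Hs Ls] /=.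
rewrite (Int_fsum Ls).
have [sT|sT] := boolP (0 < s < T); last first.
  rewrite big1 => [|i _].
    rewrite mulr0; rewrite (_ : Int _ _ = 0) ?mulr0// -[RHS](@Int0 _ _ _ leb).
    by apply: eq_Int => x; rewrite patch_cylinder_out// mul0r.
  rewrite -[RHS](@Int0 _ _ _ leb); apply: eq_Int => x.
  by rewrite (patch_cylinder_out Omega (fun p : R * vec => Dv p.1 p.2 ord0 i))// !mulr0.
have s0T : 0 <= s <= T by case/andP: sT => h1 h2; rewrite !ltW.
have := mass0 (Hs sT) s0T; rewrite /mass_functional.
have -> : Int leb (fun x => ((a s) \_ Omega) x * ((v s) \_ Omega) x) =
    Int leb (fun x => patch a (s, x) * patch v (s, x)).
  by apply: eq_Int => x; rewrite !patch_cylinder.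
move=> /eqP; rewrite addr_eq0 => /eqP ->.
rewrite mulrN mulNr mulrCA; congr (- (_ * _)); rewrite mulr_sumr; apply: eq_bigr => i _.
rewrite -IntZ.
  apply: eq_Int => x; congr (_ * (_ * _)); apply/esym.
  exact: (patch_cylinder Omega (fun t y => Dv t y ord0 i)).
apply: L2M; first by apply: primitive_L2 => //; case/andP: s0T.
suff -> : (fun y => Dv s y ord0 i) \_ Omega = (fun x => patchi Dv i (s, x)) by [].
by apply/funext => x; apply/esym; exact: (patch_cylinder Omega (fun t y => Dv t y ord0 i)).
Qed.

Variables (mu b db : R -> vec -> R) (Da : R -> vec -> vec) (k1 k2 : R).
Hypotheses (lam0 : 0 < lam) (k10 : 0 < k1) (k20 : 0 < k2).
Hypotheses (Hmu : in_L2H1 T Omega mu Dm) (Ha : in_L2H1 T Omega a Da).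
Hypotheses (Lb' : L2 sp (patch b)) (Ldb : L2 sp (patch db)).
Hypotheses (La : forall t, 0 <= t <= T -> L2 leb ((a t) \_ Omega))
  (Lb : forall t, 0 <= t <= T -> L2 leb ((b t) \_ Omega))
  (ca : L2_continuous T (fun t => (a t) \_ Omega)).
Hypothesis b_primitive : forall t, 0 <= t <= T -> \forall x \ae leb,
  ((b t) \_ Omega) x = primitive (fun s => patch db (s, x)) t.
Hypothesis energy : forall t, 0 <= t <= T ->
  Int sp (fun p => chi t p.1 * (patch db p * patch b p))
  - 2 * k1 * Int sp (fun p => chi t p.1 * (patch a p * patch a p))
  - 2 * k2 * Int sp (fun p => chi t p.1 * (patch b p * patch b p))
  + lam * \sum_i Int sp (fun p => chi t p.1 * (patchi Da i p * patchi Da i p))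
  <= Int sp (fun p => chi t p.1 * (patch a p * patch mu p)).

Let Ldb1 : L1 sp (patch db). Proof. exact: (patch_L2_L1_cylinder oO Ooo Ldb). Qed.

Lemma b_energy t : 0 <= t <= T ->
  Int sp (fun p => chi t p.1 * (patch db p * patch b p)) =
  2^-1 * Int leb (fun x => ((b t) \_ Omega) x ^+ 2).
Proof.
move=> tT; have t0 : 0 <= t by case/andP: tT.
(* The representation of b is known at each time for almost every x; passing to space-time requires
   the set A where it holds to be measurable. The last factor restricts to the open interval,
   outside of which [patch b] is zero. *)
have H : \forall p \ae sp, patch b p = chi T p.1 * primitive (fun s => patch db (s, p.2)) p.1 * ((0 < p.1 < T)%R)%:R.
  pose A : set (mR * vec) := [set p | patch b p =
    chi T p.1 * primitive (fun s => patch db (s, p.2)) p.1 * ((0 < p.1 < T)%R)%:R].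
  have mg : measurable_fun setT (fun p : mR * vec => chi T p.1 *
      primitive (fun s => patch db (s, p.2)) p.1 * ((0 < p.1 < T)%R)%:R).
    apply: measurable_funM.
      by apply: measurable_funM; [exact: measurable_chi|exact: measurable_primitive2 Ldb.1].
    have mI : measurable_fun setT (\1_(`]0, T[%classic : set R) : mR -> R) by exact: measurable_indic.
    rewrite (_ : (fun p => _) = (\1_(`]0, T[%classic : set R) : mR -> R) \o fst).
      exact: measurableT_comp mI measurable_fst.
    by apply/funext => p; rewrite /= indicE mem_setE in_itv.
  have mA : measurable A.
    rewrite (_ : A = setT `&` ((fun p => patch b p - chi T p.1 *
      primitive (fun s => patch db (s, p.2)) p.1 * ((0 < p.1 < T)%R)%:R) @^-1` [set 0])).
      have m0 := measurable_funB Lb'.1 mg.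
      by apply: m0 => //; exact: measurable_set1.
    rewrite setTI; apply/seteqP; split => p; rewrite /A /=.
      by move=> ->; rewrite subrr.
    by move=> /eqP; rewrite subr_eq0 => /eqP.
  apply: (ae_prod1 mA); apply: aeW => s; have [sT|sT] := boolP (0 < s < T).
    have s0T : 0 <= s <= T by case/andP: sT => h1 h2; rewrite !ltW.
    apply: ae_mono (b_primitive s0T) => x E.
    by rewrite /A /= patch_cylinder// E indic_segmentE s0T sT mulr1 mul1r.
  by apply: aeW => x; rewrite /A /= patch_cylinder_out// (negbTE sT) mulr0.
rewrite (_ : Int leb _ = Int leb (fun x => primitive (fun s => patch db (s, x)) t ^+ 2)); last first.
  apply: Int_ae.
  - exact: measurable_funX (Lb tT).1.
  - exact: measurable_funX (primitive_L2 Ldb1 Ldb t0).1.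
  by apply: ae_mono (b_primitive tT) => x ->.
rewrite -(Int_primitive_mul Ldb1 Ldb t0).
apply: Int_ae.
- apply: measurable_funM; first exact: measurable_chi.
  exact: measurable_funM Ldb.1 Lb'.1.
- exact: L1_measurable (L1_primitive_mul Ldb1 Ldb Ldb t0).
apply: ae_mono H => -[s x] /= ->; rewrite [RHS]mulrCA [in RHS]mulrC mulrA.
have [sT|sT] := boolP (0 < s < T); last by rewrite patch_cylinder_out// !(mul0r, mulr0).
have s0T : 0 <= s <= T by case/andP: sT => h1 h2; rewrite !ltW.
by rewrite [in LHS](indic_segmentE T) s0T mul1r mulr1; ring.
Qed.

(* The flux cut off to the open time interval, to keep it square-integrable. *)
Let fluxI i (p : R * vec) : R := ((0 < p.1 < T)%R)%:R * flux Dm i p.1 p.2.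

Let LfluxI i : L2 sp (fluxI i).
Proof.
have L := primitive_L2_spacetime (Lnu1 i) (Lnu i) (ltW T0).
have mI : measurable_fun setT (\1_(`]0, T[%classic : set R) : mR -> R) by exact: measurable_indic.
apply: L2_le (L) => [|p].
  apply: measurable_funM; last exact: measurable_primitive2 (Lnu i).1.
  rewrite (_ : (fun p => _) = (\1_(`]0, T[%classic : set R) : mR -> R) \o fst).
    exact: measurableT_comp mI measurable_fst.
  by apply/funext => p; rewrite /= indicE mem_setE in_itv.
rewrite /fluxI normrM [leRHS]normrM ler_wpM2r// indic_segmentE.
case: (boolP (0 < p.1 < T)) => [/andP[h1 h2]|_]; last by rewrite normr0.
by rewrite (ltW h1) (ltW h2).
Qed.

(** The quantity Y, extended by zero outside ]0, T[. *)
Let W (t : R) : R := 2^-1 * Int leb (fun x => patch b (t, x) ^+ 2) +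
  lam / 2 * \sum_i Int leb (fun x => fluxI i (t, x) ^+ 2).

Let LW : L1 leb1 W.
Proof.
apply: L1D; first exact: L1Z (L1_Int1 Lb'.2).
by apply: L1Z; apply: L1_fsum => i; exact: L1_Int1 (LfluxI i).2.
Qed.

Let W_ge0 t : 0 <= W t.
Proof.
apply: addr_ge0; first by rewrite mulr_ge0 ?invr_ge0// Int_ge0// => x; rewrite sqr_ge0.
rewrite mulr_ge0 ?divr_ge0 ?(ltW lam0)// sumr_ge0// => i _.
by rewrite Int_ge0// => x; rewrite sqr_ge0.
Qed.

Lemma energy_le t : 0 <= t <= T ->
  2^-1 * Int leb (fun x => ((b t) \_ Omega) x ^+ 2) +
  lam / 2 * \sum_i Int leb (fun x => flux Dm i t x ^+ 2) <=
  (4 * k2 + 2 * k1 ^+ 2) * primitive W t.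
Proof.
move=> tT; have t0 : 0 <= t by case/andP: tT.
have [_ LDa] := in_L2H1_L2 oO Ha.1 Ha.
pose Xb := Int sp (fun p => chi t p.1 * (patch b p * patch b p)).
pose Xa := Int sp (fun p => chi t p.1 * (patch a p * patch a p)).
pose Xd i := Int sp (fun p => chi t p.1 * (patchi Da i p * patchi Da i p)).
pose Xf i := Int sp (fun p => chi t p.1 * (fluxI i p ^+ 2)).
pose Xc i := Int sp (fun p => chi t p.1 * (flux Dm i p.1 p.2 * patchi Da i p)).
pose Y i := Int leb (fun x => flux Dm i t x ^+ 2).
have E := energy tT; rewrite (b_energy tT) -/Xb -/Xa in E.
have Emu : Int sp (fun p => chi t p.1 * (patch a p * patch mu p)) = - lam * \sum_i (2^-1 * Y i).
  rewrite (mass_time_integral Hmu tT); congr (_ * _); apply: eq_bigr => i _.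
  exact: (Int_primitive_mul (Lnu1 i) (Lnu i) t0).
have Eaa : Xa = - lam * \sum_i Xc i := mass_time_integral Ha tT.
(* The square of [D_i a + k1 G_i] is nonnegative; the weight k1 is the one that produces exactly the
   cross term of the energy inequality. *)
have cross i : - (2 * k1) * Xc i <= Xd i + k1 ^+ 2 * Xf i.
  have LXc := L1_primitive_mul (Lnu1 i) (Lnu i) (LDa i) t0.
  have LXd := L1_chi t (L2M (LDa i) (LDa i)); have LXf := L1_chi t (LfluxI i).2.
  rewrite /Xc /Xd /Xf -!IntZ// -IntD//; last exact: L1Z.
  apply: Int_le => [||p]; [exact: L1Z|by apply: L1D => //; exact: L1Z|].
  rewrite mulrCA [k1 ^+ 2 * _]mulrCA -mulrDr ler_wpM2l ?indic_nonneg//.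
  rewrite /fluxI; case: p => s x /=; have [sT|sT] := boolP (0 < s < T); last first.
    rewrite (patch_cylinder_out Omega (fun p : R * vec => Da p.1 p.2 ord0 i))//.
    by rewrite !mulr0 mul0r add0r expr0n mulr0.
  rewrite mul1r; set f := primitive _ _; set d := (_ \_ _) _.
  have := sqr_ge0 (d + k1 * f); rewrite -subr_ge0 => h; rewrite -subr_ge0.
  by apply: le_trans h _; rewrite le_eqVlt; apply/orP; left; apply/eqP; ring.
have PW : primitive W t = 2^-1 * Xb + lam / 2 * \sum_i Xf i.
  rewrite /Xb /Xf.
  have L1b := L1Z (mu := leb1) 2^-1 (L1_Int1 Lb'.2).
  have L1f i := L1_Int1 (LfluxI i).2.
  have mt : measurable (`[0, t]%classic : set R) by exact: measurable_itv.
  transitivity (Int leb1 (fun s => 2^-1 * (chi t s * Int leb (fun x => patch b (s, x) ^+ 2)) +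
     lam / 2 * \sum_i chi t s * Int leb (fun x => fluxI i (s, x) ^+ 2))).
    apply: eq_Int => s; rewrite /W mulrDr mulrCA; congr (_ + _).
    by rewrite mulrCA mulr_sumr.
  have Lc1 := L1_indicM mt (L1_Int1 Lb'.2).
  have Lc2 i := L1_indicM mt (L1f i).
  rewrite IntD; [|exact: L1Z|by apply: L1Z; exact: L1_fsum].
  rewrite (IntZ 2^-1 Lc1) (IntZ (lam / 2) (L1_fsum Lc2)) (Int_fsum Lc2); congr (_ * _ + _ * _).
    by apply: etrans (esym (Int_chi t Lb'.2)) _; apply: eq_Int => p; rewrite expr2.
  by apply: eq_bigr => i _; exact: esym (Int_chi t (LfluxI i).2).
have Sc : - (2 * k1) * \sum_i Xc i <= \sum_i Xd i + k1 ^+ 2 * \sum_i Xf i.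
  by rewrite !mulr_sumr -big_split /=; apply: ler_sum => i _; exact: cross.
have Xb0 : 0 <= Xb.
  by apply: Int_ge0 => p; rewrite mulr_ge0 ?indic_nonneg// -expr2 sqr_ge0.
have Xf0 : 0 <= \sum_i Xf i.
  apply: sumr_ge0 => i _; apply: Int_ge0 => p.
  by rewrite mulr_ge0 ?indic_nonneg// sqr_ge0.
rewrite PW; rewrite Emu Eaa -mulr_sumr in E.
exact: energy_arith E Sc Xb0 Xf0.
Qed.

Lemma energy_eq0 t : 0 <= t <= T ->
  Int leb (fun x => ((b t) \_ Omega) x ^+ 2) = 0 /\
  forall i, Int leb (fun x => flux Dm i t x ^+ 2) = 0.
Proof.
move=> tT; pose k := 4 * k2 + 2 * k1 ^+ 2.
have k0 : 0 < k.
  by rewrite /k ltr_pwDl// ?mulr_gt0// mulr_ge0// sqr_ge0.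
have W0 s : W s = 0.
  apply: (gronwall_eq0 (T := T) k0 LW W_ge0) => r.
    move=> rT; rewrite /W big1 => [|i _].
      rewrite mulr0 addr0 (_ : Int _ _ = 0) ?mulr0// -[RHS](@Int0 _ _ _ leb).
      by apply: eq_Int => x; rewrite patch_cylinder_out// expr0n.
    rewrite -[RHS](@Int0 _ _ _ leb); apply: eq_Int => x.
    by rewrite /fluxI /= (negbTE rT) mul0r expr0n.
  move=> rT; have r0T : 0 <= r <= T by case/andP: rT => h1 h2; rewrite !ltW.
  apply: le_trans (energy_le r0T); rewrite /W le_eqVlt; apply/orP; left; apply/eqP.
  congr (_ * _ + _ * _); first by apply: eq_Int => x; rewrite patch_cylinder.
  by apply: eq_bigr => i _; apply: eq_Int => x; rewrite /fluxI /= rT mul1r.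
have PW0 : primitive W t = 0.
  by rewrite -[RHS](@Int0 _ _ _ leb1); apply: eq_Int => s; rewrite W0 mulr0.
have := energy_le tT; rewrite PW0 mulr0.
have B0 : 0 <= Int leb (fun x => ((b t) \_ Omega) x ^+ 2).
  by apply: Int_ge0 => x; exact: sqr_ge0.
have F0 i : 0 <= Int leb (fun x => flux Dm i t x ^+ 2).
  by apply: Int_ge0 => x; exact: sqr_ge0.
have S0 : 0 <= \sum_i Int leb (fun x => flux Dm i t x ^+ 2) by exact: sumr_ge0.
move=> H; have l20 : 0 < lam / 2 by rewrite divr_gt0.
have H1 : 2^-1 * Int leb (fun x => ((b t) \_ Omega) x ^+ 2) <= 0.
  by apply: le_trans H; rewrite lerDl mulr_ge0// ltW.
have H2 : lam / 2 * \sum_i Int leb (fun x => flux Dm i t x ^+ 2) <= 0.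
  by apply: le_trans H; rewrite lerDr mulr_ge0// invr_ge0.
split; first by apply/eqP; rewrite eq_le B0 andbT -(@pmulr_rle0 _ 2^-1) ?invr_gt0.
rewrite pmulr_rle0// in H2; move=> i; apply/eqP; rewrite eq_le F0 andbT.
apply: le_trans H2; rewrite (bigD1 i)//= lerDl; exact: sumr_ge0.
Qed.

Lemma energy_uniqueness t : 0 <= t <= T ->
  (\forall x \ae leb, ((a t) \_ Omega) x = 0) /\ (\forall x \ae leb, ((b t) \_ Omega) x = 0).
Proof.
have sq0 (f : vec -> R) : L2 leb f -> Int leb (fun x => f x ^+ 2) = 0 -> \forall x \ae leb, f x = 0.
  move=> Lf f0; have := Int_eq0 Lf.2 (fun x => sqr_ge0 _) f0.
  by apply: ae_mono => x /eqP; rewrite sqrf_eq0 => /eqP.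
move=> tT; split; last by apply: sq0; [exact: Lb|exact: (energy_eq0 tT).1].
apply: (sq0 _ (La tT)).
(* For almost every s only is a(s) in H^1, and there G = 0 gives a(s) = 0. Pairing with the fixed
   function a(t) yields a continuous scalar function of s, whose vanishing extends to s = t. *)
suff Z : forall s, 0 <= s <= T -> Int leb (fun x => ((a s) \_ Omega) x * ((a t) \_ Omega) x) = 0.
  by rewrite -[RHS](Z t tT); apply: eq_Int => x; rewrite expr2.
apply: (continuous_ae_zero T0).
  by apply: L2_continuous_pairing => //; exact: La.
have [[_ _ H1a] _] := Ha; apply: ae_mono H1a => s Hs sT.
have s0T : 0 <= s <= T by case/andP: sT => h1 h2; rewrite !ltW.
have := mass0 (Hs sT) s0T; rewrite /mass_functional big1 => [|i _]; last first.
  rewrite -[RHS](@Int0 _ _ _ leb).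
  have Lfi : L2 leb (fun x => flux Dm i s x) by apply: primitive_L2 => //; case/andP: s0T.
  have [_ /(_ i)/(in_L2P leb _ (open_row_measurable oO)) LD _] := Hs sT.
  apply: Int_ae; [exact: measurable_funM Lfi.1 LD.1|exact: measurable_cst|].
  by apply: ae_mono (sq0 _ Lfi ((energy_eq0 s0T).2 i)) => x ->; rewrite mul0r.
rewrite mulr0 addr0 => Z; rewrite -[RHS](@Int0 _ _ _ leb).
have Las := La s0T.
have as0 : \forall x \ae leb, ((a s) \_ Omega) x = 0.
  by apply: (sq0 _ Las); rewrite -[RHS]Z; apply: eq_Int => x; rewrite expr2.
apply: Int_ae; [exact: measurable_funM Las.1 (La tT).1|exact: measurable_cst|].
by apply: ae_mono as0 => x ->; rewrite mul0r.
Qed.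

End energy_estimate.

(** * Monotonicity of the elastic and entropic terms *)

Section frobenius.
Context {R : realType} {D : nat}.
Implicit Types (A B E S X : 'M[R]_D).

Lemma frobDl A A' B : frob (A + A') B = frob A B + frob A' B.
Proof. by rewrite /frob linearD/= mulmxDl mxtraceD. Qed.

Lemma frobZl (c : R) A B : frob (c *: A) B = c * frob A B.
Proof. by rewrite /frob linearZ/= -scalemxAl mxtraceZ. Qed.

Lemma frobC A B : frob A B = frob B A.
Proof. by rewrite /frob -mxtrace_tr trmx_mul trmxK. Qed.

Lemma frobDr A B B' : frob A (B + B') = frob A B + frob A B'.
Proof. by rewrite frobC frobDl !(frobC A). Qed.

Lemma frobZr (c : R) A B : frob A (c *: B) = c * frob A B.
Proof. by rewrite frobC frobZl (frobC A). Qed.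

Lemma frobNl A B : frob (- A) B = - frob A B.
Proof. by rewrite -scaleN1r frobZl mulN1r. Qed.

Lemma frobNr A B : frob A (- B) = - frob A B.
Proof. by rewrite frobC frobNl (frobC A). Qed.

Lemma frobBl A A' B : frob (A - A') B = frob A B - frob A' B.
Proof. by rewrite frobDl frobNl. Qed.

Lemma frobBr A B B' : frob A (B - B') = frob A B - frob A B'.
Proof. by rewrite frobDr frobNr. Qed.

Lemma frob_tr A B : frob A^T B = frob A B^T.
Proof. by rewrite /frob trmxK -trmx_mul mxtrace_tr mxtrace_mulC. Qed.

Lemma frob_delta i j B : frob (delta_mx i j) B = B i j.
Proof.
rewrite /frob trmx_delta /mxtrace (bigD1 j)//= big1 ?addr0 => [|k kj].
  rewrite mxE (bigD1 i)//= big1 ?addr0 => [|l li]; first by rewrite mxE !eqxx mul1r.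
  by rewrite mxE eqxx (negbTE li) mul0r.
rewrite mxE big1// => l _; rewrite mxE (negbTE kj) mul0r//.
Qed.

Lemma sym_partD A B : sym_part (A + B) = sym_part A + sym_part B.
Proof. by apply/matrixP => i j; rewrite !mxE; ring. Qed.

Lemma sym_partZ (c : R) A : sym_part (c *: A) = c *: sym_part A.
Proof. by apply/matrixP => i j; rewrite !mxE; ring. Qed.

Lemma sym_partB A B : sym_part (A - B) = sym_part A - sym_part B.
Proof. by rewrite sym_partD -scaleN1r sym_partZ scaleN1r. Qed.

Lemma sym_part_tr A : (sym_part A)^T = sym_part A.
Proof. by apply/matrixP => i j; rewrite !mxE addrC. Qed.

Lemma frob_sym_part A B : B^T = B -> frob (sym_part A) B = frob A B.
Proof. by move=> sB; rewrite /sym_part frobZl frobDl frob_tr sB; field. Qed.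

End frobenius.

Section linear_elasticity.
Context {R : realType} {D : nat}.
Variables (C : {linear 'M[R]_D -> 'M[R]_D}) (ebar : 'M[R]_D).
Hypotheses (hebar : ebar^T = ebar) (hC : elasticity_tensor C).
Implicit Types (E S X : 'M[R]_D).

Let C_tr E : E^T = E -> (C E)^T = C E. Proof. by case: hC => H _ _; exact: H. Qed.
Let C_sym E F : E^T = E -> F^T = F -> frob E (C F) = frob F (C E).
Proof. by case: hC => _ H _; exact: H. Qed.

Let strain_tr E (d : R) : E^T = E -> (E - d *: ebar)^T = E - d *: ebar.
Proof. by move=> sE; rewrite linearB/= linearZ/= sE hebar. Qed.

Let C_lin (s : R) E F : C (s *: E + F) = s *: C E + C F.
Proof. by rewrite linearP. Qed.

Let C_sub E F (s : R) : C (E - s *: F) = C E - s *: C F.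
Proof. by rewrite -scaleNr addrC C_lin scaleNr addrC. Qed.

Lemma is_derive_quadratic (c0 c1 c2 x : R) :
  is_derive x (1 : R) (fun s : R => c0 + c1 * s + c2 * s ^+ 2) (c1 + 2 * c2 * x).
Proof. by apply: is_derive_eq; rewrite /GRing.scale/=; ring. Qed.

Lemma partial_d_W_lin (d : R) E : E^T = E ->
  partial_d (W_lin C ebar) d E = - frob ebar (C (E - d *: ebar)).
Proof.
move=> sE; rewrite /partial_d derive1E.
have -> : (fun s => W_lin C ebar s E) = fun s : R => 2^-1 * frob E (C E) +
    (- frob ebar (C E)) * s + (2^-1 * frob ebar (C ebar)) * s ^+ 2.
  apply/funext => s; rewrite /W_lin C_sub !(frobBl, frobBr, frobZl, frobZr).
  by rewrite (C_sym sE hebar); field.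
rewrite (@derive_val _ _ _ _ _ _ _ (is_derive_quadratic _ _ _ d)).
by rewrite C_sub frobBr frobZr; field.
Qed.

Lemma is_derive_W_lin (d : R) E S : E^T = E -> S^T = S ->
  is_derive E S (W_lin C ebar d) (frob S (C (E - d *: ebar))).
Proof.
move=> sE sS.
have expand X (h : R) : X^T = X -> 2^-1 * frob (h *: S + X) (C (h *: S + X)) =
    2^-1 * frob X (C X) + frob S (C X) * h + (2^-1 * frob S (C S)) * h ^+ 2.
  by move=> sX; rewrite C_lin !(frobDl, frobDr, frobZl, frobZr) (C_sym sX sS); field.
have sX := strain_tr d sE; set X := E - d *: ebar in sX *.
apply: is_derive_line.
rewrite (_ : (fun h => _) = fun h : R => 2^-1 * frob X (C X) + frob S (C X) * h +
  (2^-1 * frob S (C S)) * h ^+ 2).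
  by apply: is_derive_eq (is_derive_quadratic _ _ _ 0) _; ring.
by apply/funext => h; rewrite /W_lin -addrA expand.
Qed.

Lemma partial_eps_W_lin (d : R) E : E^T = E ->
  partial_eps (W_lin C ebar) d E = C (E - d *: ebar).
Proof.
move=> sE; apply/matrixP => i j; rewrite mxE.
rewrite (@derive_val _ _ _ _ _ _ _ (is_derive_W_lin d sE (sym_part_tr (delta_mx i j)))).
(* [C] of the elastic strain is symmetric, so pairing it with the symmetrized unit matrix returns
   its entry (i, j). *)
by rewrite frob_sym_part ?frob_delta//; exact/C_tr/strain_tr.
Qed.

(** The energy depends on d and E only through X = E - d ebar, and quadratically. Its gradient in
    (d, E) is thus linear in X, and the monotonicity expression is the quadratic form of C at the
    difference of the two values of X. *)
Lemma elastic_monotone (d1 d2 : R) E1 E2 : E1^T = E1 -> E2^T = E2 ->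
  (partial_d (W_lin C ebar) d1 E1 - partial_d (W_lin C ebar) d2 E2) * (d1 - d2) +
  frob (partial_eps (W_lin C ebar) d1 E1 - partial_eps (W_lin C ebar) d2 E2) (E1 - E2) =
  frob (E1 - E2 - (d1 - d2) *: ebar) (C (E1 - E2 - (d1 - d2) *: ebar)).
Proof.
move=> s1 s2; rewrite !partial_d_W_lin// !partial_eps_W_lin//.
pose X1 := E1 - d1 *: ebar; pose X2 := E2 - d2 *: ebar.
have -> : E1 - E2 - (d1 - d2) *: ebar = X1 - X2.
  by apply/matrixP => i j; rewrite !mxE; ring.
have -> : E1 - E2 = (X1 - X2) + (d1 - d2) *: ebar.
  by apply/matrixP => i j; rewrite !mxE; ring.
rewrite -/X1 -/X2 (frobC (C X1 - C X2)).
have -> : C (X1 - X2) = C X1 - C X2 by rewrite -[X2]scale1r C_sub !scale1r.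
by rewrite !(frobDl, frobZl, frobBr, frobBl); ring.
Qed.

Lemma elastic_ge0 E : E^T = E -> 0 <= frob E (C E).
Proof.
move=> sE; have [->|E0] := eqVneq E 0; first by rewrite linear0 /frob mulmx0 linear0.
by case: hC => _ _ H; exact: ltW (H _ sE E0).
Qed.

Lemma elastic_eq0 E : E^T = E -> frob E (C E) = 0 -> E = 0.
Proof.
move=> sE E0; apply/eqP/negPn/negP => EN0; case: hC => _ _ /(_ _ sE EN0).
by rewrite E0 ltxx.
Qed.

End linear_elasticity.

Section entropy_slope.
Context {R : realType}.

Lemma derive1_entropy (s : R) : 0 < s < 1 -> derive1 (@entropy R) s = ln s - ln (1 - s).
Proof.
move=> /andP[s0 s1]; rewrite derive1E.
have s1' : 0 < 1 - s by rewrite subr_gt0.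
have H1 := is_derive1_ln s0.
have H2 : is_derive s (1 : R) (fun z : R => 1 - z) (- 1).
  by apply: is_derive_eq; ring.
have H3 : is_derive s (1 : R) (@ln R \o (fun z : R => 1 - z)) ((1 - s)^-1 * -1).
  by apply: is_derive1_comp => /=; exact: is_derive1_ln.
have H4 := is_deriveM (is_derive_id s (1 : R)) H1.
have H5 := is_deriveM H2 H3.
have H6 := is_deriveD H4 H5.
suff H : is_derive s (1 : R) (@entropy R) (ln s - ln (1 - s)) by exact: derive_val.
apply: (is_derive_eq H6); rewrite /GRing.scale/=.
by field; rewrite !gt_eqF.
Qed.

Lemma entropy_monotone (p q : R) : 0 < p < 1 -> 0 < q < 1 ->
  0 <= (derive1 (@entropy R) p - derive1 (@entropy R) q) * (p - q).
Proof.
suff H x y : 0 < x < 1 -> 0 < y < 1 -> x <= y ->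
    0 <= (derive1 (@entropy R) x - derive1 (@entropy R) y) * (x - y).
  move=> p01 q01; have [pq|/ltW qp] := leP p q; first exact: H.
  by rewrite -mulrNN !opprB; exact: H.
move=> /[dup] x01 /andP[x0 x1] /[dup] y01 /andP[y0 y1] xy.
rewrite !derive1_entropy// mulr_le0 ?subr_le0//.
by apply: lerB; rewrite ler_ln ?posrE ?subr_gt0// lerB.
Qed.

End entropy_slope.

(** * Differences, gradients and time bounds in the energy spaces *)

Section energy_spaces.
Context {R : realType} {D : nat}.
Local Notation vec := 'rV[R]_D.
Local Notation leb1 := (@lebesgue_measure R).
Local Notation mR := (measurableTypeR R).
Local Notation leb := (@lebesgue_row R D).
Local Notation sp := (@spacetime_measure R D).
Variables (T : R) (Omega : set vec).
Hypotheses (T0 : 0 < T) (oO : open Omega) (Ooo : (leb Omega < +oo)%E).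
Local Notation Q := (cylinder T Omega).
Let mO : measurable Omega. Proof. exact: open_row_measurable. Qed.
Let mQ : measurable (Q : set (mR * vec)). Proof. exact: measurable_cylinder. Qed.

Lemma cutoff_in_L2H1 (q : R -> R) (M : R) f g Df Dg : in_L2H1 T Omega f Df ->
  in_L2H1 T Omega g Dg -> measurable_fun setT q -> (forall t, `|q t| <= M) ->
  in_L2H1 T Omega (fun t x => q t * (f t x - g t x)) (fun t x => q t *: (Df t x - Dg t x)).
Proof.
move=> Hf Hg mq qM; have [Lf LDf] := in_L2H1_L2 oO Hf.1 Hf.
have [Lg LDg] := in_L2H1_L2 oO Hg.1 Hg.
have mq' : measurable_fun setT (fun p : mR * vec => q p.1) by exact: measurableT_comp mq measurable_fst.
have Lq (h k : R * vec -> R) : L2 sp (h \_ Q) -> L2 sp (k \_ Q) ->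
    L2 sp ((fun p => q p.1 * (h p - k p)) \_ Q).
  move=> Lh Lk; have L := L2B Lh Lk.
  have -> : (fun p => q p.1 * (h p - k p)) \_ Q = fun p => q p.1 * ((h \_ Q) p - (k \_ Q) p).
    by apply/funext => p; rewrite !patchE; case: ifP => // _; rewrite subrr mulr0.
  apply: L2_le (L2Z M L) => [|p]; first by apply: measurable_funM => //; exact: L.1.
  by rewrite normrM [leRHS]normrM ler_wpM2r// (le_trans (qM _))// ler_norm.
have LA := Lq _ _ Lf Lg.
have LB i : L2 sp ((fun p : R * vec => (q p.1 *: (Df p.1 p.2 - Dg p.1 p.2)) ord0 i) \_ Q).
  have -> : (fun p : R * vec => (q p.1 *: (Df p.1 p.2 - Dg p.1 p.2)) ord0 i) =
      fun p : R * vec => q p.1 * (Df p.1 p.2 ord0 i - Dg p.1 p.2 ord0 i).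
    by apply/funext => p; rewrite !mxE.
  exact: Lq (LDf i) (LDg i).
apply: L2_in_L2H1 => //; split=> [|i|].
- exact: measurable_of_patch oO _ LA.1.
- exact: measurable_of_patch oO _ (LB i).1.
have [[_ _ H1f] _] := Hf; have [[_ _ H1g] _] := Hg.
apply: ae_mono2 H1f H1g => t Hft Hgt tT.
have := in_H1_lin (-1) oO Ooo (Hgt tT) (Hft tT) => Hd.
have := in_H1_lin (q t - 1) oO Ooo Hd Hd.
congr in_H1; apply/funext => x; first by ring.
by rewrite scaleN1r [- _ + _]addrC -[X in _ + X]scale1r -scalerDl subrK.
Qed.

Lemma in_H1_gradient_unique v Dv Dv' : in_H1 Omega v Dv -> in_H1 Omega v Dv' ->
  \forall x \ae leb, Omega x -> forall i, Dv x ord0 i = Dv' x ord0 i.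
Proof.
move=> H H'; suff : \forall x \ae leb, forall i, Omega x -> Dv x ord0 i = Dv' x ord0 i.
  by apply: ae_mono => x Hx Ox i; exact: Hx.
apply: ae_forall_fin => i.
have [_ /(_ i)/(in_L2P leb _ mO) L _] := H; have [_ /(_ i)/(in_L2P leb _ mO) L' _] := H'.
have L1' := patch_L2_L1 mO Ooo L; have L1'' := patch_L2_L1 mO Ooo L'.
have := @fundamental_lemma_open R D Omega _ oO (L1B L1' L1'').
move=> FL; suff : \forall x \ae leb, Omega x -> ((fun x => Dv x ord0 i) \_ Omega) x -
    ((fun x => Dv' x ord0 i) \_ Omega) x = 0.
  apply: ae_mono => x Hx Ox; have := Hx Ox; rewrite !patchE mem_set// => /eqP.
  by rewrite subr_eq0 => /eqP.
apply: FL => F a b sF F0 abO.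
have [M _ FM] := tens_bounded sF F0; have mF := tens_measurable sF.
have W := in_H1_weak_partial i H sF F0 abO; have W' := in_H1_weak_partial i H' sF F0 abO.
have -> : Int leb (fun x => (((fun x => Dv x ord0 i) \_ Omega) x -
    ((fun x => Dv' x ord0 i) \_ Omega) x) * tensor (@row_coord R D) F x) =
  Int leb (fun x => ((fun x => Dv x ord0 i) \_ Omega) x * tensor (@row_coord R D) F x) -
  Int leb (fun x => ((fun x => Dv' x ord0 i) \_ Omega) x * tensor (@row_coord R D) F x).
  rewrite -IntB; first by apply: eq_Int => x; rewrite mulrBl.
    exact: L1_mul_bounded mF FM.
  exact: L1_mul_bounded mF FM.
by move: W; rewrite W' => /oppr_inj ->; rewrite subrr.
Qed.

(** A uniform bound on the slices, integrated by Tonelli over a time interval of finite length. *)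
Lemma L2_slices (f : R * vec -> R) (K : R) : measurable_fun setT (f : mR * vec -> R) ->
  (forall t x, ~~ (0 < t < T) -> f (t, x) = 0) ->
  (\forall t \ae leb1, 0 < t < T -> (\int[leb]_x (f (t, x) ^+ 2)%:E <= K%:E)%E) -> L2 sp f.
Proof.
move=> mf f0 fK; split => //.
have mf2 : measurable_fun setT (fun p : mR * vec => f p ^+ 2) by exact: measurable_funX.
have mE : measurable_fun setT (fun p : mR * vec => (f p ^+ 2)%:E) by exact/measurable_EFinP.
apply/integrableP; split => //.
have TE := @tonelli1 _ _ _ _ R (@lebesgue_measure R) leb _ mf2 (fun p => sqr_ge0 (f p)).
have -> : (\int[sp]_p `|(f p ^+ 2)%:E| = \int[leb1]_t \int[leb]_x (f (t, x) ^+ 2)%:E)%E.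
  rewrite -TE; apply: eq_integral => p _; rewrite gee0_abs// lee_fin sqr_ge0//.
have mI : measurable (`]0, T[%classic : set R) by exact: measurable_itv.
apply: (@le_lt_trans _ _ (\int[leb1]_t (`|K| * \1_(`]0, T[%classic : set R) t)%:E)%E).
  apply: ae_ge0_le_integral => //.
  - by move=> t _; apply: integral_ge0 => x _; rewrite lee_fin sqr_ge0.
  - have mE0 (p : mR * vec) : (0 <= (f p ^+ 2)%:E)%E by rewrite lee_fin sqr_ge0.
    have m := @measurable_fun_fubini_tonelli_F _ _ _ _ R leb _ mE mE0; exact: m.
  - by apply/measurable_EFinP; apply: measurable_funM => //; exact: measurable_indic.
  apply: ae_mono fK => t Ht _; rewrite indicE mem_setE in_itv/=.
  have [tT|tT] := boolP (0 < t < T).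
    by apply: (le_trans (Ht tT)); rewrite mulr1 lee_fin ler_norm.
  rewrite mulr0 (_ : (\int[leb]_x _ = 0)%E)// -[RHS](integral0 leb setT).
  by apply: eq_integral => x _; rewrite f0// expr0n.
have L : L1 leb1 (fun t => `|K| * \1_(`]0, T[%classic : set R) t).
  apply: L1Z; apply: (L1_indicator (mu := leb1) mI); exact: lebesgue_itv_lty.
have /integrableP[_] := L; apply: le_lt_trans; apply: ge0_le_integral => //.
- by apply/measurable_EFinP; apply: measurable_funM => //; exact: measurable_indic.
- by apply: measurableT_comp => //; apply/measurable_EFinP; apply: measurable_funM => //; exact: measurable_indic.
by move=> t _; rewrite lee_fin ler_norm.
Qed.

Lemma H1_sqnorm_ge v Dv : in_H1 Omega v Dv ->
  (\int[leb]_x ((v \_ Omega) x ^+ 2)%:E <= H1_sqnorm Omega v Dv)%E /\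
  forall i, (\int[leb]_x (((fun x => Dv x ord0 i) \_ Omega) x ^+ 2)%:E <= H1_sqnorm Omega v Dv)%E.
Proof.
move=> [/(in_L2P leb _ mO) Lv LDv _].
have LD i := (in_L2P leb (fun x => Dv x ord0 i) mO).1 (LDv i).
have E : H1_sqnorm Omega v Dv = (\int[leb]_x ((v \_ Omega) x ^+ 2 +
    \sum_i ((fun x => Dv x ord0 i) \_ Omega) x ^+ 2)%:E)%E.
  rewrite /H1_sqnorm integral_mkcond; apply: eq_integral => x _; rewrite !patchE.
  case: ifPn => xO; first by congr (_ + _)%:E; apply: eq_bigr => i _; rewrite patchE xO expr2.
  by rewrite expr0n big1 ?addr0// => i _; rewrite patchE (negbTE xO) expr0n.
have mE : measurable_fun setT (fun x => (v \_ Omega) x ^+ 2 +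
    \sum_i ((fun x => Dv x ord0 i) \_ Omega) x ^+ 2).
  apply: measurable_funD; first exact: measurable_funX Lv.1.
  by apply: measurable_sum => i; exact: measurable_funX (LD i).1.
have S0 x : 0 <= \sum_i ((fun x => Dv x ord0 i) \_ Omega) x ^+ 2.
  by apply: sumr_ge0 => i _; exact: sqr_ge0.
rewrite E; split=> [|i]; apply: ge0_le_integral => //.
- by move=> x _; rewrite lee_fin sqr_ge0.
- by apply/measurable_EFinP; exact: measurable_funX Lv.1.
- exact/measurable_EFinP.
- by move=> x _; rewrite lee_fin lerDl.
- by move=> x _; rewrite lee_fin sqr_ge0.
- by apply/measurable_EFinP; exact: measurable_funX (LD i).1.
- exact/measurable_EFinP.
move=> x _; rewrite lee_fin (bigD1 i)//= addrCA lerDl addr_ge0 ?sqr_ge0//.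
by apply: sumr_ge0 => j _; exact: sqr_ge0.
Qed.

(** The gradient in the weak formulation and the one carrying the uniform bound are separate
    witnesses. Weak gradients are unique almost everywhere, so the bound passes to the former, and u
    becomes available for building test functions in the elastic equation. *)
Lemma LooH1v_L2H1v u Du Du' : measurable_H1v T Omega u Du -> in_LooH1v T Omega u Du' ->
  in_L2H1v T Omega u Du.
Proof.
move=> mu [mu' [K HK]] i; have [m1 m2 H1] := mu i; have [_ _ H1'] := mu' i.
have B : \forall t \ae leb1, 0 < t < T ->
    (\int[leb]_x (((fun x => u t x ord0 i) \_ Omega) x ^+ 2)%:E <= K%:E)%E /\
    forall j, (\int[leb]_x (((fun x => row i (Du t x) ord0 j) \_ Omega) x ^+ 2)%:E <= K%:E)%E.
  apply: ae_mono2 (ae_mono2 (fun t P P' => conj P P') H1 H1') HK => t [Ht Ht'] HKt tT.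
  have [N1 N2] := H1_sqnorm_ge (Ht' tT).
  have NK : (H1_sqnorm Omega (fun x => u t x ord0 i) (fun x => row i (Du' t x)) <= K%:E)%E.
    apply: le_trans (HKt tT); rewrite (bigD1 i)//= leeDl// sume_ge0// => j _.
    apply: integral_ge0 => x _; rewrite lee_fin addr_ge0 ?sqr_ge0//.
    by apply: sumr_ge0 => k _; rewrite -expr2 sqr_ge0.
  split=> [|j]; first exact: le_trans N1 NK.
  apply: le_trans (le_trans (N2 j) NK).
  have GU := in_H1_gradient_unique (Ht tT) (Ht' tT).
  have [_ /(_ j)/(in_L2P leb _ mO) L _] := Ht tT.
  have [_ /(_ j)/(in_L2P leb _ mO) L' _] := Ht' tT.
  rewrite le_eqVlt; apply/orP; left; apply/eqP; apply: ae_eq_integral => //.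
  - by apply/measurable_EFinP; exact: measurable_funX L.1.
  - by apply/measurable_EFinP; exact: measurable_funX L'.1.
  apply: ae_mono GU => x Hx _; rewrite !patchE; case: ifPn => // /set_mem Ox.
  by rewrite Hx.
have mi := mu i.
have [mp1 mp2] : measurable_fun setT (((fun p : R * vec => u p.1 p.2 ord0 i) \_ Q) : mR * vec -> R) /\
   forall j, measurable_fun setT (((fun p : R * vec => row i (Du p.1 p.2) ord0 j) \_ Q) : mR * vec -> R).
  by split=> [|j]; apply: measurable_patch => //; exact: m2.
apply: L2_in_L2H1 => // [|j].
  apply: (L2_slices (K := K)) => // [t x tT|]; first exact: patch_cylinder_out.
  apply: ae_mono B => t Ht tT; have [+ _] := Ht tT; apply: le_trans.
  rewrite le_eqVlt; apply/orP; left; apply/eqP; apply: eq_integral => x _.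
  by rewrite (patch_cylinder Omega (fun t x => u t x ord0 i)).
apply: (L2_slices (K := K)) => // [t x tT|]; first exact: patch_cylinder_out.
apply: ae_mono B => t Ht tT; have [_ /(_ j)] := Ht tT; apply: le_trans.
rewrite le_eqVlt; apply/orP; left; apply/eqP; apply: eq_integral => x _.
by rewrite (patch_cylinder Omega (fun t x => row i (Du t x) ord0 j)).
Qed.

End energy_spaces.

(** Right side minus left side is exactly c times the elastic expression, plus lam (y1 - y2), plus c
    th/2 times the two entropy expressions, all nonnegative. The letters f and g stand for the
    entropy slopes at a + b and a - b. *)
Lemma pointwise_arith {R : realFieldType} (c th k1 k2 lam a1 b1 a2 b2 w1 w2 x1 x2 y1 y2
    P1 P2 S f1 g1 f2 g2 : R) : 0 <= c -> 0 < th -> 0 < lam ->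
  0 <= (P1 - P2) * (a1 + b1 - (a2 + b2)) + S -> 0 <= y1 - y2 ->
  0 <= (f1 - f2) * (a1 + b1 - (a2 + b2)) -> 0 <= (g1 - g2) * (a1 - b1 - (a2 - b2)) ->
  c * ((w1 - w2) * (b1 - b2)) - 2 * k1 * (c * ((a1 - a2) * (a1 - a2)))
  - 2 * k2 * (c * ((b1 - b2) * (b1 - b2))) + lam * (x1 - x2) <=
  (((th / 2 * (f1 + g1) + k1 * (1 - 2 * a1) + P1) * (c * (a1 - a2)) + lam * x1) -
   ((th / 2 * (f2 + g2) + k1 * (1 - 2 * a2) + P2) * (c * (a1 - a2)) + lam * x2)) +
  (((w1 + th / 2 * (f1 - g1) - 2 * k2 * b1 + P1) * (c * (b1 - b2)) + lam * y1) -
   ((w2 + th / 2 * (f2 - g2) - 2 * k2 * b2 + P2) * (c * (b1 - b2)) + lam * y2)) + c * S.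
Proof.
move=> c0 th0 lam0 El Y F G; rewrite -subr_ge0.
have E1 := mulr_ge0 c0 El; have E2 := mulr_ge0 (ltW lam0) Y.
have th2 : 0 <= c * (th / 2) by rewrite mulr_ge0// divr_ge0// ltW.
have E3 := mulr_ge0 th2 F; have E4 := mulr_ge0 th2 G.
apply: le_trans (addr_ge0 (addr_ge0 E1 E2) (addr_ge0 E3 E4)) _.
by rewrite le_eqVlt; apply/orP; left; apply/eqP; field.
Qed.

Section pointwise.
Context {R : realType} {D : nat}.
Local Notation vec := 'rV[R]_D.
Variables (C : {linear 'M[R]_D -> 'M[R]_D}) (ebar sext : 'M[R]_D).
Hypotheses (hebar : ebar^T = ebar) (hC : elasticity_tensor C).
Local Notation W := (W_lin C ebar).
Local Notation s' := (derive1 (@entropy R)).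

Lemma dot_diff (c : R) (x y : vec) : dot x (c *: (x - y)) - dot y (c *: (x - y)) =
  \sum_i c * ((x ord0 i - y ord0 i) * (x ord0 i - y ord0 i)).
Proof.
rewrite /dot -sumrB; apply: eq_bigr => i _; rewrite !mxE; ring.
Qed.

Lemma stress_diff (c : R) (d1 d2 : R) (Du1 Du2 : 'M[R]_D) :
  frob (partial_eps W d1 (sym_part Du1) - sext) (sym_part (c *: (Du1 - Du2))) -
  frob (partial_eps W d2 (sym_part Du2) - sext) (sym_part (c *: (Du1 - Du2))) =
  c * frob (partial_eps W d1 (sym_part Du1) - partial_eps W d2 (sym_part Du2))
        (sym_part Du1 - sym_part Du2).
Proof.
move: (partial_eps _ _ _) (partial_eps _ _ _) => A B.
rewrite sym_partZ sym_partB; move: (sym_part Du1 - sym_part Du2) => E.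
by rewrite !(frobZr c) -mulrBr -frobBl opprB addrA subrK. Qed.

(** The number c is the value of the time cutoff. The monotone terms absent from the left side are
    the elastic form, the two entropy slopes and the gradients of b. *)
Lemma pointwise_energy (c th k1 k2 lam : R) (a1 b1 a2 b2 w1 w2 : R) (Du1 Du2 : 'M[R]_D)
    (Da1 Da2 Db1 Db2 : vec) :
  0 <= c -> 0 < th -> 0 < lam ->
  0 < a1 + b1 < 1 /\ 0 < a1 - b1 < 1 -> 0 < a2 + b2 < 1 /\ 0 < a2 - b2 < 1 ->
  forall P1 P2, P1 = partial_d W (a1 + b1) (sym_part Du1) ->
  P2 = partial_d W (a2 + b2) (sym_part Du2) ->
  c * ((w1 - w2) * (b1 - b2)) - 2 * k1 * (c * ((a1 - a2) * (a1 - a2)))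
  - 2 * k2 * (c * ((b1 - b2) * (b1 - b2)))
  + lam * \sum_i c * ((Da1 ord0 i - Da2 ord0 i) * (Da1 ord0 i - Da2 ord0 i)) <=
  (((th / 2 * (s' (a1 + b1) + s' (a1 - b1)) + k1 * (1 - 2 * a1) + P1) * (c * (a1 - a2))
     + lam * dot Da1 (c *: (Da1 - Da2))) -
   ((th / 2 * (s' (a2 + b2) + s' (a2 - b2)) + k1 * (1 - 2 * a2) + P2) * (c * (a1 - a2))
     + lam * dot Da2 (c *: (Da1 - Da2)))) +
  (((w1 + th / 2 * (s' (a1 + b1) - s' (a1 - b1)) - 2 * k2 * b1 + P1) * (c * (b1 - b2))
     + lam * dot Db1 (c *: (Db1 - Db2))) -
   ((w2 + th / 2 * (s' (a2 + b2) - s' (a2 - b2)) - 2 * k2 * b2 + P2) * (c * (b1 - b2))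
     + lam * dot Db2 (c *: (Db1 - Db2)))) +
  (frob (partial_eps W (a1 + b1) (sym_part Du1) - sext) (sym_part (c *: (Du1 - Du2))) -
   frob (partial_eps W (a2 + b2) (sym_part Du2) - sext) (sym_part (c *: (Du1 - Du2)))).
Proof.
move=> c0 th0 lam0 [p1 q1] [p2 q2] P1 P2 P1E P2E.
have Mp := entropy_monotone p1 p2; have Mq := entropy_monotone q1 q2.
have El := elastic_monotone hebar hC (a1 + b1) (a2 + b2) (sym_part_tr Du1) (sym_part_tr Du2).
set X := _ - _ *: ebar in El.
have sX : X^T = X.
  have trB (A B : 'M[R]_D) : (A - B)^T = A^T - B^T by apply/matrixP => i j; rewrite !mxE.
  have trZ (r : R) (A : 'M[R]_D) : (r *: A)^T = r *: A^T by apply/matrixP => i j; rewrite !mxE.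
  by rewrite /X !trB (trZ _ ebar) hebar !sym_part_tr.
have El0 := elastic_ge0 hC sX; rewrite -El -P1E -P2E in El0.
rewrite stress_diff.
have Ea := dot_diff c Da1 Da2; have Eb := dot_diff c Db1 Db2.
have Eb0 : 0 <= \sum_i c * ((Db1 ord0 i - Db2 ord0 i) * (Db1 ord0 i - Db2 ord0 i)).
  by apply: sumr_ge0 => i _; rewrite -expr2 mulr_ge0 ?sqr_ge0.
rewrite -Ea; rewrite -Eb in Eb0.
exact: pointwise_arith.
Qed.

End pointwise.

(** * Uniqueness *)

(** For the two solutions, F and G are the two sides of the equation for mu, H is the integrand of
    the equation for b and S that of the elastic equation. Integration turns G1 - G2 into M and
    removes the H and S terms; stated abstractly, this is independent of their long expressions. *)
Lemma Int_combination {dd} {X : measurableType dd} {R : realType} (mu : {measure set X -> \bar R})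
    (A : set X) (c1 c2 c3 : R) (A1 A2 A3 A4 M F1 F2 G1 G2 H1 H2 S1 S2 : X -> R) :
  L1 mu (F1 \_ A) -> L1 mu (F2 \_ A) -> L1 mu (G1 \_ A) -> L1 mu (G2 \_ A) ->
  L1 mu (H1 \_ A) -> L1 mu (H2 \_ A) -> L1 mu (S1 \_ A) -> L1 mu (S2 \_ A) ->
  Int mu (F1 \_ A) = Int mu (G1 \_ A) -> Int mu (F2 \_ A) = Int mu (G2 \_ A) ->
  Int mu (H1 \_ A) = 0 -> Int mu (H2 \_ A) = 0 ->
  Int mu (S1 \_ A) = 0 -> Int mu (S2 \_ A) = 0 ->
  L1 mu A1 -> L1 mu A2 -> L1 mu A3 -> L1 mu A4 ->
  (forall x, ~ A x -> [/\ A1 x = 0, A2 x = 0, A3 x = 0, A4 x = 0 & M x = 0]) ->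
  (forall x, A x -> M x = F1 x - F2 x) ->
  (\forall x \ae mu, A x -> A1 x - c1 * A2 x - c2 * A3 x + c3 * A4 x <=
    (G1 x - G2 x) + (H1 x - H2 x) + (S1 x - S2 x)) ->
  Int mu A1 - c1 * Int mu A2 - c2 * Int mu A3 + c3 * Int mu A4 <= Int mu M.
Proof.
move=> LF1 LF2 LG1 LG2 LH1 LH2 LS1 LS2 EG1 EG2 EH1 EH2 ES1 ES2 LA1 LA2 LA3 LA4 out ME le_ae.
have LA : L1 mu (fun x => A1 x - c1 * A2 x - c2 * A3 x + c3 * A4 x).
  by apply: L1D; [apply: L1B; [apply: L1B => //|]|]; exact: L1Z.
have LB : L1 mu (fun x => ((G1 \_ A) x - (G2 \_ A) x) + ((H1 \_ A) x - (H2 \_ A) x) +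
    ((S1 \_ A) x - (S2 \_ A) x)).
  by apply: L1D; [apply: L1D|]; exact: L1B.
have -> : Int mu A1 - c1 * Int mu A2 - c2 * Int mu A3 + c3 * Int mu A4 =
    Int mu (fun x => A1 x - c1 * A2 x - c2 * A3 x + c3 * A4 x).
  rewrite IntD; [|by apply: L1B; [apply: L1B => //|]; exact: L1Z|exact: L1Z].
  rewrite IntB; [|by apply: L1B => //; exact: L1Z|exact: L1Z].
  by rewrite IntB//; [rewrite !IntZ|exact: L1Z].
have {}le_ae : \forall x \ae mu, A1 x - c1 * A2 x - c2 * A3 x + c3 * A4 x <=
    ((G1 \_ A) x - (G2 \_ A) x) + ((H1 \_ A) x - (H2 \_ A) x) + ((S1 \_ A) x - (S2 \_ A) x).
  apply: ae_mono le_ae => x Hx; have [Ax|Ax] := pselect (A x).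
    by rewrite !(patch_in _ Ax); exact: Hx.
  by have [-> -> -> -> _] := out x Ax; rewrite !(patch_out _ Ax) !mulr0 !subrr !addr0.
apply: (le_trans (Int_ae_le LA LB le_ae)).
rewrite IntD; [|by apply: L1D; exact: L1B|exact: L1B].
rewrite IntD; [|exact: L1B..].
rewrite (IntB LH1 LH2) (IntB LS1 LS2) EH1 EH2 ES1 ES2 subrr !addr0 (IntB LG1 LG2) -EG1 -EG2 -IntB//.
rewrite le_eqVlt; apply/orP; left; apply/eqP/eq_Int => x.
have [Ax|Ax] := pselect (A x); first by rewrite !(patch_in _ Ax) ME.
by have [_ _ _ _ ->] := out x Ax; rewrite !(patch_out _ Ax) subrr.
Qed.

Lemma elastic_stress_diff {R : realType} {D : nat} (C : {linear 'M[R]_D -> 'M[R]_D})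
    (ebar : 'M[R]_D) (hebar : ebar^T = ebar) (hC : elasticity_tensor C) (d : R) (E1 E2 : 'M[R]_D) :
  E1^T = E1 -> E2^T = E2 ->
  frob (partial_eps (W_lin C ebar) d E1 - partial_eps (W_lin C ebar) d E2) (E1 - E2) =
  frob (E1 - E2) (C (E1 - E2)).
Proof.
move=> s1 s2; have := elastic_monotone hebar hC d d s1 s2.
by rewrite subrr mulr0 add0r scale0r subr0.
Qed.

Lemma Int_diff_eq0 {dd} {X : measurableType dd} {R : realType} (mu : {measure set X -> \bar R})
    (A : set X) (F1 F2 : X -> R) : L1 mu (F1 \_ A) -> Int mu (F1 \_ A) = 0 ->
  L1 mu (F2 \_ A) -> Int mu (F2 \_ A) = 0 ->
  (\forall x \ae mu, A x -> 0 <= F1 x - F2 x) -> \forall x \ae mu, A x -> F1 x - F2 x = 0.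
Proof.
move=> LF1 E1 LF2 E2 H; have LF := L1B LF1 LF2.
have IS : Int mu (fun x => `|(F1 \_ A) x - (F2 \_ A) x|) = 0.
  rewrite -[RHS](subrr 0) -[X in _ = X - _]E1 -[X in _ = _ - X]E2 -IntB//.
  apply: Int_ae; [exact: L1_measurable (L1_norm LF)|exact: L1_measurable LF|].
  apply: ae_mono H => x Hx; have [Ax|Ax] := pselect (A x).
    by rewrite !(patch_in _ Ax) ger0_norm// Hx.
  by rewrite !(patch_out _ Ax) subrr normr0.
have := Int_eq0 (L1_norm LF) (fun x => normr_ge0 _) IS.
apply: ae_mono => x /eqP; rewrite normr_eq0 => /eqP + Ax.
by rewrite !(patch_in _ Ax).
Qed.

Section uniqueness.
Context {R : realType} {D : nat}.
Local Notation vec := 'rV[R]_D.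
Local Notation leb1 := (@lebesgue_measure R).
Local Notation mR := (measurableTypeR R).
Local Notation leb := (@lebesgue_row R D).
Local Notation sp := (@spacetime_measure R D).
Local Notation chi t := (\1_(`[0, t]%classic : set R)).
Variables (T lam th k1 k2 : R) (Omega : set vec) (sext ebar : 'M[R]_D).
Variables (C : {linear 'M[R]_D -> 'M[R]_D}) (a0 b0 : vec -> R).
Local Notation Q := (cylinder T Omega).
Local Notation W := (W_lin C ebar).
Hypotheses (T0 : 0 < T) (oO : open Omega) (Ooo : (leb Omega < +oo)%E).
Hypotheses (lam0 : 0 < lam) (th0 : 0 < th) (k10 : 0 < k1) (k20 : 0 < k2).
Hypotheses (hebar : ebar^T = ebar) (hC : elasticity_tensor C).
(* The two solutions are indexed by the booleans; w is the time derivative of b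
   in the weak formulation, r the square-integrable one of the regularity class. *)
Variables (a b mu w r : bool -> R -> vec -> R) (Da Db Dmu : bool -> R -> vec -> vec).
Variables (u : bool -> R -> vec -> vec) (Du : bool -> R -> vec -> 'M[R]_D).
Let d j t x := a j t x + b j t x.
Let eps j t x := sym_part (Du j t x).
Hypothesis init : forall j, \forall x \ae leb, Omega x -> b j 0 x = b0 x.
Hypothesis range : forall j, \forall p \ae sp, Q p ->
  0 < a j p.1 p.2 + b j p.1 p.2 < 1 /\ 0 < a j p.1 p.2 - b j p.1 p.2 < 1.
Hypotheses (Ha : forall j, in_L2H1 T Omega (a j) (Da j))
  (Hb : forall j, in_L2H1 T Omega (b j) (Db j))
  (Hmu : forall j, in_L2H1 T Omega (mu j) (Dmu j))
  (Hu : forall j, in_L2H1v T Omega (u j) (Du j))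
  (Hw : forall j, weak_dt T Omega (b j) (w j))
  (Hr : forall j, weak_dt T Omega (b j) (r j))
  (Lr : forall j, in_L2 sp Q (fun p : R * vec => r j p.1 p.2))
  (hoelder_a : forall j, hoelder_L2 4^-1 T Omega (a j))
  (hoelder_b : forall j, hoelder_L2 4^-1 T Omega (b j)).
Hypothesis eq1 : forall j xi dxi Dxi, admissible_test_T T Omega xi dxi Dxi ->
  let F (p : R * vec) := let: (t, x) := p in
    - (a j t x - a0 x) * dxi t x + lam * dot (Dmu j t x) (Dxi t x) in
  sp.-integrable Q (EFin \o F) /\ \int[sp]_(p in Q) F p = 0.
Hypothesis eq2 : forall j zeta Dzeta, admissible_test T Omega zeta Dzeta ->
  let F (p : R * vec) := let: (t, x) := p in mu j t x * zeta t x in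
  let G (p : R * vec) := let: (t, x) := p in
    (th / 2 * (derive1 entropy (a j t x + b j t x) + derive1 entropy (a j t x - b j t x))
     + k1 * (1 - 2 * a j t x) + partial_d W (d j t x) (eps j t x)) * zeta t x
    + lam * dot (Da j t x) (Dzeta t x) in
  [/\ sp.-integrable Q (EFin \o F), sp.-integrable Q (EFin \o G) &
      \int[sp]_(p in Q) F p = \int[sp]_(p in Q) G p].
Hypothesis eq3 : forall j eta Deta, admissible_test T Omega eta Deta ->
  let F (p : R * vec) := let: (t, x) := p in
    (w j t x
     + th / 2 * (derive1 entropy (a j t x + b j t x) - derive1 entropy (a j t x - b j t x))
     - 2 * k2 * b j t x + partial_d W (d j t x) (eps j t x)) * eta t x
    + lam * dot (Db j t x) (Deta t x) in
  sp.-integrable Q (EFin \o F) /\ \int[sp]_(p in Q) F p = 0.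
Hypothesis eq4 : forall j v Dv, in_L2H1v T Omega v Dv ->
  let F (p : R * vec) := let: (t, x) := p in
    frob (partial_eps W (d j t x) (eps j t x) - sext) (sym_part (Dv t x)) in
  sp.-integrable Q (EFin \o F) /\ \int[sp]_(p in Q) F p = 0.

Let mO : measurable Omega. Proof. exact: open_row_measurable. Qed.
Let mQ : measurable (Q : set (mR * vec)). Proof. exact: measurable_cylinder. Qed.

Local Notation diff f := (fun t x => f true t x - f false t x).

Lemma cylinder_L1 (F : R * vec -> R) : sp.-integrable Q (EFin \o F) -> L1 sp (F \_ Q).
Proof. by move=> LF; apply: (integrable_cylinder T oO F).1. Qed.

Lemma cylinder_eq0 (F : R * vec -> R) :
  sp.-integrable Q (EFin \o F) /\ \int[sp]_(p in Q) F p = 0 ->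
  L1 sp (F \_ Q) /\ Int sp (F \_ Q) = 0.
Proof. by move=> [/cylinder_L1 LF]; rewrite Rintegral_Int. Qed.

Lemma cylinder_eq (F G : R * vec -> R) :
  [/\ sp.-integrable Q (EFin \o F), sp.-integrable Q (EFin \o G) &
      \int[sp]_(p in Q) F p = \int[sp]_(p in Q) G p] ->
  [/\ L1 sp (F \_ Q), L1 sp (G \_ Q) & Int sp (F \_ Q) = Int sp (G \_ Q)].
Proof. by move=> [/cylinder_L1 LF /cylinder_L1 LG]; rewrite !Rintegral_Int. Qed.

Lemma diff_in_L2H1 (f : bool -> R -> vec -> R) Df :
  (forall j, in_L2H1 T Omega (f j) (Df j)) -> in_L2H1 T Omega (diff f) (diff Df).
Proof.
move=> Hf; have m1 : measurable_fun setT (fun _ : mR => 1 : R) by exact: measurable_cst.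
have := cutoff_in_L2H1 oO Ooo (M := 1) (Hf true) (Hf false) m1 (fun _ => _).
rewrite normr1 lexx => /(_ (fun _ => isT)).
by congr in_L2H1; apply/funext => t; apply/funext => x; rewrite ?mul1r ?scale1r.
Qed.

Lemma diff_balance xi dxi Dxi : admissible_test_T T Omega xi dxi Dxi ->
  Int sp (fun p => - (((fun p => diff a p.1 p.2) \_ Q) p * dxi p.1 p.2) +
    lam * \sum_i ((fun p => (diff Dmu p.1 p.2) ord0 i) \_ Q) p * Dxi p.1 p.2 ord0 i) = 0.
Proof.
move=> adm; have [/cylinder_L1 I1 E1] := eq1 true adm.
have [/cylinder_L1 I2 E2] := eq1 false adm.
rewrite Rintegral_Int in E1; rewrite Rintegral_Int in E2.
rewrite -[RHS](subrr 0) -[X in _ = X - _]E1 -[X in _ = _ - X]E2 -IntB//.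
apply: eq_Int => -[t x]; rewrite !patchE; case: ifPn => Qp /=; last first.
  rewrite subrr mul0r oppr0 add0r big1 ?mulr0// => i _.
  by rewrite patchE (negbTE Qp) mul0r.
have -> : \sum_i ((fun p => (diff Dmu p.1 p.2) ord0 i) \_ Q) (t, x) * Dxi t x ord0 i =
    dot (Dmu true t x) (Dxi t x) - dot (Dmu false t x) (Dxi t x).
  rewrite /dot -sumrB; apply: eq_bigr => i _; rewrite patchE Qp /= !mxE; ring.
by ring.
Qed.

(** The bounds on a + b and a - b confine a to ]0, 1[ and b to ]-1/2, 1/2[. The resulting bound
    makes the cut-off differences admissible in the equations for mu and b. *)
Lemma diff_bounded : \forall p \ae sp, Q p ->
  `|diff a p.1 p.2| <= 1 /\ `|diff b p.1 p.2| <= 1.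
Proof.
apply: ae_mono2 (range true) (range false) => p H1 H2 Qp.
have [/andP[h1 h2] /andP[h3 h4]] := H1 Qp; have [/andP[l1 l2] /andP[l3 l4]] := H2 Qp.
by split; rewrite ler_norml; apply/andP; split; move: h1 h2 h3 h4 l1 l2 l3 l4; lra.
Qed.

Lemma measurable_chi1 t : measurable_fun setT (chi t : mR -> R).
Proof. exact: measurable_indic. Qed.

Lemma cutoff_admissible t (f : bool -> R -> vec -> R) Df :
  (forall j, in_L2H1 T Omega (f j) (Df j)) ->
  (\forall p \ae sp, Q p -> `|diff f p.1 p.2| <= 1) ->
  admissible_test T Omega (fun s x => chi t s * (f true s x - f false s x))
    (fun s x => chi t s *: (Df true s x - Df false s x)).
Proof.
move=> Hf fb; split.
  have H := cutoff_in_L2H1 oO Ooo (Hf true) (Hf false) (measurable_chi1 t) (chi_bound t).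
  exact: H.
exists 1; apply: ae_mono fb => p H Qp; rewrite normrM -[leRHS]mulr1.
by apply: ler_pM => //; [exact: chi_bound|exact: H].
Qed.

Lemma cutoff_in_L2H1v t : in_L2H1v T Omega (fun s x => chi t s *: (u true s x - u false s x))
  (fun s x => chi t s *: (Du true s x - Du false s x)).
Proof.
move=> i; have := cutoff_in_L2H1 oO Ooo (Hu true i) (Hu false i) (measurable_chi1 t) (chi_bound t).
congr in_L2H1; apply/funext => s; apply/funext => x; first by rewrite !mxE.
by apply/rowP => k; rewrite !mxE.
Qed.

Local Notation patch f := ((fun p : R * vec => f p.1 p.2) \_ Q).
Local Notation patchi f i := ((fun p : R * vec => (f p.1 p.2) ord0 i) \_ Q).

Lemma w_eq_r j : \forall p \ae sp, Q p -> w j p.1 p.2 = r j p.1 p.2.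
Proof. by have H := weak_dt_unique oO (Hw j) (Hr j); exact: H. Qed.

Lemma L2_diff_a : L2 sp (patch (diff a)).
Proof. by have H := diff_in_L2H1 Ha; have [] := in_L2H1_L2 oO H.1 H. Qed.

Lemma L2_diff_b : L2 sp (patch (diff b)).
Proof. by have H := diff_in_L2H1 Hb; have [] := in_L2H1_L2 oO H.1 H. Qed.

Lemma L2_diff_Da i : L2 sp (patchi (diff Da) i).
Proof. by have H := diff_in_L2H1 Ha; have [] := in_L2H1_L2 oO H.1 H. Qed.

Lemma L2_diff_Dmu i : L2 sp (patchi (diff Dmu) i).
Proof. by have H := diff_in_L2H1 Hmu; have [] := in_L2H1_L2 oO H.1 H. Qed.

Lemma L2_diff_r : L2 sp (patch (diff r)).
Proof.
have L j := (in_L2P sp _ mQ).1 (Lr j); have := L2B (L true) (L false).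
by congr (L2 sp _); apply/funext => p; rewrite !patchE; case: ifP => // _; rewrite subrr.
Qed.

Lemma diff_energy t : 0 <= t <= T ->
  Int sp (fun p => chi t p.1 * (patch (diff r) p * patch (diff b) p))
  - 2 * k1 * Int sp (fun p => chi t p.1 * (patch (diff a) p * patch (diff a) p))
  - 2 * k2 * Int sp (fun p => chi t p.1 * (patch (diff b) p * patch (diff b) p))
  + lam * \sum_i Int sp (fun p => chi t p.1 * (patchi (diff Da) i p * patchi (diff Da) i p))
  <= Int sp (fun p => chi t p.1 * (patch (diff a) p * patch (diff mu) p)).
Proof.
move=> tT.
have bda : \forall p \ae sp, Q p -> `|diff a p.1 p.2| <= 1.
  by apply: ae_mono diff_bounded => p H /H[].
have bdb : \forall p \ae sp, Q p -> `|diff b p.1 p.2| <= 1.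
  by apply: ae_mono diff_bounded => p H /H[].
have ta := cutoff_admissible t Ha bda; have tb := cutoff_admissible t Hb bdb.
have [LF1 LG1 EG1] := cylinder_eq (eq2 true ta).
have [LF2 LG2 EG2] := cylinder_eq (eq2 false ta).
have [LH1 EH1] := cylinder_eq0 (eq3 true tb).
have [LH2 EH2] := cylinder_eq0 (eq3 false tb).
have [LS1 ES1] := cylinder_eq0 (eq4 true (cutoff_in_L2H1v t)).
have [LS2 ES2] := cylinder_eq0 (eq4 false (cutoff_in_L2H1v t)).
have Lbb := L1_chi t (L2M L2_diff_b L2_diff_b); have Laa := L1_chi t (L2M L2_diff_a L2_diff_a).
have Lrb := L1_chi t (L2M L2_diff_r L2_diff_b).
have LDa i := L1_chi t (L2M (L2_diff_Da i) (L2_diff_Da i)).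
rewrite -(Int_fsum LDa).
apply: (Int_combination LF1 LF2 LG1 LG2 LH1 LH2 LS1 LS2 EG1 EG2 EH1 EH2 ES1 ES2).
- exact: Lrb.
- exact: Laa.
- exact: Lbb.
- exact: (L1_fsum LDa).
- move=> p Qp; rewrite !(patch_out _ Qp) !mulr0; split => //.
  by rewrite big1// => i _; rewrite (patch_out _ Qp) !mulr0.
- by move=> -[s x] Qp; rewrite !(patch_in _ Qp) /=; ring.
(* The equation for b contains w while the energy uses the square-integrable r; they agree almost
   everywhere in the cylinder. *)
apply: ae_mono2 (ae_mono2 (fun p P P' => conj P P') (range true) (range false))
  (ae_mono2 (fun p P P' => conj P P') (w_eq_r true) (w_eq_r false)) => -[s x] [R1 R2] [W1 W2] Qp.
have W1' := W1 Qp; have W2' := W2 Qp; rewrite /= in W1' W2'.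
rewrite (patch_in (fun p => diff r p.1 p.2) Qp) (patch_in (fun p => diff a p.1 p.2) Qp)
  (patch_in (fun p => diff b p.1 p.2) Qp) /fst /snd -W1' -W2'.
have -> : \sum_i chi t s * (patchi (diff Da) i (s, x) * patchi (diff Da) i (s, x)) =
   \sum_i chi t s * ((Da true s x ord0 i - Da false s x ord0 i) * (Da true s x ord0 i - Da false s x ord0 i)).
  by apply: eq_bigr => i _; rewrite (patch_in _ Qp) /= !mxE.
exact: (pointwise_energy sext hebar hC k1 k2 (w true s x) (w false s x) (Da true s x) (Da false s x)
  (Db true s x) (Db false s x) (indic_nonneg _ _) th0 lam0 (R1 Qp) (R2 Qp) erefl erefl).
Qed.

Lemma patch_diff (f : bool -> R -> vec -> R) t :
  (diff f t) \_ Omega = fun x => ((f true t) \_ Omega) x - ((f false t) \_ Omega) x.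
Proof. by apply/funext => x; rewrite !patchE; case: ifP => // _; rewrite subrr. Qed.

Lemma diff_hoelder (f : bool -> R -> vec -> R) : (forall j, hoelder_L2 4^-1 T Omega (f j)) ->
  (forall t, 0 <= t <= T -> L2 leb ((diff f t) \_ Omega)) /\
  L2_continuous T (fun t => (diff f t) \_ Omega).
Proof.
move=> Hf; have [L1' c1] := hoelder_L2_continuous mO (Hf true).
have [L2' c2] := hoelder_L2_continuous mO (Hf false); split.
  by move=> t tT; rewrite patch_diff; apply: L2B; [exact: L1'|exact: L2'].
have := L2_continuousB L1' L2' c1 c2; congr L2_continuous.
by apply/funext => t; rewrite patch_diff.
Qed.

Lemma diff_eq0 t : 0 <= t <= T ->
  (\forall x \ae leb, ((diff a t) \_ Omega) x = 0) /\
  (\forall x \ae leb, ((diff b t) \_ Omega) x = 0).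
Proof.
have [La ca] := diff_hoelder hoelder_a; have [Lb cb] := diff_hoelder hoelder_b.
have mass0 v Dv (Hv : in_H1 Omega v Dv) s (sT : 0 <= s <= T) :=
  mass_functional_eq0 T0 oO Ooo La ca L2_diff_a L2_diff_Dmu diff_balance Hv sT.
have b00 : \forall x \ae leb, ((diff b 0) \_ Omega) x = 0.
  apply: ae_mono2 (init true) (init false) => x i1 i2; rewrite patchE.
  by case: ifPn => // /set_mem Ox; rewrite i1// i2// subrr.
have bP := weak_dt_primitive T0 oO Ooo (weak_dtB oO (Hr true) (Hr false))
  (patch_L2_L1_cylinder oO Ooo L2_diff_b) (patch_L2_L1_cylinder oO Ooo L2_diff_r)
  L2_diff_r Lb cb b00.
have := energy_uniqueness T0 oO Ooo L2_diff_a L2_diff_Dmu mass0 lam0 k10 k20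
  (diff_in_L2H1 Hmu) (diff_in_L2H1 Ha) L2_diff_b L2_diff_r La Lb ca bP diff_energy.
by apply.
Qed.

Lemma solutions_eq t : 0 <= t <= T -> \forall x \ae leb, Omega x ->
  a true t x = a false t x /\ b true t x = b false t x.
Proof.
move=> /diff_eq0[H1 H2]; apply: ae_mono2 H1 H2 => x E1 E2 Ox.
move: E1 E2; rewrite !(patch_in _ Ox) => /eqP + /eqP.
by rewrite !subr_eq0 => /eqP -> /eqP ->.
Qed.

Lemma solutions_eq_cylinder : \forall p \ae sp, Q p ->
  a true p.1 p.2 = a false p.1 p.2 /\ b true p.1 p.2 = b false p.1 p.2.
Proof.
(* Equality is known at each time for almost every x; measurability of this set carries it over to
   the product measure. *)
pose A : set (mR * vec) := [set p | patch (diff a) p = 0] `&` [set p | patch (diff b) p = 0].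
have m0 (f : R * vec -> R) : L2 sp f -> measurable ([set p | f p = 0] : set (mR * vec)).
  move=> [mf _]; rewrite -[X in measurable X]setTI.
  by apply: (mf measurableT [set 0]); exact: measurable_set1.
have mA : measurable A by apply: measurableI; apply: m0; [exact: L2_diff_a|exact: L2_diff_b].
have HA : \forall p \ae sp, A p.
  apply: (ae_prod1 mA); apply: aeW => t; have [tT|tT] := boolP (0 < t < T); last first.
    by apply: aeW => x; split; exact: patch_cylinder_out.
  have t0T : 0 <= t <= T by case/andP: tT => h1 h2; rewrite !ltW.
  have [H1 H2] := diff_eq0 t0T; apply: ae_mono2 H1 H2 => x E1 E2.
  by split; [exact: etrans (patch_cylinder Omega (diff a) x tT) E1
            |exact: etrans (patch_cylinder Omega (diff b) x tT) E2].
apply: ae_mono HA => p [/= E1 E2] Qp; move: E1 E2; rewrite !(patch_in _ Qp) => /eqP + /eqP.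
by rewrite !subr_eq0 => /eqP -> /eqP ->.
Qed.

(** Once a and b coincide, the stresses differ by C applied to the strain difference E. The
    difference of the elastic equations, tested with the difference of u, has integrand
    [frob E (C E) >= 0] and integral zero, and positive definiteness gives E = 0. *)
Lemma strains_eq : \forall p \ae sp, Q p ->
  sym_part (Du true p.1 p.2 - Du false p.1 p.2) = 0.
Proof.
(* The cutoff at time T equals 1 on the cylinder, so it does not alter the test field there. *)
have [LS1 ES1] := cylinder_eq0 (eq4 true (cutoff_in_L2H1v T)).
have [LS2 ES2] := cylinder_eq0 (eq4 false (cutoff_in_L2H1v T)).
have key : \forall p \ae sp, Q p -> exists2 E : 'M[R]_D,
    E = sym_part (Du true p.1 p.2 - Du false p.1 p.2) &
    (let: (t, x) := p in frob (partial_eps W (d true t x) (eps true t x) - sext)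
      (sym_part (chi T t *: (Du true t x - Du false t x)))) -
    (let: (t, x) := p in frob (partial_eps W (d false t x) (eps false t x) - sext)
      (sym_part (chi T t *: (Du true t x - Du false t x)))) = frob E (C E).
  apply: ae_mono solutions_eq_cylinder => -[s x] Hp Qp.
  have [E1 E2] := Hp Qp; rewrite /= in E1 E2.
  have [sT _] := Qp; move: sT; rewrite /= in_itv/= => /andP[h1 h2].
  have chi1 : chi T s = 1 :> R by rewrite indic_segmentE !ltW.
  have dE : d true s x = d false s x by rewrite /d E1 E2.
  eexists; first by [].
  apply: (etrans (stress_diff C ebar sext (chi T s) (d true s x) (d false s x) (Du true s x) (Du false s x))).
  rewrite chi1 mul1r dE sym_partB.
  by apply: elastic_stress_diff => //; exact: sym_part_tr.
have Z := Int_diff_eq0 LS1 ES1 LS2 ES2.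
apply: ae_mono2 (key) (Z _) => [p Hp Hz Qp|].
  have [E EE FE] := Hp Qp; rewrite -EE.
  apply: (elastic_eq0 hC); first by rewrite EE sym_part_tr.
  exact: etrans (esym FE) (Hz Qp).
apply: ae_mono key => p Hp Qp; have [E EE FE] := Hp Qp.
suff : 0 <= frob E (C E) by move=> h; apply: (le_trans h); rewrite le_eqVlt; apply/orP; left; apply/eqP; exact: esym FE.
apply: (elastic_ge0 hC).
by rewrite EE sym_part_tr.
Qed.

Lemma displacements_rigid : connected Omega -> Omega !=set0 ->
  \forall t \ae leb1, 0 < t < T -> rigid_displacement Omega (fun x => u true t x - u false t x).
Proof.
move=> cO nO.
have HU j : \forall t \ae leb1, forall i, 0 < t < T ->
    in_H1 Omega (fun x => u j t x ord0 i) (fun x => row i (Du j t x)).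
  by apply: ae_forall_fin => i; have [[_ _ H] _] := Hu j i.
apply: ae_mono2 (ae_mono2 (fun t P P' => conj P P') (HU true) (HU false))
  (ae_fubini1 strains_eq) => t [H1 H2] HS tT.
apply: (zero_symmetric_gradient_rigid (Dw := fun x => Du true t x - Du false t x) oO cO nO Ooo).
  move=> i; have := in_H1_lin (-1) oO Ooo (H2 i tT) (H1 i tT).
  congr in_H1; apply/funext => x; first by rewrite !mxE; ring.
  by apply/rowP => k; rewrite !mxE; ring.
apply: ae_mono HS => x Hx Ox; apply: Hx; split => //=.
Qed.

Lemma pair_uniqueness : connected Omega -> Omega !=set0 ->
  [/\ forall t, 0 <= t <= T -> \forall x \ae leb, Omega x ->
        a true t x = a false t x /\ b true t x = b false t x,
      \forall p \ae sp, Q p ->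
        a true p.1 p.2 = a false p.1 p.2 /\ b true p.1 p.2 = b false p.1 p.2 &
      \forall t \ae leb1, 0 < t < T ->
        rigid_displacement Omega (fun x => u true t x - u false t x)].
Proof.
move=> cO nO; split; [exact: solutions_eq|exact: solutions_eq_cylinder|exact: displacements_rigid].
Qed.

End uniqueness.

(** Packs the data of the two solutions into families over [bool], so that the hypotheses on both
    are stated once. *)
Definition either {X : Type} (x y : X) (j : bool) : X := if j then x else y.

(** The elastic terms see u only through its symmetric gradient, and the pure traction condition
    fixes no displacement; uniqueness of u is therefore understood modulo infinitesimal rigid
    displacements. *)
Theorem theorem2 (R : realType) (D : nat) (Omega : set 'rV[R]_D)
    (T lam th k1 k2 : R) (sext ebar : 'M[R]_D)
    (C : {linear 'M[R]_D -> 'M[R]_D}) (a0 b0 : 'rV[R]_D -> R)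
    (hD : (0 < D)%N) (hOmega : lipschitz_domain Omega)
    (hT : 0 < T) (hlam : 0 < lam) (hth : 0 < th) (hk1 : 0 < k1) (hk2 : 0 < k2)
    (hsext : sext^T = sext) (hebar : ebar^T = ebar)
    (hC : elasticity_tensor C)
    (ma0 : measurable_fun Omega a0) (mb0 : measurable_fun Omega b0)
    (hab0 : \forall x \ae @lebesgue_row R D, Omega x ->
       0 <= a0 x + b0 x <= 1 /\ 0 <= a0 x - b0 x <= 1)
    (hu0 : exists (u0 : 'rV[R]_D -> 'rV[R]_D) (Du0 : 'rV[R]_D -> 'M[R]_D),
       elastic_equilibrium (W_lin C ebar) sext Omega
         (fun x => a0 x + b0 x) u0 Du0 /\
       (\int[@lebesgue_row R D]_(x in Omega)
          (W_lin C ebar (a0 x + b0 x) (sym_part (Du0 x)))%:E < +oo)%E)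
    (a1 b1 a2 b2 : R -> 'rV[R]_D -> R) (u1 u2 : R -> 'rV[R]_D -> 'rV[R]_D)
    (sol1 : weak_solution lam th k1 k2 (W_lin C ebar) sext T Omega a0 b0
              a1 b1 u1)
    (reg1 : regularity_class T Omega a1 b1 u1)
    (sol2 : weak_solution lam th k1 k2 (W_lin C ebar) sext T Omega a0 b0
              a2 b2 u2)
    (reg2 : regularity_class T Omega a2 b2 u2) :
  [/\ forall t, 0 <= t <= T ->
        \forall x \ae @lebesgue_row R D, Omega x ->
          a1 t x = a2 t x /\ b1 t x = b2 t x,
      \forall p \ae @spacetime_measure R D, cylinder T Omega p ->
        a1 p.1 p.2 = a2 p.1 p.2 /\ b1 p.1 p.2 = b2 p.1 p.2 &
      \forall t \ae @lebesgue_measure R, 0 < t < T ->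
        rigid_displacement Omega (fun x => u1 t x - u2 t x)].
Proof.
have [nO oO cO bO _] := hOmega.
have Ooo := bounded_lebesgue_lty (open_row_measurable oO) bO.
have [mu1 [w1 [Dmu1 [Da1 [Db1 [Du1 [[i1 R1] [Ha1 Hb1 Hm1 Hu1 Hw1] e11 e12 [e13 e14]]]]]]]] := sol1.
have [mu2 [w2 [Dmu2 [Da2 [Db2 [Du2 [[i2 R2] [Ha2 Hb2 Hm2 Hu2 Hw2] e21 e22 [e23 e24]]]]]]]] := sol2.
have [[ha1 hb1] _ [r1 Lr1 Hr1] [Du1' HL1] _] := reg1.
have [[ha2 hb2] _ [r2 Lr2 Hr2] [Du2' HL2] _] := reg2.
have Hu1' := LooH1v_L2H1v oO Ooo Hu1 HL1.
have Hu2' := LooH1v_L2H1v oO Ooo Hu2 HL2.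
have init j : \forall x \ae @lebesgue_row R D, Omega x -> either b1 b2 j 0 x = b0 x.
  by case: j; [apply: ae_mono i1|apply: ae_mono i2] => x H /H[].
have range j : \forall p \ae @spacetime_measure R D, cylinder T Omega p ->
    0 < either a1 a2 j p.1 p.2 + either b1 b2 j p.1 p.2 < 1 /\
    0 < either a1 a2 j p.1 p.2 - either b1 b2 j p.1 p.2 < 1.
  by case: j; [exact: R1|exact: R2].
have either_P (P : bool -> Prop) : P true -> P false -> forall j, P j by move=> ? ?; case.
have U := pair_uniqueness (sext := sext) (a0 := a0) (a := either a1 a2) (b := either b1 b2) (mu := either mu1 mu2)
  (w := either w1 w2) (r := either r1 r2) (Da := either Da1 Da2) (Db := either Db1 Db2)
  (Dmu := either Dmu1 Dmu2) (u := either u1 u2) (Du := either Du1 Du2)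
  hT oO Ooo hlam hth hk1 hk2 hebar hC init range.
have {}U := U (either_P _ Ha1 Ha2) (either_P _ Hb1 Hb2) (either_P _ Hm1 Hm2).
have {}U := U (either_P _ Hu1' Hu2') (either_P _ Hw1 Hw2) (either_P _ Hr1 Hr2).
have {}U := U (either_P _ Lr1 Lr2) (either_P _ ha1 ha2) (either_P _ hb1 hb2).
have {}U := U (either_P _ e11 e21).
have {}U := U (either_P _ e12 e22).
have {}U := U (either_P _ e13 e23).
have {}U := U (either_P _ e14 e24).
exact: U cO nO.
Qed.
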